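(* Let $G$ be a compact group, with a non-trivial irreducible character $\phi\in\hat G\setminus\{\mathbf{1}\}$, let $w\in F_r$ be a word and fix $m\in\mathbb{N}$. For every sequence $n_1,\dots,n_m\in\mathbb{N}$ satisfying $n_i\ge|w|$ for $i=1,\dots,m$, denote $\chi=\mathrm{Ind}_{n_1,\dots,n_m}\phi\in\widehat{\mathcal{W}_{n_1,\dots,n_m}(G)}$. Then $\mathbb{E}_w[\chi]$ coincides with some rational function in $\mathbb{Q}_G(n_1,\dots,n_m)$, and $$\mathbb{E}_w[\chi]=O\left(\dim(\chi)^{1-\pi(w)}\right),$$ where the implied constant depends on $w$, $m$ and $G$. Moreover, if $\phi$ is a linear character, then $$\mathbb{E}_w[\chi]=(n_1\cdots n_m)^{1-\pi_\phi(w)}\cdot\left(C+O\left(\sum_{i=1}^m n_i^{-1}\right)\right)$$ for some positive integer $C\le|\mathrm{Crit}_\phi(w)|^m$ which depends on $w,m$.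
   Context: $F_r$ is the free group of rank $r$. For a basis $B$ of $F_r$, $|w|_B$ is the length of $w$ written in $B$, and $|w|=\min_B|w|_B$ over all bases $B$ of $F_r$. A linear character is a one-dimensional character. Word measures: for a compact group $G$ and a free group $H$ of finite rank $k$, $\mathrm{Hom}(H,G)\cong G^k$ carries the Haar probability measure $U$. For a class function $f:G\to\mathbb{C}$ and $w\in H$, $\mathbb{E}_{w\to H}[f]=\mathbb{E}_{\alpha\sim U(\mathrm{Hom}(H,G))}[f(\alpha(w))]$, and $\mathbb{E}_w[f]=\mathbb{E}_{w\to F_r}[f]$ for $w\in F_r$. $\hat G$ is the set of irreducible characters of $G$ and $\mathbf{1}$ is the trivial one. An element of a free group $H$ is primitive if it belongs to some basis of $H$. With $H$ ranging over finitely generated subgroups of $F_r$ and $\min\emptyset=\infty$: $\pi(w)=\min\{\mathrm{rk}(H): w\in H\le F_r,\ w\text{ not primitive in }H\}$; for $\phi\in\hat G$, $\phi\neq\mathbf{1}$, $\pi_\phi(w)=\min\{\mathrm{rk}(H):w\in H\le F_r,\ \mathbb{E}_{w\to H}[\phi]\ne0\}$, and $\mathrm{Crit}_\phi(w)$ is the set of such $H$ with $\mathrm{rk}(H)=\pi_\phi(w)$. A power with exponent $-\infty$ is read as $0$. $\mathbb{Q}_G\subseteq\mathbb{C}$ is the field extension of $\mathbb{Q}$ generated by all values $\mathbb{E}_u[\psi]$, for $\psi\in\hat G$ and $u\in F_r$. Wreath product: $G\wr S_n=G^n\rtimes S_n$, whose elements $(v,\sigma)$, $v\in G^n$, $\sigma\in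 S_n$, are thought of as monomial matrices with $(i,j)$ entry $v(i)$ if $\sigma(i)=j$ and $0$ otherwise. For a character $\phi$ of $G$, $\mathrm{Ind}_n\phi$ is the character of $G\wr S_n$ given by $\mathrm{Ind}_n\phi(v,\sigma)=\sum_{i:\sigma(i)=i}\phi(v(i))$. Iterating, $\mathcal{W}_{n_1,\dots,n_m}(G)=(\cdots((G\wr S_{n_1})\wr S_{n_2})\cdots)\wr S_{n_m}$ and $\mathrm{Ind}_{n_1,\dots,n_m}\phi=\mathrm{Ind}_{n_m}\mathrm{Ind}_{n_1,\dots,n_{m-1}}\phi$ (with $\mathrm{Ind}$ over the empty sequence being $\phi$), a character of $\mathcal{W}_{n_1,\dots,n_m}(G)$ of dimension $\phi(1)\,n_1\cdots n_m$; it is irreducible and non-trivial when $\phi\in\hat G\setminus\{\mathbf{1}\}$.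
   Formalization: The bound C ≤ |Crit_φ(w)|^m is claimed only if π_φ(w) < ∞ (otherwise Crit_φ(w) is empty and no positive C exists); φ is fixed with G, so the implied constants and C may depend on φ; Q_G uses words u in free groups of every finite rank; each n_i ≥ 1. *)

(* Defs.v *)
From HB Require Import structures.
From mathcomp Require Import all_boot all_order all_fingroup all_algebra.
From mathcomp Require Import all_classical all_reals all_analysis.
From mathcomp Require Import complex.
From mathcomp Require mpoly.
Set Implicit Arguments.
Unset Strict Implicit.
Unset Printing Implicit Defensive.
Import Order.TTheory GRing.Theory Num.Theory.
Local Open Scope classical_set_scope.
Local Open Scope complex_scope.
Local Open Scope group_scope.

(* [monoid.Group] is the library's class of arbitrary groups; the short name
   is shadowed by a constructor of fingroup. *)
HB.mixin Record isTopGroup G of monoid.Group G & PointedTopological G := {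
  mulg_continuous : continuous (fun p : G * G => p.1 * p.2);
  invg_continuous : continuous (fun g : G => g^-1)
}.

#[short(type="topGroupType")]
HB.structure Definition TopGroup :=
  {G of monoid.Group G & PointedTopological G & isTopGroup G}.

Definition gpow (G : Type) (k : nat) : Type := 'I_k -> G.

HB.instance Definition _ (G : topologicalType) k :=
  Topological.copy (gpow G k) {ptws 'I_k -> G}.

Section PowerTopology.
Variables (G : topologicalType) (k : nat).

Lemma gpow_proj_continuous (i : 'I_k) : continuous (fun a : gpow G k => a i).
Proof. exact: (@proj_continuous _ (fun _ : 'I_k => G) i). Qed.

Lemma gpow_cvg (T : Type) (H : set_system T) (f : T -> gpow G k)
    (a : gpow G k) :
  Filter H -> (forall i, f x i @[x --> H] --> a i) -> f x @[x --> H] --> a.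
Proof.
move=> FH fa; apply/(@cvg_sup _ _ (fun i => Topological.class
  (initial_topology (fun b : {ptws 'I_k -> G} => b i)))) => i U.
case=> V [[W oW <-] Wa WV].
have : nbhs (f x @[x --> H]) (fun b => W (b i)).
  by apply: fa; apply: open_nbhs_nbhs.
by apply: filterS => b Wb; exact: WV.
Qed.

Lemma gpow_continuous (T : topologicalType) (f : T -> gpow G k) :
  (forall i, continuous (fun x => f x i)) -> continuous f.
Proof. by move=> fc x; apply: gpow_cvg => i; exact: fc. Qed.

End PowerTopology.

Section PowerGroup.
Variables (G : topGroupType) (k : nat).
Implicit Types a b c : gpow G k.
Let mul a b : gpow G k := fun i => a i * b i.
Let one : gpow G k := fun=> 1.
Let inv a : gpow G k := fun i => (a i)^-1.
Let mulA : associative mul.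
Proof. by move=> a b c; apply/funext => i; exact: mulgA. Qed.
Let mul1 : left_id one mul.
Proof. by move=> a; apply/funext => i; exact: mul1g. Qed.
Let mulr1 : right_id one mul.
Proof. by move=> a; apply/funext => i; exact: mulg1. Qed.
Let mulV : left_inverse one inv mul.
Proof. by move=> a; apply/funext => i; exact: mulVg. Qed.
Let mulrV : right_inverse one inv mul.
Proof. by move=> a; apply/funext => i; exact: mulgV. Qed.

HB.instance Definition _ := isPointed.Build (gpow G k) one.
HB.instance Definition _ :=
  monoid.isGroup.Build (gpow G k) mulA mul1 mulr1 mulV mulrV.

Let mul_cont : continuous (fun p : gpow G k * gpow G k => p.1 * p.2).
Proof.
have c1 i : continuous (fun q : gpow G k * gpow G k => q.1 i).
  move=> q; apply: (@continuous_comp _ _ _ fst (fun a : gpow G k => a i)).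
    exact: cvg_fst.
  exact: gpow_proj_continuous.
have c2 i : continuous (fun q : gpow G k * gpow G k => q.2 i).
  move=> q; apply: (@continuous_comp _ _ _ snd (fun a : gpow G k => a i)).
    exact: cvg_snd.
  exact: gpow_proj_continuous.
apply: (@gpow_continuous G k _ (fun p : gpow G k * gpow G k => p.1 * p.2)).
move=> i p; apply: (@continuous_comp _ _ _
  (fun q : gpow G k * gpow G k => (q.1 i, q.2 i)) (fun q => q.1 * q.2)).
  exact: (cvg_pair (c1 i p) (c2 i p)).
exact: mulg_continuous.
Qed.

Let inv_cont : continuous (fun a : gpow G k => a^-1).
Proof.
apply: (@gpow_continuous G k _ (fun a : gpow G k => a^-1)).
move=> i a; apply: (@continuous_comp _ _ _ (fun b : gpow G k => b i)
  (fun g => g^-1)).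
  exact: gpow_proj_continuous.
exact: invg_continuous.
Qed.

HB.instance Definition _ := isTopGroup.Build (gpow G k) mul_cont inv_cont.

End PowerGroup.

Definition wreath (G : Type) (n : nat) : Type :=
  (gpow G n * discrete_topology 'S_n)%type.

HB.instance Definition _ (G : topologicalType) n :=
  Topological.copy (wreath G n) (gpow G n * discrete_topology 'S_n)%type.

Section WreathGroup.
Variables (G : topGroupType) (n : nat).
Implicit Types a b c : wreath G n.

(* Product of monomial matrices; in MathComp [(s * t) i = t (s i)]. *)
Let mul a b : wreath G n :=
  (fun i => a.1 i * b.1 ((a.2 : 'S_n) i), (a.2 : 'S_n) * (b.2 : 'S_n)).
Let one : wreath G n := (fun=> 1, 1 : 'S_n).
Let inv a : wreath G n :=
  (fun i => (a.1 (((a.2 : 'S_n)^-1) i))^-1, (a.2 : 'S_n)^-1).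
Let mulA : associative mul.
Proof.
move=> a b c; congr pair; last exact: mulgA.
by apply/funext => i /=; rewrite permM mulgA.
Qed.
Let mul1 : left_id one mul.
Proof.
case=> v s; congr pair; last exact: mul1g.
by apply/funext => i /=; rewrite perm1 mul1g.
Qed.
Let mulr1 : right_id one mul.
Proof.
case=> v s; congr pair; last exact: mulg1.
by apply/funext => i /=; rewrite mulg1.
Qed.
Let mulV : left_inverse one inv mul.
Proof.
move=> a; congr pair; last exact: mulVg.
by apply/funext => i /=; rewrite mulVg.
Qed.
Let mulrV : right_inverse one inv mul.
Proof.
move=> a; congr pair; last exact: mulgV.
by apply/funext => i /=; rewrite permK mulgV.
Qed.

HB.instance Definition _ := isPointed.Build (wreath G n) one.
HB.instance Definition _ :=
  monoid.isGroup.Build (wreath G n) mulA mul1 mulr1 mulV mulrV.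

Let base_cont i : continuous (fun a : wreath G n => a.1 i).
Proof.
move=> a; apply: (@continuous_comp _ _ _
  (fst : wreath G n -> gpow G n) (fun b : gpow G n => b i)).
  exact: (@cvg_fst _ _ (nbhs a.1) (nbhs a.2)).
exact: gpow_proj_continuous.
Qed.

Let near_perm a : \forall b \near a, b.2 = a.2.
Proof.
exact: (@cvg_snd _ _ (nbhs a.1) (nbhs a.2) _ [set s | s = a.2]
  (discrete_set1 a.2)).
Qed.

Let pair_cont (T : topologicalType) (f : T -> wreath G n) x :
  (forall i, (f y).1 i @[y --> x] --> (f x).1 i) ->
  (\forall y \near x, (f y).2 = (f x).2) -> f y @[y --> x] --> f x.
Proof.
move=> f1 f2.
have c1 : (f y).1 @[y --> x] --> (f x).1 by exact: gpow_cvg.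
have c2 : (f y).2 @[y --> x] --> (f x).2.
  by move=> U /nbhs_singleton Ux; apply: filterS f2 => y /= ->.
have -> : f = (fun y => ((f y).1, (f y).2)).
  by apply/funext => y; case: (f y).
exact: (cvg_pair c1 c2).
Qed.

Let mul_cont : continuous (fun p : wreath G n * wreath G n => p.1 * p.2).
Proof.
move=> p.
have p1 : \forall q \near p, q.1.2 = p.1.2 by exact: cvg_fst (near_perm p.1).
have p2 : \forall q \near p, q.2.2 = p.2.2 by exact: cvg_snd (near_perm p.2).
apply: (pair_cont (f := fun p : wreath G n * wreath G n => p.1 * p.2)).
  move=> i; pose s : 'S_n := p.1.2.
  have c1 : q.1.1 i @[q --> p] --> p.1.1 i.
    apply: (@continuous_comp _ _ _ fst (fun a : wreath G n => a.1 i)).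
      exact: cvg_fst.
    exact: base_cont.
  have c2 : q.2.1 (s i) @[q --> p] --> p.2.1 (s i).
    apply: (@continuous_comp _ _ _ snd (fun a : wreath G n => a.1 (s i))).
      exact: cvg_snd.
    exact: base_cont.
  apply: (@cvg_trans _ ((q.1.1 i * q.2.1 (s i)) @[q --> p])).
    by apply: near_eq_cvg; apply: filterS p1 => q /= ->.
  apply: (@continuous_comp _ _ _
    (fun q : wreath G n * wreath G n => (q.1.1 i, q.2.1 (s i)))
    (fun q => q.1 * q.2)); last exact: mulg_continuous.
  exact: (cvg_pair c1 c2).
by apply: filterS2 p1 p2 => q /= -> ->.
Qed.

Let inv_cont : continuous (fun a : wreath G n => a^-1).
Proof.
move=> a; have p1 := near_perm a.
apply: (pair_cont (f := fun a : wreath G n => a^-1)).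
  move=> i; pose s : 'S_n := a.2.
  have e1 : \forall b \near (a : wreath G n),
      ((b : wreath G n).1 ((s^-1) i))^-1 = ((b : wreath G n)^-1).1 i.
    apply: filterS p1 => b bs; have -> : s = b.2 by rewrite bs.
    exact: erefl.
  have c1 : continuous (fun b : wreath G n => (b.1 ((s^-1) i))^-1).
    move=> b; apply: (@continuous_comp _ _ _
      (fun b : wreath G n => b.1 ((s^-1) i)) (fun g => g^-1)).
      exact: base_cont.
    exact: invg_continuous.
  exact: cvg_trans (near_eq_cvg e1) (c1 a).
by apply: filterS p1 => b; exact: (congr1 (fun s : 'S_n => s^-1)).
Qed.

HB.instance Definition _ := isTopGroup.Build (wreath G n) mul_cont inv_cont.

End WreathGroup.

Fixpoint iter_wreath (G : topGroupType) (ns : seq nat) : topGroupType :=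
  if ns is n :: ns' then iter_wreath (wreath G n) ns' else G.

Section InducedCharacters.
Variable R : realType.

(* [(v, s)] stands for the monomial matrix with entry [v i] at [(i, s i)], so
   its diagonal entries are those with [s i = i]. *)
Definition ind (G : topGroupType) (n : nat) (phi : G -> R[i]) :
    wreath G n -> R[i] :=
  fun a => (\sum_(i < n | (a.2 : 'S_n) i == i) phi (a.1 i))%R.

Fixpoint iter_ind (G : topGroupType) (phi : G -> R[i]) (ns : seq nat) :
    iter_wreath G ns -> R[i] :=
  match ns return iter_wreath G ns -> R[i] with
  | [::] => phi
  | n :: ns' => @iter_ind (wreath G n) (@ind G n phi) ns'
  end.

End InducedCharacters.
Arguments iter_ind {R G} phi ns _.

Section Haar.
Variables (R : realType) (K : topGroupType).

Local Notation borel := (g_sigma_algebraType (@open K)).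

(* Left-invariant regular Borel probability measure. On a compact Hausdorff
   group there is exactly one. *)
Definition is_haar (P : probability borel R) :=
  (forall (g : K) (A : set borel), measurable A ->
     P [set g * x | x in (A : set K)] = P A) /\
  (forall A : set borel, measurable A ->
     P A = ereal_inf [set P U | U in [set U : set K | open U /\ A `<=` U]]).

Definition haar : probability borel R :=
  if pselect (exists P, is_haar P) is left h then projT1 (cid h)
  else @dirac _ borel (1 : K) R.

Definition haar_expect (f : K -> R[i]) : R[i] :=
  (\int[haar]_x complex.Re (f x))%R +i* (\int[haar]_x complex.Im (f x))%R.

End Haar.

Section Characters.
Variables (R : realType) (K : topGroupType).

(* [R[i]^o] carries the topology given by the modulus. *)
Definition is_rep d (rho : K -> 'M[R[i]]_d) :=
  [/\ rho 1 = 1%:M%R,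
      forall g h, rho (g * h) = (rho g *m rho h)%R
    & forall i j, continuous (fun g => rho g i j : R[i]^o)].

(* [stablemx] and [row_full] speak of row vectors, acted upon on the right. *)
Definition irreducible_rep d (rho : K -> 'M[R[i]]_d) :=
  (0 < d)%N /\
  forall U : 'M[R[i]]_d, (forall g, stablemx U (rho g)) ->
    U = 0%R \/ row_full U.

Definition irr_char (phi : K -> R[i]) :=
  exists d, exists rho : K -> 'M[R[i]]_d,
    [/\ is_rep rho, irreducible_rep rho & phi = fun g => (\tr (rho g))%R].

Definition linear_char (phi : K -> R[i]) :=
  exists2 rho : K -> 'M[R[i]]_1, is_rep rho & phi = fun g => (\tr (rho g))%R.

End Characters.

(* The letter [(i, e)] stands for the [i]-th generator, inverted if [e]. *)
Definition word k := seq ('I_k * bool).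

Definition reduced k (u : word k) : bool :=
  sorted (fun l l' => ~~ ((l.1 == l'.1) && (l.2 != l'.2))) u.

Definition eval_word (K : groupType) k (g : 'I_k -> K) (u : word k) : K :=
  foldr (fun l a => (if l.2 then (g l.1)^-1 else g l.1) * a) 1 u.

Section FreeGroups.
Variable F : groupType.
Implicit Types (H : set F) (w : F).

Definition free_basis H k (b : 'I_k -> F) :=
  H = range (eval_word b) /\
  (forall u, reduced u -> eval_word b u = 1 -> u = [::]).

Definition fg_subgroup H := exists k (b : 'I_k -> F), H = range (eval_word b).

(* The unique reduced word in the basis [b] representing [w]. *)
Definition word_of k (b : 'I_k -> F) w : word k :=
  xget [::] [set u | reduced u /\ eval_word b u = w].

Definition a_basis H : {k : nat & 'I_k -> F} :=
  if pselect (exists kb : {k : nat & 'I_k -> F}, free_basis H (projT2 kb))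
  is left h then projT1 (cid h) else existT _ 0%N (fun=> 1).

Definition rk H : nat := projT1 (a_basis H).

Definition primitive_in H w :=
  exists k (b : 'I_k -> F) i, free_basis H b /\ b i = w.

(* Minimum in [nat] with infinity as [None]. *)
Definition natmin (A : set nat) : option nat :=
  if pselect (exists n, n \in A) is left h then Some (ex_minn h) else None.

Definition min_length w : nat :=
  odflt 0%N (natmin [set l | exists k (b : 'I_k -> F),
    free_basis setT b /\ l = size (word_of b w)]).

Definition primitivity_rank w : option nat :=
  natmin [set rk H | H in
    [set H | [/\ fg_subgroup H, H w & ~ primitive_in H w]]].

Section WordMeasures.
Variable R : realType.

(* [a : gpow K (rk H)] is the homomorphism [H -> K] sending the chosen basis of
   [H] to [a]. Another basis changes [a] by an automorphism of a free group,
   which preserves Haar measure. *)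
Definition word_expect (K : topGroupType) H w (f : K -> R[i]) : R[i] :=
  let b := projT2 (a_basis H) in
  @haar_expect R (gpow K (rk H)) (fun a => f (eval_word a (word_of b w))).

Definition char_witness (K : topGroupType) (phi : K -> R[i]) w : set (set F) :=
  [set H | [/\ fg_subgroup H, H w & word_expect H w phi <> 0%R]].

Definition char_rank (K : topGroupType) (phi : K -> R[i]) w : option nat :=
  natmin [set rk H | H in char_witness phi w].

Definition crit (K : topGroupType) (phi : K -> R[i]) w : set (set F) :=
  [set H | char_witness phi w H /\ Some (rk H) = char_rank phi w].

End WordMeasures.
End FreeGroups.

(* The subfield of [R[i]] generated by all the word expectations of irreducible
   characters of [K]; words in any finite number of letters are used, so that
   the field depends on [K] only. *)
Definition expect_field (R : realType) (K : topGroupType) : set R[i] :=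
  [set z | forall S : {pred R[i]}, GRing.divring_closed S ->
    (forall k (u : word k) (psi : K -> R[i]), irr_char psi ->
       haar_expect (fun a : gpow K k => psi (eval_word a u)) \in S) ->
    z \in S].
Arguments expect_field R K : clear implicits.

(* [x ^ (1 - p)], read as 0 when [p] is infinite. *)
Definition pow_one_minus (C : unitRingType) (x : C) (p : option nat) : C :=
  (if p is Some k then x ^ (1 - k%:Z) else 0)%R.

(* Main.v *)
Require Import Defs.
From HB Require Import structures.
From mathcomp Require Import all_boot all_order all_fingroup all_algebra.
From mathcomp Require Import all_classical all_reals all_analysis.
From mathcomp Require Import complex.
From mathcomp Require mpoly.
From mathcomp Require Import zify ring lra.
Set Implicit Arguments.
Unset Strict Implicit.
Unset Printing Implicit Defensive.
Import Order.TTheory GRing.Theory Num.Theory.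
Import numFieldNormedType.Exports.
Import (canonicals) mpoly.

(** Let [b] be a basis of the free group in which [w] is spelled by a word [u] of
    least length, and write [Ew psi u] for the expectation of [psi] at the value
    of [u] on independent Haar random elements. The proof rests on four facts.

    Basis independence ([Ew_basis]): [Ew psi u] depends only on the element
    spelled by [u] in a basis of a free group, not on the basis. This is
    proved by Stallings folding: a tuple of words that generates a free group
    of the same rank is subdivided into single edges of a labelled graph, and
    each fold is a change of variables that preserves Haar measure
    ([generating_measure_preserving]).

    Expansion ([Ew_ind]): for the character of [K] wr ['S_n] induced from [psi],
    the value at a word is a sum over the closed trajectories of the word on
    ['I_n]. A trajectory is a walk along a connected graph whose vertices are
    the points visited; sorted by their isomorphism types [c], the trajectories
    give
      [Ew (ind psi) u = \sum_c type_coef c n * Ew psi (sub_word c)],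
    where [sub_word c] spells the walk in a basis of the fundamental group of
    the graph, of rank [sub_rank c], and where [type_coef c n] is a quotient of
    falling factorials, of order [n ^ (1 - sub_rank c)]. In terms of [w]: the
    fundamental group of the graph is a subgroup [sub_group b c] that contains
    [w], and [sub_word c] is [w] in a basis of it. Iterating, the expectation
    of [iter_ind phi ns] is a finite sum of products of such coefficients with
    values [Ew phi v], where [v] spells [w] in a basis of some subgroup. As the
    falling factorials involved have at most [size u] factors, the denominators
    do not vanish once every entry of [ns] is at least [size u]; hence the
    rational function ([rat_fun_iter]).

    Vanishing: if [w] is primitive in the subgroup then [Ew phi v] is the mean
    of [phi], which is zero by Schur's argument ([haar_irr]). So only subgroups
    of rank at least the primitivity rank contribute, each to the order stated
    ([wreath_iter_bound]).

    Linear characters: [Ew phi v] is [1] or [0], according to whether [phi]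
    kills all values of [v], so the leading coefficient counts chains of types
    of rank [char_rank phi w], which are critical subgroups
    ([wreath_iter_lead]). A type is determined by its subgroup
    ([sub_group_inj]), whence the upper bound. Conversely [w] has a type on the
    cosets of every critical subgroup [H]; its subgroup is a retract of [H]
    that still sees [phi] ([coset_retract]), so by minimality it is [H]
    itself. Hence the coefficient is positive and [crit phi w] is finite. *)

(** * Haar measure of a compact group *)

Section HaarConstruction.
Local Open Scope classical_set_scope.
Local Open Scope group_scope.
Variables (R : realType) (K : topGroupType).
Hypothesis K_compact : compact [set: K].
Implicit Types (A B C O V W : set K) (g h x y : K).

Lemma mulgl_continuous g : continuous (fun x : K => g * x).
Proof.
move=> x; apply: (@continuous_comp _ _ _ (fun x : K => (g, x)) (fun p : K * K => p.1 * p.2)).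
  exact: (cvg_pair (cvg_cst g) cvg_id).
exact: mulg_continuous.
Qed.

Lemma translateK g A : [set g^-1 * x | x in [set g * x | x in A]] = A.
Proof.
apply/seteqP; split=> [_ [_ [x Ax <-] <-]|x Ax]; first by rewrite mulKg.
by exists (g * x); [exists x|rewrite mulKg].
Qed.

Lemma nbhs_translate V x : nbhs (1 : K) V -> nbhs x [set y | V (x^-1 * y)].
Proof.
move=> V1; have := @mulgl_continuous (x^-1) x V.
by rewrite mulVg => /(_ V1).
Qed.

Definition covers V A (s : seq K) :=
  forall x, A x -> has (fun g => `[< V (g^-1 * x) >]) s.

Lemma has_cover V : nbhs (1 : K) V -> exists s, covers V setT s.
Proof.
move=> V1.
have := K_compact; rewrite compact_cover => /(_ K setT
  (fun g => [set y | V (g^-1 * y)]^°)).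
case=> [g _| x _|D _ cov]; first exact: open_interior.
  by exists x => //; apply: nbhs_translate.
exists (finmap.enum_fset D) => x Ax; have [g Dg /interior_subset Vx] := cov x Ax.
by apply/hasP; exists g => //; exact/asboolP.
Qed.

(** The index [(A : V)] of Haar's construction. *)
Definition cov_num V A : nat := xget 0%N [set n |
  (exists2 s, covers V A s & size s = n) /\
  forall s, covers V A s -> (n <= size s)%N].

Lemma cov_numP V A : nbhs (1 : K) V ->
  (exists2 s, covers V A s & size s = cov_num V A) /\
  forall s, covers V A s -> (cov_num V A <= size s)%N.
Proof.
move=> V1; apply: (@xgetPex _ 0%N [set n | (exists2 s, covers V A s & size s = n) /\
  forall s, covers V A s -> (n <= size s)%N]).
have ex : exists n, `[< exists2 s, covers V A s & size s = n >].
  have [s sc] := has_cover V1; exists (size s); apply/asboolP; exists s => //.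
  by move=> x _; exact: sc.
case: (ex_minnP ex) => n /asboolP nP nmin; exists n; split => // s sc.
by apply: nmin; apply/asboolP; exists s.
Qed.

Lemma cov_num_le V A B : nbhs (1 : K) V -> A `<=` B ->
  (cov_num V A <= cov_num V B)%N.
Proof.
move=> V1 AB; have [[s sc <-] _] := cov_numP B V1.
by apply: (cov_numP A V1).2 => x /AB; exact: sc.
Qed.

Lemma cov_numU V A B : nbhs (1 : K) V ->
  (cov_num V (A `|` B) <= cov_num V A + cov_num V B)%N.
Proof.
move=> V1; have [[s sc <-] _] := cov_numP A V1.
have [[t tc <-] _] := cov_numP B V1; rewrite -size_cat.
apply: (cov_numP _ V1).2 => x; rewrite has_cat.
by case=> [/sc ->//|/tc ->]; rewrite orbT.
Qed.

(** A translate of [V] that meets both sets would violate the hypothesis, so a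
    cover of the union splits into a cover of [A] and a cover of [B]. *)
Lemma cov_numU_sep V A B : nbhs (1 : K) V ->
  (forall g x y, A x -> B y -> V (g^-1 * x) -> V (g^-1 * y) -> False) ->
  (cov_num V A + cov_num V B <= cov_num V (A `|` B))%N.
Proof.
move=> V1 sep; have [[s sc <-] _] := cov_numP (A `|` B) V1.
pose meets C := fun g => `[< exists2 x, C x & V (g^-1 * x) >].
have meetsP C : C `<=` A `|` B -> (cov_num V C <= size [seq g <- s | meets C g])%N.
  move=> CAB; apply: (cov_numP C V1).2 => x Cx.
  have /hasP[g gs /asboolP Vg] := sc x (CAB x Cx).
  apply/hasP; exists g; last exact/asboolP.
  by rewrite mem_filter gs andbT; apply/asboolP; exists x.
have AU : A `<=` A `|` B by move=> x; left.
have BU : B `<=` A `|` B by move=> x; right.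
apply: leq_trans (leq_add (meetsP A AU) (meetsP B BU)) _.
rewrite !size_filter -count_predUI (@eq_count _ (predI _ _) pred0) ?count_pred0 ?addn0.
  exact: count_size.
move=> g /=; apply/negP => /andP[/asboolP[x Ax Vx] /asboolP[y By Vy]].
exact: sep Ax By Vx Vy.
Qed.

Lemma cov_num_translate V A g : nbhs (1 : K) V ->
  cov_num V [set g * x | x in A] = cov_num V A.
Proof.
move=> V1; suff le h B : (cov_num V [set (h * x)%g | x in B] <= cov_num V B)%N.
  apply/eqP; rewrite eqn_leq le /=.
  by rewrite -{1}(translateK g A) le.
have [[s sc <-] _] := cov_numP B V1; have -> : size s = size [seq h * x | x <- s] by rewrite size_map.
apply: (cov_numP _ V1).2 => _ [x Bx <-]; have /hasP[k ks Vk] := sc x Bx.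
apply/hasP; exists (h * k); first exact: map_f.
by rewrite invMg -mulgA mulKg.
Qed.

Lemma cov_num_gt0 V A x : nbhs (1 : K) V -> A x -> (0 < cov_num V A)%N.
Proof.
move=> V1 Ax; have [[s sc <-] _] := cov_numP A V1.
by case: s sc => // /(_ x Ax).
Qed.

Lemma cov_num0 V : nbhs (1 : K) V -> cov_num V set0 = 0%N.
Proof.
by move=> V1; apply/eqP; rewrite -leqn0; apply: ((cov_numP _ V1).2 [::]) => x.
Qed.

Definition cov_ratio V A : R := ((cov_num V A)%:R / (cov_num V setT)%:R)%R.

(** The limit along ever smaller neighbourhoods of the identity is taken along
    an ultrafilter, so that it exists for all sets at once. *)
Let Uex := ultraFilterLemma (powerset_filter_from_filter (nbhs_pfilter (1 : K))).
Let U := projT1 (cid Uex).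
Let U_ultra : UltraFilter U := (projT2 (cid Uex)).1.
Let U_small P : (\forall V \near powerset_filter_from (nbhs (1 : K)), P V) -> U P.
Proof. exact: (projT2 (cid Uex)).2. Qed.
Local Instance U_proper : ProperFilter U.
Proof. exact: ultra_proper. Qed.

Let U_nbhs : \forall V \near U, nbhs (1 : K) V.
Proof. exact/U_small/near_small_set. Qed.

Let ratio_itv V A : nbhs (1 : K) V -> (0 <= cov_ratio V A <= 1)%R.
Proof.
move=> V1; rewrite divr_ge0 //= ler_pdivrMr ?mul1r ?ler_nat ?cov_num_le //.
by rewrite ltr0n (@cov_num_gt0 _ _ 1).
Qed.

Definition content A : R := lim (cov_ratio V A @[V --> U]).

Lemma content_cvg A : cov_ratio V A @[V --> U] --> content A.
Proof.
apply/cvg_ex.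
have [|l [_ cl]] := @segment_compact R 0%R 1%R _ (fmap_proper_filter (cov_ratio ^~ A) U_proper).
  by apply: filterS U_nbhs => V V1; rewrite /= in_itv /= ratio_itv.
exists l => D Dl; have [//|nD] := in_ultra_setVsetC [set V | D (cov_ratio V A)] U_ultra.
by have [t []] := cl (~` D) D nD Dl.
Qed.

Lemma content_ge0 A : (0 <= content A)%R.
Proof.
apply: (cvgr_to_ge (@content_cvg A)).
by apply: filterS U_nbhs => V V1; case/andP: (ratio_itv A V1).
Qed.

Let ler_lim_to (f g : set K -> R) (l l' : R) : f V @[V --> U] --> l ->
  g V @[V --> U] --> l' -> (\forall V \near U, (f V <= g V)%R) -> (l <= l')%R.
Proof.
move=> fl gl fg; rewrite -subr_ge0; apply: (cvgr_to_ge (cvgB gl fl)).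
by apply: filterS fg => V; rewrite subr_ge0.
Qed.

Let content_eq A (g : set K -> R) (l : R) : g V @[V --> U] --> l ->
  (forall V, nbhs (1 : K) V -> cov_ratio V A = g V) -> content A = l.
Proof.
move=> gl gA; apply/eqP; rewrite eq_le (ler_lim_to (@content_cvg A) gl) ?(ler_lim_to gl (@content_cvg A)) //.
  by apply: filterS U_nbhs => V /gA ->.
by apply: filterS U_nbhs => V /gA ->.
Qed.

Lemma content0 : content set0 = 0%R.
Proof.
by apply: (content_eq (cvg_cst 0%R)) => V V1; rewrite /cov_ratio cov_num0 // mul0r.
Qed.

Lemma contentT : content setT = 1%R.
Proof.
apply: (content_eq (cvg_cst (1%R : R))) => V V1.
by rewrite /cov_ratio divff // pnatr_eq0 -lt0n (@cov_num_gt0 _ _ 1).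
Qed.

Lemma content_translate g A : content [set g * x | x in A] = content A.
Proof.
by apply: (content_eq (@content_cvg A)) => V V1; rewrite /cov_ratio cov_num_translate.
Qed.

Lemma content_le A B : A `<=` B -> (content A <= content B)%R.
Proof.
move=> AB; apply: (ler_lim_to (@content_cvg A) (@content_cvg B)).
apply: filterS U_nbhs => V V1.
by rewrite ler_wpM2r ?invr_ge0 // ler_nat cov_num_le.
Qed.

Lemma contentU A B : (content (A `|` B)%classic <= content A + content B)%R.
Proof.
apply: (ler_lim_to (@content_cvg _) (cvgD (@content_cvg A) (@content_cvg B))).
apply: filterS U_nbhs => V V1.
by rewrite -mulrDl ler_wpM2r ?invr_ge0 // -natrD ler_nat cov_numU.
Qed.

(** Additivity holds only for sets kept apart by a neighbourhood [W] of the
    identity: then [cov_numU_sep] applies to all small enough [V]. *)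
Lemma contentU_sep A B W : nbhs (1 : K) W ->
  (forall x w, B x -> W w -> ~ A (x * w)) ->
  (content A + content B <= content (A `|` B))%R.
Proof.
move=> W1 sep.
apply: (ler_lim_to (cvgD (@content_cvg A) (@content_cvg B)) (@content_cvg _)).
have VW : \forall V \near U, forall v v', V v -> V v' -> W (v^-1 * v').
  have : nbhs ((1 : K), (1 : K)) [set p | W (p.1^-1 * p.2)].
    have : continuous (fun p : K * K => p.1^-1 * p.2).
      move=> p; apply: (@continuous_comp _ _ _ (fun p : K * K => (p.1^-1, p.2))
        (fun p : K * K => p.1 * p.2)); last exact: mulg_continuous.
      apply: cvg_pair; last exact: cvg_snd.
      apply: (@continuous_comp _ _ _ fst (fun x : K => x^-1)); first exact: cvg_fst.
      exact: invg_continuous.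
    by move/(_ (1, 1)); apply; rewrite /= invg1 mul1g.
  case=> -[P Q] [/= P1 Q1] PQ; apply: U_small.
  apply: filterS (small_set_sub (filterI P1 Q1)) => V VPQ v v' /VPQ[Pv _] /VPQ[_ Qv'].
  by apply: (PQ (v, v')).
apply: filterS2 U_nbhs VW => V V1 VW.
rewrite -mulrDl ler_wpM2r ?invr_ge0 // -natrD ler_nat cov_numU_sep // => g x y Ax By Vx Vy.
apply: (sep y ((g^-1 * y)^-1 * (g^-1 * x))) => //; first exact: VW.
by rewrite invMg invgK -!mulgA !mulVKg.
Qed.

(** Being well inside replaces the compact subsets of the classical
    construction: it keeps [A] away from the complement of [O] uniformly, and
    is inherited by unions and subsets without any separation axiom. *)
Definition well_inside O : set (set K) :=
  [set A | exists2 W, nbhs (1 : K) W & forall x w, A x -> W w -> O (x * w)].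

Lemma well_inside_sub O A : well_inside O A -> A `<=` O.
Proof. by case=> W /nbhs_singleton W1 AW x Ax; rewrite -[x]mulg1; exact: AW. Qed.

Lemma well_inside_closure O A : well_inside O A -> closure A `<=` O.
Proof.
case=> W W1 AW x clA.
have : nbhs x [set y | W (y^-1 * x)].
  have := @invg_continuous K 1 W; rewrite invg1 => /(_ W1) W1'.
  by apply: filterS (nbhs_translate x W1') => y /=; rewrite invMg invgK.
by case/clA => y [Ay /= Wy]; have := AW _ _ Ay Wy; rewrite mulVKg.
Qed.

(** The inner measure of an open set; the outer measure derived from it below
    is Haar measure. *)
Definition inner O : \bar R := ereal_sup [set (content A)%:E | A in well_inside O].

Lemma inner_ge O A : well_inside O A -> ((content A)%:E <= inner O)%E.
Proof. by move=> OA; apply: ereal_sup_ubound; exists A. Qed.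

Lemma inner_le O (x : \bar R) : (forall A, well_inside O A -> ((content A)%:E <= x)%E) ->
  (inner O <= x)%E.
Proof. by move=> H; apply: ub_ereal_sup => _ [A OA <-]; exact: H. Qed.

Lemma inner_ge0 O : (0 <= inner O)%E.
Proof.
apply: (@le_trans _ _ (content set0)%:E); first by rewrite lee_fin content_ge0.
by apply: inner_ge; exists setT => //; exact: filterT.
Qed.

Lemma inner_le1 O : (inner O <= 1)%E.
Proof. by apply: inner_le => A _; rewrite lee_fin -contentT content_le. Qed.

Lemma inner_fin O : inner O \is a fin_num.
Proof.
by rewrite ge0_fin_numE ?inner_ge0 // (le_lt_trans (inner_le1 O)) ?ltry.
Qed.

Lemma le_inner O O' : O `<=` O' -> (inner O <= inner O')%E.
Proof.
by move=> OO'; apply: inner_le => A [W W1 AW]; apply: inner_ge; exists W => // x w Ax /AW -/(_ _ Ax) /OO'.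
Qed.

Lemma content_bigcup n (F : nat -> set K) :
  (content (\big[setU/set0]_(i < n) F i) <= \sum_(i < n) content (F i))%R.
Proof.
elim: n => [|n IH]; first by rewrite !big_ord0 content0.
by rewrite !big_ord_recr /=; apply: le_trans (contentU _ _) _; rewrite lerD2r.
Qed.

(** Compactness of the closure of [A] gives finitely many [O n] and one
    neighbourhood [W] of the identity that serve all points of [A] at once. *)
Lemma inner_bigcup (O : nat -> set K) : (forall n, open (O n)) ->
  (inner (\bigcup_n O n) <= \sum_(n <oo) inner (O n))%E.
Proof.
move=> Oop; apply: inner_le => A OA.
have cpt : compact (closure A).
  by apply: subclosed_compact K_compact _ => //; exact: closed_closure.
have /near_covering_withinP := (compact_near_coveringP _).1 cpt.
move/(_ _ (filter_prod \oo (powerset_filter_from (nbhs (1 : K))))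
  (fun NW x => exists2 n, (n < NW.1)%N & forall w, NW.2 w -> O n (x * w)) _).
case=> [x clx|].
  have [n _ Onx] := well_inside_closure OA clx.
  have /= := @mulg_continuous K (x, 1) (O n).
  rewrite /= mulg1 => /(_ (open_nbhs_nbhs (conj (Oop n) Onx))).
  case=> -[P Q] [/= Px Q1] PQ.
  exists (P, [set NW | (n < NW.1)%N /\ NW.2 `<=` Q]).
    split => //=; exists ([set N | (n < N)%N], [set W | W `<=` Q]) => //=.
    by split; [exists n.+1|exact: small_set_sub].
  case=> y [N W] /= [Py [nN WQ]] _; exists n => // w /WQ Qw.
  exact: (PQ (y, w)).
case=> P Q [/= P1 P2].
have /filter_ex[N PN] := P1; have /filter_ex[W [QW W1]] : (\forall W \near powerset_filter_from (nbhs (1 : K)), Q W /\ nbhs (1 : K) W).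
  exact: filterI P2 (near_small_set _).
move=> /(_ (N, W) (conj PN QW)) /= cov.
pose C n := [set x | forall w, W w -> O n (x * w)].
have CO n : well_inside (O n) (C n) by exists W => // x w; apply.
have AC : A `<=` \big[setU/set0]_(i < N) C i.
  move=> x Ax; have [n nN On] := cov x (subset_closure Ax).
  by rewrite -bigcup_mkord; exists n.
have := le_trans (content_le AC) (content_bigcup N C); rewrite -lee_fin => /le_trans; apply.
rewrite -sumEFin; apply: le_trans (nneseries_lim_ge N _); last by move=> n _ _; exact: inner_ge0.
by rewrite big_mkord; apply: lee_sum => i _; exact: inner_ge.
Qed.

Definition haar_outer A : \bar R :=
  ereal_inf [set inner O | O in [set O | open O /\ A `<=` O]].

Lemma haar_outer_le A O : open O -> A `<=` O -> (haar_outer A <= inner O)%E.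
Proof. by move=> Oop AO; apply: ereal_inf_lbound; exists O. Qed.

Lemma haar_outer_ge A (x : \bar R) :
  (forall O, open O -> A `<=` O -> (x <= inner O)%E) -> (x <= haar_outer A)%E.
Proof. by move=> H; apply: le_ereal_inf_tmp => _ [ O [Oop AO] <-]; exact: H. Qed.

Lemma haar_outer_open O : open O -> haar_outer O = inner O.
Proof.
move=> Oop; apply/eqP; rewrite eq_le haar_outer_le //=.
by apply: haar_outer_ge => O' _; exact: le_inner.
Qed.

Let outer0 : haar_outer set0 = 0%E.
Proof.
rewrite haar_outer_open; last exact: open0.
apply/eqP; rewrite eq_le inner_ge0 andbT; apply: inner_le => A /well_inside_sub.
by rewrite subset0 => ->; rewrite content0.
Qed.

Let outer_ge0 A : (0 <= haar_outer A)%E.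
Proof. by apply: haar_outer_ge => O _ _; exact: inner_ge0. Qed.

Let le_outer A B : A `<=` B -> (haar_outer A <= haar_outer B)%E.
Proof.
by move=> AB; apply: haar_outer_ge => O Oop BO; apply: haar_outer_le => // x /AB /BO.
Qed.

Let outer_fin A : haar_outer A \is a fin_num.
Proof.
rewrite ge0_fin_numE //.
apply: le_lt_trans (haar_outer_le openT (@subsetT _ _)) _.
by apply: le_lt_trans (inner_le1 _) _; rewrite ltry.
Qed.

Let outer_sigma : sigma_subadditive haar_outer.
Proof.
move=> F; apply/lee_addgt0Pr => e e0.
apply: le_trans (epsilon_trick xpredT (fun n => outer_ge0 (F n)) (ltW e0)).
have /choice[ O OP] : forall n, exists O, [/\ open O, F n `<=` O &
    (inner O <= haar_outer (F n) + (e / (2 ^ n.+1)%:R)%:E)%E].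
  move=> n; have d0 : (0 < e / (2 ^ n.+1)%:R)%R by rewrite divr_gt0 // ltr0n expn_gt0.
  have [_ [ O [Oop FO] <-] /ltW lt] := lb_ereal_inf_adherent d0 (outer_fin (F n)).
  by exists O.
apply: le_trans (haar_outer_le (O := \bigcup_n O n) _ _) _.
- by apply: bigcup_open => n _; have [] := OP n.
- by apply: subset_bigcup => n _; have [] := OP n.
apply: le_trans (inner_bigcup _) _; first by move=> n; have [] := OP n.
by apply: lee_nneseries => n *; [exact: inner_ge0|have [] := OP n].
Qed.

HB.instance Definition _ :=
  isOuterMeasure.Build R K haar_outer outer0 outer_ge0 le_outer outer_sigma.

(** Exhaust [O' `&` O] by [C], and the part of [O'] outside the closure of [C]
    by [C2]; that part covers what [A] has outside [O]. As [C] and [C2] are kept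
    apart, their contents add up to at most that of [O']. *)
Lemma open_caratheodory O : open O -> haar_outer.-caratheodory O.
Proof.
move=> Oop; apply: le_caratheodory_measurable => A.
apply: haar_outer_ge => O' O'op AO'; apply/lee_addgt0Pr => e e0.
have e20 : (0 < e / 2)%R by rewrite divr_gt0.
have [_ [C [W W1 CW] <-] lt1] := ub_ereal_sup_adherent e20 (inner_fin (O' `&` O)).
have CI : well_inside (O' `&` O) C by exists W.
pose O2 := O' `&` ~` closure C.
have O2op : open O2 by apply: openI => //; exact/closed_openC/closed_closure.
have [_ [C2 [W2 W21 CW2] <-] lt2] := ub_ereal_sup_adherent e20 (inner_fin O2).
have le1 : (content C + content C2 <= content (C `|` C2))%R.
  apply: (contentU_sep W21) => x w Cx Ww Cxw.
  by have [_ []] := CW2 _ _ Cx Ww; exact: subset_closure.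
have le2 : ((content (C `|` C2))%:E <= inner O')%E.
  apply: inner_ge; exists (W `&` W2); first exact: filterI.
  by move=> x w [Cx|Cx] [Ww Ww2]; [case: (CW _ _ Cx Ww)|case: (CW2 _ _ Cx Ww2)].
have le3 : (haar_outer (A `&` O) + haar_outer (A `&` ~` O) <= inner (O' `&` O) + inner O2)%E.
  apply: leeD; apply: haar_outer_le => //; first exact: openI.
    by apply: setSI.
  move=> x [/AO' O'x nOx]; split => // /(well_inside_closure CI)[_ Ox].
  exact: nOx.
apply: le_trans le3 _; apply: le_trans (leeD2r _ le2).
have [r1 E1] : exists r, inner (O' `&` O) = r%:E.
  by exists (fine (inner (O' `&` O))); rewrite fineK ?inner_fin.
have [r2 E2] : exists r, inner O2 = r%:E.
  by exists (fine (inner O2)); rewrite fineK ?inner_fin.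
move: lt1 lt2; rewrite -!/(inner _) E1 E2 -!EFinB !lte_fin -!EFinD lee_fin.
by move: le1; lra.
Qed.

Local Notation borel := (g_sigma_algebraType (@open K)).

Lemma borel_caratheodory (A : set borel) :
  measurable A -> haar_outer.-caratheodory A.
Proof.
move=> mA; suff : <<s (@open K) >> `<=` haar_outer.-cara.-measurable by exact.
by apply: smallest_sub; [exact: sigma_algebra_measurable|exact: open_caratheodory].
Qed.

Definition haar_measure (A : set borel) : \bar R := haar_outer A.

Let measure0' : haar_measure set0 = 0%E. Proof. exact: outer0. Qed.
Let measure_ge0' A : (0 <= haar_measure A)%E. Proof. exact: outer_ge0. Qed.
Let measure_sigma : semi_sigma_additive haar_measure.
Proof.
move=> F mF tF mU.
apply: (@caratheodory_measure_sigma_additive R K haar_outer F) => //.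
  by move=> i; exact: borel_caratheodory.
exact: borel_caratheodory.
Qed.
HB.instance Definition _ :=
  isMeasure.Build _ borel R haar_measure measure0' measure_ge0' measure_sigma.

Let measureT : haar_measure setT = 1%E.
Proof.
rewrite /haar_measure haar_outer_open; last exact: openT.
apply/eqP; rewrite eq_le inner_le1 -contentT; apply: inner_ge.
by exists setT => //; exact: filterT.
Qed.
HB.instance Definition _ := Measure_isProbability.Build _ borel R haar_measure measureT.

Lemma translate_open g O : open O -> open [set g * x | x in O].
Proof.
move=> Oop; have -> : [set g * x | x in O] = (fun x => g^-1 * x) @^-1` O.
  apply/seteqP; split=> [_ [x Ox <-]|x /= Ox]; first by rewrite /= mulKg.
  by exists (g^-1 * x) => //; rewrite mulKVg.
by apply: open_comp => // x _; exact: mulgl_continuous.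
Qed.

Lemma haar_outer_translate g A :
  haar_outer [set g * x | x in A] = haar_outer A.
Proof.
suff le h B : (haar_outer [set (h * x)%g | x in B] <= haar_outer B)%E.
  apply/eqP; rewrite eq_le le /=.
  by rewrite -{1}(translateK g A) le.
apply: haar_outer_ge => O Oop BO.
apply: (@le_trans _ _ (inner [set h * x | x in O])).
  apply: haar_outer_le; first exact: translate_open.
  by move=> _ [x /BO Ox <-]; exists x.
apply: inner_le => C [W W1 CW]; rewrite -(content_translate h^-1); apply: inner_ge.
exists W => // _ w [x Cx <-] Ww; have [y Oy xw] := CW _ _ Cx Ww.
by rewrite -mulgA -xw mulKg.
Qed.

Theorem haar_exists : exists P : probability borel R, is_haar P.
Proof.
exists haar_measure; split=> [g A _|A mA]; first exact: haar_outer_translate.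
rewrite /haar_measure /haar_outer; congr ereal_inf.
apply/seteqP; split=> _ [ O [Oop AO] <-]; exists O => //.
  exact: (haar_outer_open Oop).
exact: (esym (haar_outer_open Oop)).
Qed.

End HaarConstruction.

(** * Haar expectation of continuous complex functions *)

Section ComplexContinuity.
Local Open Scope classical_set_scope.
Local Open Scope complex_scope.
Local Open Scope ring_scope.
Variable R : realType.
Implicit Types (z : R[i]).

Lemma ReD (x y : R[i]) : complex.Re (x + y) = complex.Re x + complex.Re y.
Proof. by case: x y => [a b] [c d]. Qed.
Lemma ImD (x y : R[i]) : complex.Im (x + y) = complex.Im x + complex.Im y.
Proof. by case: x y => [a b] [c d]. Qed.
Lemma ReM (x y : R[i]) :
  complex.Re (x * y) = complex.Re x * complex.Re y - complex.Im x * complex.Im y.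
Proof. by case: x y => [a b] [c d]. Qed.
Lemma ImM (x y : R[i]) :
  complex.Im (x * y) = complex.Re x * complex.Im y + complex.Im x * complex.Re y.
Proof. by case: x y => [a b] [c d]. Qed.

(** Real and imaginary parts are what integration needs; [ccontP] derives this
    from continuity for the modulus. *)
Definition ccont (T : topologicalType) (f : T -> R[i]) :=
  continuous (fun x => complex.Re (f x)) /\ continuous (fun x => complex.Im (f x)).

Section Closure.
Variable T : topologicalType.
Implicit Types f g : T -> R[i].

Lemma ccont_cst z : ccont (fun _ : T => z).
Proof. by split=> x; exact: cvg_cst. Qed.

Lemma ccontD f g : ccont f -> ccont g -> ccont (fun x => f x + g x).
Proof.
move=> [f1 f2] [g1 g2]; split=> x.
  under eq_fun do rewrite ReD.
  exact: (cvgD (f1 x) (g1 x)).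
under eq_fun do rewrite ImD.
exact: (cvgD (f2 x) (g2 x)).
Qed.

Lemma ccontM f g : ccont f -> ccont g -> ccont (fun x => f x * g x).
Proof.
move=> [f1 f2] [g1 g2]; split=> x.
  under eq_fun do rewrite ReM.
  exact: (cvgB (cvgM (f1 x) (g1 x)) (cvgM (f2 x) (g2 x))).
under eq_fun do rewrite ImM.
exact: (cvgD (cvgM (f1 x) (g2 x)) (cvgM (f2 x) (g1 x))).
Qed.

Lemma ccont_sum (I : Type) (s : seq I) (P : pred I) (F : I -> T -> R[i]) :
  (forall i, P i -> ccont (F i)) -> ccont (fun x => \sum_(i <- s | P i) F i x).
Proof.
move=> FP; elim: s => [|i s IH].
  have -> : (fun x => \sum_(i <- [::] | P i) F i x) = fun=> 0.
    by apply/funext => x; exact: big_nil.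
  exact: ccont_cst.
have -> : (fun x => \sum_(i <- i :: s | P i) F i x) = fun x =>
  (if P i then F i x else 0) + \sum_(i <- s | P i) F i x; last first.
  by apply: ccontD => //; case Pi: (P i); [exact: FP|exact: ccont_cst].
by apply/funext => x; rewrite big_cons; case: ifP => // _; rewrite add0r.
Qed.

Lemma ccont_comp (U : topologicalType) (h : U -> T) f :
  continuous h -> ccont f -> ccont (fun x => f (h x)).
Proof.
move=> hc [f1 f2]; split=> x.
  exact: (continuous_comp (hc x) (f1 (h x))).
exact: (continuous_comp (hc x) (f2 (h x))).
Qed.

Lemma ccontP f : continuous (f : T -> R[i]^o) -> ccont f.
Proof.
have key (h : R[i] -> R) : (forall z z', `|h z - h z'|%:C <= `|z - z'|) ->
    continuous (f : T -> R[i]^o) -> continuous (fun x => h (f x)).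
  move=> hle fc x; apply/cvgrPdist_lt => e e0.
  have := fc x; move/cvgrPdist_lt => /(_ e%:C); rewrite ltcR => /(_ e0).
  apply: filterS => y /(le_lt_trans (hle _ _)); by rewrite ltcR.
move=> fc; split; apply: key => // z z'.
  by have := normc_ge_Re (z - z'); case: z z' => [a b] [c d].
have Im_le (u : R[i]) : `|complex.Im u|%:C <= `|u|.
  by rewrite normc_def lecR -sqrtr_sqr ler_wsqrtr // lerDr sqr_ge0.
by have := Im_le (z - z'); case: z z' => [a b] [c d].
Qed.

End Closure.
End ComplexContinuity.

Section HaarExpect.
Local Open Scope classical_set_scope.
Local Open Scope complex_scope.
Local Open Scope ring_scope.
Variables (R : realType) (K : topGroupType).
Hypothesis K_compact : compact [set: K].
Local Notation borel := (g_sigma_algebraType (@open K)).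
Local Notation P := (haar R K).
Implicit Types (f g : K -> R[i]).

Lemma haarP : is_haar P.
Proof.
rewrite /haar; case: pselect => [h|[]]; first exact: projT2 (cid h).
exact: haar_exists.
Qed.

Lemma continuous_borel (h : K -> R) : continuous h ->
  measurable_fun [set: borel] (h : borel -> R).
Proof.
move=> hc; apply: (measurability _ (measurable_realfun.RGenOpens.measurableE R)).
move=> _ [_ [a [b ->]] <-]; rewrite setTI.
apply: sub_sigma_algebra; apply: open_comp; last exact: interval_open.
by move=> x _; exact: hc.
Qed.

Lemma continuous_integrable (h : K -> R) : continuous h ->
  P.-integrable [set: borel] (EFin \o h).
Proof.
move=> hc; apply: measurable_bounded_integrable.
- exact: measurableT.
- by apply: (le_lt_trans (probability_le1 P measurableT)); rewrite ltry.
- exact: continuous_borel.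
have : compact [set h x | x in [set: K]].
  by apply: continuous_compact => //; exact: continuous_subspaceT.
move/compact_bounded => [M [Mreal MP]]; exists M; split => // r Mr x _.
by apply: (MP r Mr); exists x.
Qed.

Lemma Rintegral_translate (h : K -> R) (k : K) : continuous h ->
  \int[P]_x h (k * x)%g = \int[P]_x h x.
Proof.
move=> hc; rewrite /Rintegral; congr fine.
have mk : measurable_fun [set: borel] (fun x : borel => (k * x)%g : borel).
  apply: (@measurability _ _ borel borel _ _ (@open K)) => //.
  move=> _ [ O Oop <-]; rewrite setTI; apply: sub_sigma_algebra.
  by apply: open_comp => // x _; exact: mulgl_continuous.
have hk : continuous (fun x => h (k * x)%g).
  by move=> x; apply: continuous_comp; [exact: mulgl_continuous|exact: hc].
have := @integral_pushforward _ _ borel borel R _ mk P setT (EFin \o h).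
move=> /(_ _ _ measurableT); rewrite preimage_setT => <-.
- apply: eq_measure_integral => A mA _.
  transitivity (P [set (k^-1 * x)%g | x in (A : set K)]); last exact: haarP.1.
  rewrite [LHS](_ : _ = P ((fun x : K => (k * x)%g) @^-1` A)) //.
  congr (P _); apply/seteqP; split=> [x /= Ax|_ [x Ax <-]] /=.
    by exists (k * x)%g => //; rewrite mulKg.
  by rewrite mulVKg.
- by apply/measurable_realfun.measurable_EFinP; exact: continuous_borel.
- exact: continuous_integrable.
Qed.

Lemma haar_expectD f g : ccont f -> ccont g ->
  haar_expect (fun x => f x + g x) = haar_expect f + haar_expect g.
Proof.
move=> [f1 f2] [g1 g2]; rewrite /haar_expect.
under eq_fun do rewrite ReD.
under [X in _ +i* Rintegral _ _ X]eq_fun do rewrite ImD.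
by rewrite !RintegralD //; exact: continuous_integrable.
Qed.

Lemma haar_expectZ (c : R[i]) f : ccont f ->
  haar_expect (fun x => c * f x) = c * haar_expect f.
Proof.
move=> [f1 f2]; rewrite /haar_expect; case: c => a b.
have cZ (t : R) (h : K -> R) : continuous h -> continuous (fun x => t * h x).
  by move=> hc x; exact: (cvgM (cvg_cst t) (hc x)).
under eq_fun do rewrite ReM.
under [X in _ +i* Rintegral _ _ X]eq_fun do rewrite ImM.
rewrite RintegralB ?RintegralD ?RintegralZl //=; try apply: continuous_integrable => //.
all: by apply: cZ.
Qed.

Lemma haar_expect_cst (c : R[i]) : haar_expect (fun _ : K => c) = c.
Proof.
rewrite /haar_expect !Rintegral_cst //.
have -> : fine (P setT) = 1 by rewrite (_ : P setT = 1%E) //; exact: (probability_setT P).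
rewrite !mulr1.
by case: c.
Qed.

Lemma haar_expect_translate f (k : K) : ccont f ->
  haar_expect (fun x => f (k * x)%g) = haar_expect f.
Proof.
by move=> [f1 f2]; rewrite /haar_expect (Rintegral_translate _ f1) (Rintegral_translate _ f2).
Qed.

End HaarExpect.

Section Compactness.
Local Open Scope classical_set_scope.

Lemma gpow_compact (G : topologicalType) n :
  compact [set: G] -> compact [set: gpow G n].
Proof.
move=> Gc; have := @tychonoff 'I_n (fun _ => G) (fun _ => setT) (fun _ => Gc).
by rewrite (_ : [set f | _] = setT) //; apply/seteqP; split.
Qed.

Lemma wreath_compact (G : topologicalType) n :
  compact [set: G] -> compact [set: wreath G n].
Proof.
move=> Gc.
have dc : compact [set: discrete_topology 'S_n].
  by apply: finite_compact; exact: (@finite_finset 'S_n setT).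
have := compact_setX (gpow_compact (n := n) Gc) dc.
by rewrite setXTT.
Qed.

Lemma iter_wreath_compact ns (G : topGroupType) :
  compact [set: G] -> compact [set: iter_wreath G ns].
Proof. by elim: ns G => //= n ns IH G Gc; apply: IH; exact: wreath_compact. Qed.

End Compactness.

(** * Words and their evaluation *)

Section Words.
Local Open Scope group_scope.

Section Operations.
Variables (I J : Type).
Implicit Types (u v : seq (I * bool)).

(** [eval_word] over an arbitrary alphabet, to which it is convertible. *)
Definition evalw (Q : groupType) (g : I -> Q) (u : seq (I * bool)) : Q :=
  foldr (fun l a => (if l.2 then (g l.1)^-1 else g l.1) * a) 1 u.

Definition winv u : seq (I * bool) := rev [seq (l.1, ~~ l.2) | l <- u].

Definition wsub (Y : I -> seq (J * bool)) u : seq (J * bool) :=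
  flatten [seq (if l.2 then rev [seq (l.1, ~~ l.2) | l <- Y l.1] else Y l.1) | l <- u].

Definition wmap (j : I -> J) u : seq (J * bool) := [seq (j l.1, l.2) | l <- u].

Variable Q : groupType.
Implicit Types g : I -> Q.

Lemma evalw_cat g u v : evalw g (u ++ v) = evalw g u * evalw g v.
Proof. by elim: u => [|l u IH] /=; rewrite ?mul1g // IH mulgA. Qed.

Lemma evalw_cons g l u :
  evalw g (l :: u) = (if l.2 then (g l.1)^-1 else g l.1) * evalw g u.
Proof. by []. Qed.

Lemma evalw_letter g l : evalw g [:: l] = if l.2 then (g l.1)^-1 else g l.1.
Proof. by rewrite /= mulg1. Qed.

Lemma evalw_winv g u : evalw g (winv u) = (evalw g u)^-1.
Proof.
rewrite /winv; elim: u => [|[i e] u IH]; first by rewrite /= invg1.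
by rewrite /= rev_cons -cats1 evalw_cat IH invMg evalw_letter /=; case: e; rewrite ?invgK.
Qed.

Lemma evalw_ext g g' u : (forall i, g i = g' i) -> evalw g u = evalw g' u.
Proof. by move=> gg; elim: u => //= l u ->; rewrite gg. Qed.

Lemma evalw_rcons g u l :
  evalw g (rcons u l) = evalw g u * (if l.2 then (g l.1)^-1 else g l.1).
Proof. by rewrite -cats1 evalw_cat evalw_letter. Qed.
End Operations.

Lemma evalw_wsub I J (Q : groupType) (g : J -> Q) (Y : I -> seq (J * bool)) u :
  evalw g (wsub Y u) = evalw (fun i => evalw g (Y i)) u.
Proof.
elim: u => //= l u IH; rewrite /wsub /= evalw_cat -/(wsub Y u) IH; congr (_ * _).
by case: l.2 => //; exact: (evalw_winv g (Y l.1)).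
Qed.

Lemma evalw_wmap I J (Q : groupType) (g : J -> Q) (j : I -> J) u :
  evalw g (wmap j u) = evalw (fun i => g (j i)) u.
Proof. by elim: u => //= l u ->. Qed.

Lemma evalw_eq_in (I : eqType) (Q : groupType) (g g' : I -> Q) u :
  (forall l, l \in u -> g l.1 = g' l.1) -> evalw g u = evalw g' u.
Proof.
elim: u => //= l u IH H; rewrite H ?mem_head // IH // => l' l'u.
by apply: H; rewrite in_cons l'u orbT.
Qed.

Lemma evalw_subgroup I (Q : groupType) (g : I -> Q) (S : Q -> Prop) u :
  S 1 -> (forall a b, S a -> S b -> S (a * b)) -> (forall a, S a -> S a^-1) ->
  (forall i, S (g i)) -> S (evalw g u).
Proof.
by move=> S1 SM SV Sg; elim: u => //= l u IH; apply: SM => //; case: ifP => // _; exact: SV.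
Qed.

Lemma evalw_abelian I (Q : groupType) (g g' : I -> Q) u :
  (forall a b : Q, a * b = b * a) ->
  evalw (fun i => g i * g' i) u = evalw g u * evalw g' u.
Proof.
move=> ab; elim: u => [|l u IH] /=; first by rewrite mul1g.
rewrite IH; case: l.2; last by rewrite -!mulgA; congr (_ * _); rewrite !mulgA; congr (_ * _).
by rewrite invMg [X in X * _]ab -!mulgA; congr (_ * _); rewrite !mulgA; congr (_ * _).
Qed.

(** ** Cancellation, and the universal property of a free basis *)

Section Cancellation.
Variable I : eqType.
Implicit Types (u v x y : seq (I * bool)) (l : I * bool).

Definition linv l : I * bool := (l.1, ~~ l.2).

Lemma linvK l : linv (linv l) = l.
Proof. by case: l => i e; rewrite /linv /= negbK. Qed.

Definition cancel_inv (T : Type) (Theta : seq (I * bool) -> T) :=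
  forall x y l, Theta (x ++ l :: linv l :: y) = Theta (x ++ y).

(** Equality in the free group, phrased so that no model of that group is
    needed. *)
Definition sim u v := forall (T : Type) (Theta : seq (I * bool) -> T),
  cancel_inv Theta -> Theta u = Theta v.

Lemma sim_refl u : sim u u. Proof. by []. Qed.
Lemma sim_sym u v : sim u v -> sim v u.
Proof. by move=> uv T Th ThP; rewrite (uv T Th ThP). Qed.
Lemma sim_trans v u w : sim u v -> sim v w -> sim u w.
Proof. by move=> uv vw T Th ThP; rewrite (uv T Th ThP) (vw T Th ThP). Qed.

Lemma sim_cat x u v y : sim u v -> sim (x ++ u ++ y) (x ++ v ++ y).
Proof.
move=> uv T Th ThP; apply: (uv T (fun z => Th (x ++ z ++ y))) => a b l.
by rewrite -[(a ++ _) ++ y]catA /= catA ThP -!catA.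
Qed.

Lemma sim_cancel x y l : sim (x ++ l :: linv l :: y) (x ++ y).
Proof. by move=> T Th ThP; exact: ThP. Qed.

Lemma sim_evalw (Q : groupType) (g : I -> Q) u v :
  sim u v -> evalw g u = evalw g v.
Proof.
move=> /(_ Q (evalw g)); apply => x y l.
rewrite !evalw_cat !evalw_cons /= ; congr (_ * _).
by case: l => i [] /=; rewrite ?mulKg ?mulVKg.
Qed.

Lemma sim_winv u : sim (u ++ winv u) [::].
Proof.
elim/last_ind: u => [|u l IH]; first exact: sim_refl.
rewrite /winv map_rcons rev_rcons cat_rcons; apply: sim_trans IH.
exact: (sim_cancel u (winv u) l).
Qed.

Lemma sim_winvl u : sim (winv u ++ u) [::].
Proof.
have {2}-> : u = winv (winv u).
  by rewrite /winv map_rev revK -map_comp -[LHS]map_id; apply: eq_map => l /=; rewrite negbK -surjective_pairing.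
exact: sim_winv.
Qed.

Definition push l u :=
  if u is l' :: u' then if l == linv l' then u' else l :: u else [:: l].

Definition red u := foldr push [::] u.

Definition wreduced u :=
  sorted (fun l l' : I * bool => ~~ ((l.1 == l'.1) && (l.2 != l'.2))) u.

Lemma linv_eq l l' : (l == linv l') = (l.1 == l'.1) && (l.2 != l'.2).
Proof. by case: l l' => i e [i' e']; rewrite /linv xpair_eqE /=; case: e e' => [] []. Qed.

Lemma push_sim l u : sim (push l u) (l :: u).
Proof.
case: u => [|l' u] /=; first exact: sim_refl.
case: eqP => [->|_]; last exact: sim_refl.
by apply: sim_sym; rewrite -{2}[l']linvK; exact: (sim_cancel [::] u (linv l')).
Qed.

Lemma red_sim u : sim (red u) u.
Proof.
elim: u => [|l u IH] /=; first exact: sim_refl.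
apply: sim_trans (push_sim l _) _.
by have := sim_cat [:: l] [::] IH; rewrite !cats0.
Qed.

Lemma red_reduced u : wreduced (red u).
Proof.
elim: u => //= l u; case: (red u) => [|l' v] //= vr.
case: ifP => [_|]; first by case: v vr => //= ? ? /andP[].
by rewrite /= -linv_eq => ->.
Qed.

(** It suffices to test the reduction of [u] times the inverse of [v]. *)
Lemma sim_of_detect (Detect : seq (I * bool) -> Prop) u v :
  (forall z, wreduced z -> Detect z -> z = [::]) ->
  Detect (red (u ++ winv v)) -> sim u v.
Proof.
move=> D Duv; have r0 := D _ (red_reduced _) Duv.
have s0 : sim (u ++ winv v) [::].
  by apply: sim_trans (sim_sym (red_sim _)) _; rewrite r0; exact: sim_refl.
have s1 : sim (u ++ winv v ++ v) u.
  by have := sim_cat u [::] (sim_winvl v); rewrite !cats0.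
have s2 : sim (u ++ winv v ++ v) v by have := sim_cat [::] v s0; rewrite /= -catA.
exact: sim_trans (sim_sym s1) s2.
Qed.

End Cancellation.

Lemma free_basis_sim (F : groupType) (H : set F) k (b : 'I_k -> F) u v :
  free_basis H b -> evalw b u = evalw b v -> sim u v.
Proof.
case=> _ bf uv; apply: (@sim_of_detect _ (fun z => evalw b z = 1)) => //.
by rewrite (sim_evalw b (red_sim _)) evalw_cat evalw_winv uv mulgV.
Qed.

Lemma free_basis_evalw (F : groupType) (H : set F) k (b : 'I_k -> F) u v
    (Q : groupType) (g : 'I_k -> Q) :
  free_basis H b -> evalw b u = evalw b v -> evalw g u = evalw g v.
Proof. by move=> fb /(free_basis_sim fb); exact: sim_evalw. Qed.

(** ** Labelled actions *)

Section Walks.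
Variables (I : eqType) (Omega : Type) (Q : groupType).
Variables (step : I -> bool -> Omega -> Omega) (lab : I -> bool -> Omega -> Q).
Hypothesis stepK : forall i e o, step i (~~ e) (step i e o) = o.
Hypothesis labV : forall i e o, lab i (~~ e) (step i e o) = (lab i e o)^-1.

(** Read [u] along an action on [Omega], collecting labels in [Q]: the
    action of a wreath product of [Q], computed one point at a time. *)
Fixpoint walk (o : Omega) (u : seq (I * bool)) : Omega * Q :=
  if u is l :: u' then
    let: (o', a) := walk (step l.1 l.2 o) u' in (o', lab l.1 l.2 o * a)
  else (o, 1).

Lemma walk_cons o l u : walk o (l :: u) =
  ((walk (step l.1 l.2 o) u).1, lab l.1 l.2 o * (walk (step l.1 l.2 o) u).2).
Proof. by rewrite /=; case: (walk _ u). Qed.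

Lemma walk_cat o u v : walk o (u ++ v) =
  ((walk (walk o u).1 v).1, (walk o u).2 * (walk (walk o u).1 v).2).
Proof.
elim: u o => [|l u IH] o; first by rewrite /= mul1g; case: (walk o v).
by rewrite cat_cons !walk_cons IH /= mulgA.
Qed.

Lemma walk_cancel o : cancel_inv (walk o).
Proof.
move=> x y [i e]; rewrite !walk_cat !walk_cons /= stepK labV mulKVg //.
Qed.

Lemma walk_sim o u v : sim u v -> walk o u = walk o v.
Proof. by move/(_ _ (walk o)); apply; exact: walk_cancel. Qed.

Lemma walk_winv o u : walk (walk o u).1 (winv u) = (o, (walk o u).2^-1).
Proof.
have := walk_sim o (sim_winv u); rewrite walk_cat /= => -[e1 e2].
rewrite [LHS]surjective_pairing e1; congr pair.
by apply: (mulgI (walk o u).2); rewrite e2 mulgV.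
Qed.

Lemma walk_rcons o u l : walk o (rcons u l) =
  (step l.1 l.2 (walk o u).1, (walk o u).2 * lab l.1 l.2 (walk o u).1).
Proof. by rewrite -cats1 walk_cat /= mulg1. Qed.
End Walks.

(** ** Extending partial injections to permutations *)

(** By induction on [D], each point being corrected by one transposition. *)
Lemma perm_extend (T : finType) (D : {set T}) (f : T -> T) :
  {in D &, injective f} -> exists s : {perm T}, {in D, forall x, s x = f x}.
Proof.
move: {2}#|D| (erefl #|D|) => n; elim: n D => [|n IH] D cD injf.
  by exists 1%g => x; move: cD => /eqP; rewrite cards_eq0 => /eqP ->; rewrite inE.
have [x xD] : exists x, x \in D by apply/card_gt0P; rewrite cD.
have cD' : #|D :\ x| = n by move: cD; rewrite (cardsD1 x) xD => -[].
have [|s sP] := IH (D :\ x) cD'.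
  by move=> y z /setD1P[_ yD] /setD1P[_ zD]; exact: injf.
exists (s * tperm (s x) (f x))%g => y yD; rewrite permM.
have [->|yx] := eqVneq y x; first by rewrite tpermL.
have yD' : y \in D :\ x by rewrite !inE yx.
rewrite -(sP y yD') tpermD //.
  by rewrite (inj_eq perm_inj) eq_sym.
by rewrite sP //; apply: contra yx => /eqP /injf -> //.
Qed.

Lemma perm_extend_pairs (T J : finType) (P : pred J) (src tgt : J -> T) :
  (forall t t', P t -> P t' -> (src t = src t' <-> tgt t = tgt t')) ->
  exists s : {perm T}, forall t, P t -> s (src t) = tgt t.
Proof.
move=> st; pose f p := if [pick t | P t && (src t == p)] is Some t then tgt t else p.
have fE t : P t -> f (src t) = tgt t.
  move=> Pt; rewrite /f; case: pickP => [t' /andP[Pt' /eqP E]|/(_ t)]; last by rewrite Pt eqxx.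
  by apply/(st _ _ Pt' Pt).
have [|s sP] := @perm_extend T [set src t | t in P] f.
  move=> _ _ /imsetP[t Pt ->] /imsetP[t' Pt' ->]; rewrite !fE //.
  by move/(st _ _ Pt Pt').
by exists s => t Pt; rewrite sP ?fE // imset_f.
Qed.

(** ** Residual finiteness *)

(** Let the letters of the word lead [0] to [1], [1] to [2], and so on. As no
    letter is followed by its inverse, each letter acts by a partial injection;
    extended to permutations, these move [0] to the length of the word. *)
Lemma reduced_detect (I : finType) (u : seq (I * bool)) : wreduced u ->
  (forall (N : nat) (g : I -> 'S_N), evalw g u = 1) -> u = [::].
Proof.
case: u => // l0 u0; set u := l0 :: u0 => ur triv; exfalso.
pose L := size u; pose lt (t : 'I_L) := nth l0 u t.
pose src (t : 'I_L) : 'I_L.+1 := if (lt t).2 then lift ord0 t else widen_ord (leqnSn L) t.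
pose tgt (t : 'I_L) : 'I_L.+1 := if (lt t).2 then widen_ord (leqnSn L) t else lift ord0 t.
have srcE t : src t = (t + (lt t).2)%N :> nat.
  by rewrite /src; case: (lt t).2; rewrite /= ?addn0 // /bump /= add1n addn1.
have tgtE t : tgt t = (t + ~~ (lt t).2)%N :> nat.
  by rewrite /tgt; case: (lt t).2; rewrite /= ?addn0 // /bump /= add1n addn1.
have adj (t t' : 'I_L) : t' = t.+1 :> nat -> (lt t).1 = (lt t').1 -> (lt t).2 = (lt t').2.
  move=> tt' E; move: ur; rewrite /wreduced => /(pathP l0)/(_ t).
  rewrite -ltnS -[(size u0).+1]/L -tt' ltn_ord => /(_ isT).
  rewrite -[nth _ (l0 :: u0) t]/(lt t).
  by rewrite -[nth _ u0 t]/(nth l0 u t.+1) -tt' -/(lt t') E eqxx /= negbK => /eqP.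
have inj (t t' : 'I_L) : (lt t).1 = (lt t').1 ->
    (src t = src t' -> t = t') /\ (tgt t = tgt t' -> t = t').
  move=> E; split=> /(congr1 val) /=; rewrite ?srcE ?tgtE => D; apply: val_inj => /=;
  have a1 := adj t t'; have a2 := adj t' t; move: a1 a2 D; rewrite E;
  by case: (lt t).2 (lt t').2 => [] [] a1 a2 D; first [lia|
    have := a1 ltac:(lia) erefl; lia|have := a2 ltac:(lia) erefl; lia].
have ex i : exists s : 'S_L.+1, forall t, (lt t).1 = i -> s (src t) = tgt t.
  have [|s sP] := @perm_extend_pairs 'I_L.+1 'I_L (fun t => (lt t).1 == i) src tgt.
    move=> t t' /eqP ti /eqP ti'; have E : (lt t).1 = (lt t').1 by rewrite ti ti'.
    by split=> [/(inj _ _ E).1 ->|/(inj _ _ E).2 ->].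
  by exists s => t ti; apply: sP; rewrite ti.
have [s sP] := choice ex.
have walkE j : (j <= L)%N -> evalw s (take j u) ord0 = inord j.
  elim: j => [_|j IH jL]; first by rewrite take0 perm1; apply: val_inj; rewrite /= inordK.
  pose t := Ordinal jL.
  rewrite (take_nth l0) // evalw_rcons permM IH ?(ltnW jL) //.
  have := sP _ t erefl; have := srcE t; have := tgtE t; rewrite -/(lt t).
  case: (lt t).2 => /= tE sE sst.
    rewrite (_ : inord j = tgt t); last by apply: val_inj; rewrite /= tE inordK ?addn0 // ltnS ltnW.
    by rewrite -sst permK; apply: val_inj; rewrite /= sE inordK ?addn1.
  rewrite (_ : inord j = src t); last by apply: val_inj; rewrite /= sE inordK ?addn0 // ltnS ltnW.
  by rewrite sst; apply: val_inj; rewrite /= tE inordK ?addn1.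
have := walkE L (leqnn L); rewrite take_size triv perm1 => /(congr1 val) /=.
by rewrite inordK.
Qed.

(** Residual finiteness of the free group. *)
Lemma sim_of_finite (I : finType) (u v : seq (I * bool)) :
  (forall (N : nat) (g : I -> 'S_N), evalw g u = evalw g v) -> sim u v.
Proof.
move=> uv; apply: (@sim_of_detect _ (fun z => forall N (g : I -> 'S_N), evalw g z = 1)).
  exact: reduced_detect.
by move=> N g; rewrite (sim_evalw g (red_sim _)) evalw_cat evalw_winv uv mulgV.
Qed.

End Words.

(** * Representative functions and invariant means *)

Section RepresentativeFunctions.
Local Open Scope complex_scope.
Local Open Scope ring_scope.
Variable R : realType.

Definition mat_rep (T : topGroupType) (J : finType) (rho : J -> J -> T -> R[i]) :=
  (forall j j', ccont (rho j j')) /\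
  (forall j j' x y, rho j j' (x * y)%g = \sum_t rho j t x * rho t j' y).

(** The matrix coefficients of finite-dimensional continuous representations.
    For them the uniqueness of Haar measure and the interchange of two
    integrations are finite linear algebra, which spares Fubini's theorem on
    the products at hand. *)
Definition rep_fun (T : topGroupType) (f : T -> R[i]) :=
  exists (J : finType) (rho : J -> J -> T -> R[i]) (c : J -> J -> R[i]),
    mat_rep rho /\ forall x, f x = \sum_j \sum_j' c j j' * rho j j' x.

Section Closure.
Variable T : topGroupType.
Implicit Types f g : T -> R[i].

Lemma rep_fun_ext f g : (forall x, f x = g x) -> rep_fun f -> rep_fun g.
Proof. by move=> /funext ->. Qed.

Lemma rep_fun_ccont f : rep_fun f -> ccont f.
Proof.
case=> J [rho [c [[rc _] fE]]]; rewrite (funext fE).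
apply: ccont_sum => j _; apply: ccont_sum => j' _; apply: ccontM => //.
exact: ccont_cst.
Qed.

Lemma rep_fun_coef (J : finType) (rho : J -> J -> T -> R[i]) j j' :
  mat_rep rho -> rep_fun (rho j j').
Proof.
move=> rr; exists J, rho, (fun t t' => ((t == j) && (t' == j'))%:R); split => // x.
rewrite (bigD1 j) //= [X in _ + X]big1 ?addr0; last first.
  by move=> t /negPf tj; rewrite big1 // => t' _; rewrite tj mul0r.
rewrite (bigD1 j') //= [X in _ + X]big1 ?addr0 ?eqxx ?mul1r //.
by move=> t /negPf tj; rewrite tj andbF mul0r.
Qed.

Lemma rep_fun_cst (z : R[i]) : rep_fun (fun _ : T => z).
Proof.
exists unit, (fun _ _ _ => 1), (fun _ _ => z); split=> [|x].
  split=> [_ _|_ _ x y]; first exact: ccont_cst.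
  by rewrite (big_pred1 tt) ?mulr1 // => -[].
by rewrite (big_pred1 tt) => [|[]//]; rewrite (big_pred1 tt) ?mulr1 // => -[].
Qed.

Lemma rep_funM f g : rep_fun f -> rep_fun g -> rep_fun (fun x => f x * g x).
Proof.
move=> [J [rho [c [[rc rM] fE]]]] [J' [rho' [c' [[rc' rM'] gE]]]].
exists (J * J')%type, (fun p q x => rho p.1 q.1 x * rho' p.2 q.2 x),
  (fun p q => c p.1 q.1 * c' p.2 q.2); split=> [|x].
  split=> [p q|p q x y]; first exact: ccontM.
  rewrite rM rM' big_distrlr /= pair_bigA /=.
  by apply: eq_bigr => -[t t'] _ /=; rewrite mulrACA.
rewrite fE gE big_distrlr /= pair_bigA /=; apply: eq_bigr => -[j j'] _ /=.
rewrite big_distrlr /= pair_bigA /=; apply: eq_bigr => -[t t'] _ /=.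
by rewrite mulrACA.
Qed.

Lemma rep_funD f g : rep_fun f -> rep_fun g -> rep_fun (fun x => f x + g x).
Proof.
move=> [J [rho [c [[rc rM] fE]]]] [J' [rho' [c' [[rc' rM'] gE]]]].
pose mix (C : Type) (z : C) (a : J -> J -> C) (a' : J' -> J' -> C) (p q : J + J') : C :=
  match p, q with inl j, inl t => a j t | inr j, inr t => a' j t | _, _ => z end.
exists (J + J')%type, (mix (T -> R[i]) (fun=> 0) rho rho'), (mix R[i] 0 c c'); split=> [|x].
  split=> [[j|j] [t|t]|[j|j] [t|t] x y] //=; try exact: ccont_cst.
  - rewrite big_sumType /= rM [X in _ + X]big1 ?addr0 // => i _; by rewrite mul0r.
  - by rewrite big_sumType /= !big1 ?addr0 // => i _; rewrite ?mulr0 ?mul0r.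
  - by rewrite big_sumType /= !big1 ?addr0 // => i _; rewrite ?mulr0 ?mul0r.
  - rewrite big_sumType /= rM' [X in X + _]big1 ?add0r // => i _; by rewrite mul0r.
rewrite big_sumType /= fE gE; congr (_ + _); apply: eq_bigr => j _; rewrite big_sumType /=.
  by rewrite [X in _ + X]big1 ?addr0 // => i _; rewrite mul0r.
by rewrite [X in X + _]big1 ?add0r // => i _; rewrite mul0r.
Qed.

Lemma rep_fun_sum (I : Type) (s : seq I) (P : pred I) (F : I -> T -> R[i]) :
  (forall i, rep_fun (F i)) -> rep_fun (fun x => \sum_(i <- s | P i) F i x).
Proof.
move=> FP; elim: s => [|i s IH].
  by apply: rep_fun_ext (rep_fun_cst 0) => x; rewrite big_nil.
apply: rep_fun_ext (rep_funD (rep_funM (rep_fun_cst (P i)%:R) (FP i)) IH) => x.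
by rewrite big_cons; case: (P i); rewrite ?mul1r // mul0r add0r.
Qed.

Lemma rep_fun_inv f : rep_fun f -> rep_fun (fun x => f x^-1%g).
Proof.
move=> [J [rho [c [[rc rM] fE]]]].
exists J, (fun j j' x => rho j' j x^-1%g), (fun j j' => c j' j); split=> [|x].
  split=> [j j'|j j' x y]; first by apply: ccont_comp => //; exact: invg_continuous.
  by rewrite invMg rM; apply: eq_bigr => t _; rewrite mulrC.
by rewrite fE exchange_big.
Qed.

Lemma rep_fun_mulgl f (a : T) : rep_fun f -> rep_fun (fun x => f (a * x)%g).
Proof.
move=> [J [rho [c [rr fE]]]]; have [rc rM] := rr.
apply: (@rep_fun_ext (fun x => \sum_j \sum_j' c j j' * \sum_t rho j t a * rho t j' x)).
  by move=> x; rewrite fE; apply: eq_bigr => j _; apply: eq_bigr => j' _; rewrite rM.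
apply: rep_fun_sum => j; apply: rep_fun_sum => j'; apply: rep_funM; first exact: rep_fun_cst.
apply: rep_fun_sum => t; apply: rep_funM; first exact: rep_fun_cst.
exact: rep_fun_coef.
Qed.

Lemma rep_fun_mulgr f (a : T) : rep_fun f -> rep_fun (fun x => f (x * a)%g).
Proof.
move=> /rep_fun_inv /(@rep_fun_mulgl _ a^-1%g) /rep_fun_inv; apply: rep_fun_ext => x.
by rewrite invMg !invgK.
Qed.

(** The product formula for matrix coefficients. *)
Lemma rep_fun_split f : rep_fun f ->
  exists (I : finType) (p q : I -> T -> R[i]),
    [/\ forall i, rep_fun (p i), forall i, rep_fun (q i)
      & forall x y, f (x * y)%g = \sum_i p i x * q i y].
Proof.
move=> [J [rho [c [rr fE]]]]; have [rc rM] := rr.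
exists (J * J)%type, (fun i x => rho i.1 i.2 x),
  (fun i y => \sum_j' c i.1 j' * rho i.2 j' y); split=> [i|i|x y].
- exact: rep_fun_coef.
- by apply: rep_fun_sum => j'; apply: rep_funM; [exact: rep_fun_cst|exact: rep_fun_coef].
rewrite fE -(pair_bigA _ (fun j t => rho j t x * \sum_j' c j j' * rho t j' y)) /=.
apply: eq_bigr => j _.
under eq_bigr => j' _ do rewrite rM big_distrr /=.
rewrite exchange_big /=; apply: eq_bigr => t _; rewrite big_distrr /=.
by apply: eq_bigr => j' _; rewrite mulrCA.
Qed.
End Closure.

Lemma rep_fun_comp (T T' : topGroupType) (h : T -> T') (f : T' -> R[i]) :
  continuous h -> (forall x y, h (x * y)%g = (h x * h y)%g) ->
  rep_fun f -> rep_fun (fun x => f (h x)).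
Proof.
move=> hc hM [J [rho [c [[rc rM] fE]]]].
exists J, (fun j j' x => rho j j' (h x)), c; split=> [|x]; last exact: fE.
by split=> [j j'|j j' x y]; [exact: ccont_comp|rewrite hM rM].
Qed.

(** ** Invariant means *)

Section Means.
Variable T : topGroupType.
Implicit Types (f g : T -> R[i]) (L : (T -> R[i]) -> R[i]).

Definition mean L := [/\ L (fun=> 1) = 1,
  forall f g, rep_fun f -> rep_fun g -> L (fun x => f x + g x) = L f + L g
  & forall z f, rep_fun f -> L (fun x => z * f x) = z * L f].

Lemma mean_sum L (I : Type) (s : seq I) (F : I -> T -> R[i]) :
  mean L -> (forall i, rep_fun (F i)) ->
  L (fun x => \sum_(i <- s) F i x) = \sum_(i <- s) L (F i).
Proof.
move=> [L1 LD LZ] FP; elim: s => [|i s IH].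
  rewrite big_nil -[RHS](mul0r (L (fun=> 0))) -LZ; last exact: rep_fun_cst.
  by congr L; apply/funext => x; rewrite big_nil mul0r.
rewrite big_cons -IH -LD //; last exact: rep_fun_sum.
by congr L; apply/funext => x; rewrite big_cons.
Qed.

Lemma mean_lin L (I : finType) (z : I -> R[i]) (F : I -> T -> R[i]) :
  mean L -> (forall i, rep_fun (F i)) ->
  L (fun x => \sum_i z i * F i x) = \sum_i z i * L (F i).
Proof.
move=> mL FP; rewrite (mean_sum _ mL) => [|i].
  by apply: eq_bigr => i _; case: mL => _ _ ->.
by apply: rep_funM => //; exact: rep_fun_cst.
Qed.

Lemma mean_cst L z : mean L -> L (fun=> z) = z.
Proof.
move=> [L1 _ LZ]; rewrite -[RHS]mulr1 -L1 -LZ; last exact: rep_fun_cst.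
by congr L; apply/funext => x; rewrite mulr1.
Qed.

(** A Fubini exchange, finite because [f (x * y)] is a finite sum of products:
    left invariant and right invariant means agree. *)
Lemma mean_left_right L M f : mean L -> mean M -> rep_fun f ->
  (forall x, L (fun y => f (x * y)%g) = L f) ->
  (forall y, M (fun x => f (x * y)%g) = M f) -> L f = M f.
Proof.
move=> mL mM fr Linv Minv; have [I [p [q [pr qr fE]]]] := rep_fun_split fr.
have -> : L f = M (fun x => \sum_i L (q i) * p i x).
  rewrite -[LHS](mean_cst _ mM); congr M; apply/funext => x; rewrite -(Linv x).
  under [in LHS]eq_fun do rewrite fE.
  by rewrite (mean_lin _ mL) //; apply: eq_bigr => i _; rewrite mulrC.
have -> : M f = L (fun y => \sum_i M (p i) * q i y).
  rewrite -[LHS](mean_cst _ mL); congr L; apply/funext => y; rewrite -(Minv y).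
  under [in LHS]eq_fun do rewrite fE.
  rewrite (_ : (fun x => _) = (fun x => \sum_i q i y * p i x)).
    by rewrite (mean_lin _ mM) //; apply: eq_bigr => i _; rewrite mulrC.
  by apply/funext => x; apply: eq_bigr => i _; rewrite mulrC.
by rewrite (mean_lin _ mL) // (mean_lin _ mM) //; apply: eq_bigr => i _; rewrite mulrC.
Qed.

Hypothesis T_compact : compact [set: T].
Local Notation E := (@haar_expect R T).

Lemma haar_mean : mean E.
Proof.
split=> [|f g /rep_fun_ccont fc /rep_fun_ccont gc|z f /rep_fun_ccont fc].
- exact: haar_expect_cst.
- exact: haar_expectD.
- exact: haar_expectZ.
Qed.

Lemma haar_inv_mean : mean (fun f => E (fun x => f x^-1%g)).
Proof.
have [_ ED EZ] := haar_mean; split=> [|f g fr gr|z f fr].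
- exact: haar_expect_cst.
- by apply: ED; exact: rep_fun_inv.
- by apply: EZ; exact: rep_fun_inv.
Qed.

Lemma haar_mulgl f a : rep_fun f -> E (fun x => f (a * x)%g) = E f.
Proof. by move=> /rep_fun_ccont; exact: haar_expect_translate. Qed.

Lemma haar_inv f : rep_fun f -> E (fun x => f x^-1%g) = E f.
Proof.
move=> fr; apply/esym/(mean_left_right haar_mean haar_inv_mean fr) => a.
  exact: haar_mulgl.
rewrite -(haar_mulgl a^-1%g (rep_fun_inv fr)) /=; congr haar_expect.
by apply/funext => x; rewrite invMg invgK.
Qed.

Lemma haar_mulgr f a : rep_fun f -> E (fun x => f (x * a)%g) = E f.
Proof.
move=> fr; rewrite -(haar_inv (rep_fun_mulgr a fr)) -(haar_inv fr).
rewrite -(haar_mulgl a^-1%g (rep_fun_inv fr)) /=; congr haar_expect.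
by apply/funext => x; rewrite invMg invgK.
Qed.

(** Uniqueness of Haar measure, on the functions that matter here. *)
Lemma haar_unique L f : mean L -> rep_fun f ->
  (forall x, L (fun y => f (x * y)%g) = L f) -> L f = E f.
Proof.
move=> mL fr Linv; apply: (mean_left_right mL haar_mean fr) => // a.
exact: haar_mulgr.
Qed.
End Means.

(** The push-forward of Haar measure is Haar measure on the image; the last
    hypothesis says that the image is large enough for [f]. *)
Lemma haar_comp (T T' : topGroupType) (h : T -> T') (f : T' -> R[i]) :
  compact [set: T] -> compact [set: T'] ->
  continuous h -> (forall x y, h (x * y)%g = (h x * h y)%g) -> rep_fun f ->
  (forall x, exists a, forall y, f (x * y)%g = f (h a * y)%g) ->
  haar_expect (fun x => f (h x)) = haar_expect f.
Proof.
move=> Tc Tc' hc hM fr surj.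
have [_ ED EZ] := haar_mean Tc.
pose L := fun g : T' -> R[i] => haar_expect (fun x => g (h x)).
apply: (@haar_unique _ Tc' L) => //.
  split=> [|g g' gr gr'|z g gr].
  - exact: haar_expect_cst.
  - by apply: ED; exact: rep_fun_comp.
  - by apply: EZ; exact: rep_fun_comp.
move=> x; have [a xa] := surj x; rewrite /L.
rewrite -(haar_mulgl Tc a (rep_fun_comp hc hM fr)); congr haar_expect.
by apply/funext => y; rewrite xa hM.
Qed.

(** ** Independent coordinates *)

Section Power.
Variables (K : topGroupType) (k : nat).
Hypothesis K_compact : compact [set: K].
Let Kk_compact : compact [set: gpow K k]. Proof. exact: gpow_compact. Qed.
Implicit Types (x y : gpow K k) (f : gpow K k -> R[i]) (A : pred 'I_k).
Local Notation E := (@haar_expect R (gpow K k)).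

Lemma gpow_mulE x y i : (x * y)%g i = (x i * y i)%g. Proof. by []. Qed.

Definition merge A x y : gpow K k := fun i => if A i then y i else x i.

Lemma merge_mul A x y x' y' :
  merge A (x * x')%g (y * y')%g = (merge A x y * merge A x' y')%g.
Proof. by apply/funext => i; rewrite /merge !gpow_mulE; case: ifP. Qed.

Lemma mergexx A x : merge A x x = x.
Proof. by apply/funext => i; rewrite /merge if_same. Qed.

Lemma merge_continuous1 A : continuous (fun x => merge A x 1%g).
Proof.
apply: (@gpow_continuous K k _ (fun x : gpow K k => merge A x 1%g)) => i.
case Ai: (A i).
  have -> : (fun x : gpow K k => merge A x 1%g i) = cst (1%g : K).
    by apply/funext => x; rewrite /merge Ai.
  exact: cst_continuous.
have -> : (fun x : gpow K k => merge A x 1%g i) = (fun x : gpow K k => x i).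
  by apply/funext => x; rewrite /merge Ai.
exact: gpow_proj_continuous.
Qed.

Lemma merge_continuous2 A : continuous (fun y => merge A 1%g y).
Proof.
have -> : (fun y => merge A 1%g y) = (fun y => merge (predC A) y 1%g).
  by apply/funext => y; apply/funext => i; rewrite /merge /=; case: (A i).
exact: merge_continuous1.
Qed.

Lemma rep_fun_merge1 A f : rep_fun f -> rep_fun (fun x => f (merge A x 1%g)).
Proof.
apply: rep_fun_comp (@merge_continuous1 A) _ => x y.
by rewrite -merge_mul mulg1.
Qed.

Lemma rep_fun_merge2 A f x : rep_fun f -> rep_fun (fun y => f (merge A x y)).
Proof.
move=> fr; apply: (@rep_fun_ext _ (fun y => f (merge A x 1%g * merge A 1%g y)%g)).
  by move=> y; rewrite -merge_mul mulg1 mul1g.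
apply: (@rep_fun_comp _ _ (fun y => merge A 1%g y) (fun z => f (merge A x 1%g * z)%g)).
- exact: merge_continuous2.
- by move=> y z; rewrite -merge_mul mulg1.
- exact: rep_fun_mulgl.
Qed.

Lemma rep_fun_resample A f : rep_fun f ->
  rep_fun (fun x => E (fun y => f (merge A x y))).
Proof.
move=> fr; have [I [p [q [pr qr fE]]]] := rep_fun_split fr.
have mE := haar_mean Kk_compact.
apply: (@rep_fun_ext _ (fun x => \sum_i E (fun y => q i (merge A 1%g y)) * p i (merge A x 1%g))).
  move=> x; transitivity (E (fun y => \sum_i p i (merge A x 1%g) * q i (merge A 1%g y))).
    rewrite (mean_lin _ mE) => [|i]; last exact: rep_fun_merge2.
    by apply: eq_bigr => i _; rewrite mulrC.
  by congr haar_expect; apply/funext => y; rewrite -fE -merge_mul mulg1 mul1g.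
apply: rep_fun_sum => i; apply: rep_funM; first exact: rep_fun_cst.
exact: rep_fun_merge1.
Qed.

(** Drawing the coordinates in [A] a second time changes nothing: the result is
    again an invariant mean. *)
Lemma haar_resample A f : rep_fun f ->
  E (fun x => E (fun y => f (merge A x y))) = E f.
Proof.
move=> fr; have [_ ED EZ] := haar_mean Kk_compact.
pose L := fun g : gpow K k -> R[i] => E (fun x => E (fun y => g (merge A x y))).
have mL : mean L; last apply: (haar_unique Kk_compact mL fr).
  split=> [|g g' gr gr'|z g gr].
  - by rewrite /L haar_expect_cst haar_expect_cst.
  - rewrite /L -ED; try exact: rep_fun_resample.
    congr haar_expect; apply/funext => x; rewrite -ED //; exact: rep_fun_merge2.
  - rewrite /L -EZ; try exact: rep_fun_resample.
    congr haar_expect; apply/funext => x; rewrite -EZ //; exact: rep_fun_merge2.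
move=> a; rewrite /L.
rewrite -(haar_mulgl Kk_compact a (rep_fun_resample A fr)).
congr haar_expect; apply/funext => x.
rewrite -(haar_mulgl Kk_compact a (rep_fun_merge2 A (a * x)%g fr)).
by congr haar_expect; apply/funext => y; rewrite merge_mul mergexx.
Qed.

(** For fixed values of the other coordinates the factors [l x] and [r x] are
    constants, and Haar measure absorbs them on either side. *)
Lemma haar_shear A (l r : gpow K k -> gpow K k) f :
  (forall x y, l (merge A x y) = l x) -> (forall x y, r (merge A x y) = r x) ->
  rep_fun f ->
  rep_fun (fun x => f (merge A x (l x * x * r x)%g)) ->
  E (fun x => f (merge A x (l x * x * r x)%g)) = E f.
Proof.
move=> lE rE fr fr'; rewrite -(haar_resample A fr') -(haar_resample A fr).
congr haar_expect; apply/funext => x.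
have hr := rep_fun_merge2 A x fr.
rewrite -[RHS](haar_mulgl Kk_compact (l x) hr).
rewrite -[RHS](haar_mulgr Kk_compact (r x)); last exact: rep_fun_mulgl (hr).
congr haar_expect; apply/funext => y; congr f; rewrite lE rE; apply/funext => i.
by rewrite /merge !gpow_mulE; case: ifP => Ai; rewrite Ai ?mulgA.
Qed.

Lemma haar_inv_coords A f : rep_fun f -> rep_fun (fun x => f (merge A x x^-1%g)) ->
  E (fun x => f (merge A x x^-1%g)) = E f.
Proof.
move=> fr fr'; have [_ ED EZ] := haar_mean Kk_compact.
have cm : continuous (fun x => merge A x x^-1%g).
  apply: (@gpow_continuous K k _ (fun x : gpow K k => merge A x x^-1%g)) => i x.
  rewrite /merge; case: (A i); last exact: gpow_proj_continuous.
  apply: (@continuous_comp _ _ _ (fun a : gpow K k => a i) (fun g => g^-1%g)).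
    exact: gpow_proj_continuous.
  exact: invg_continuous.
pose L := fun g : gpow K k -> R[i] => E (fun x => g (merge A x x^-1%g)).
have mL : mean L; last apply: (haar_unique Kk_compact mL fr).
  split=> [|g g' /rep_fun_ccont gr /rep_fun_ccont gr'|z g /rep_fun_ccont gr].
  - exact: haar_expect_cst.
  - by apply: haar_expectD => //; exact: (ccont_comp cm).
  - by apply: haar_expectZ => //; exact: (ccont_comp cm).
move=> a; rewrite /L.
rewrite -[RHS](haar_mulgl Kk_compact (merge A a 1%g) fr').
rewrite -[RHS](haar_mulgr Kk_compact (merge A 1%g a^-1%g)); last exact: rep_fun_mulgl (fr').
congr haar_expect; apply/funext => x; congr f; apply/funext => i.
have iE (u v : gpow K k) : (u * v)%g i = (u i * v i)%g by [].
have vE (u : gpow K k) : u^-1%g i = (u i)^-1%g by [].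
rewrite iE /merge; case: ifP => Ai; last by rewrite !iE Ai mulg1.
by rewrite !vE !iE Ai mul1g invMg invgK.
Qed.
End Power.
End RepresentativeFunctions.

(** * Generating tuples and word expectations *)

Section GeneratingTuples.
Local Open Scope group_scope.
Variable I : finType.

(** The tuple of words [Y] generates the free group on [I], tested in finite
    groups only, where counting is available. *)
Definition generating (J : finType) (Y : J -> seq (I * bool)) :=
  forall (Q : finGroupType) (S : Q -> Prop) (g : I -> Q),
    S 1 -> (forall a b, S a -> S b -> S (a * b)) -> (forall a, S a -> S a^-1) ->
    (forall e, S (evalw g (Y e))) -> forall i, S (g i).

Let Z2 : finGroupType := {perm bool}.
Let tau : Z2 := tperm true false.

Let Z2_abelian (a b : Z2) : a * b = b * a.
Proof.
have E (s : Z2) : s = 1 \/ s = tau.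
  case E: (s true); [left|right]; apply/permP => -[]; rewrite ?perm1 ?tpermL ?tpermR //.
    by case E': (s false) => //; have := perm_inj (etrans E (esym E')).
  by case E': (s false) => //; have := perm_inj (etrans E (esym E')).
by case: (E a) (E b) => [->|->] [->|->]; rewrite ?mulg1 ?mul1g.
Qed.

Let tau_neq1 : tau != 1.
Proof. by apply/eqP => /permP /(_ true); rewrite tpermL perm1. Qed.

(** A letter that does not occur could be sent to a non-trivial element of a
    finite group while all the words go to the identity. *)
Lemma generating_letter (Y : I -> seq (I * bool)) (f : I -> I) (e : I -> bool) :
  generating Y -> (forall i, Y i = [:: (f i, e i)]) -> bijective f.
Proof.
move=> gY YE; have surj i : exists j, f j = i.
  apply: contrapT => ni; apply: (elimN eqP tau_neq1).
  have := gY Z2 (fun x => x = 1) (fun j => if j == i then tau else 1) erefl _ _ _ i.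
  rewrite eqxx; apply.
  - by move=> a b -> ->; rewrite mulg1.
  - by move=> a ->; rewrite invg1.
  move=> j; rewrite YE evalw_letter /= (_ : (f j == i) = false) ?invg1 ?if_same //.
  by apply/eqP => fj; apply: ni; exists j.
have [g gK] := choice surj.
by apply: (bij_can_bij (f := g)) => //; apply: injF_bij; exact: can_inj gK.
Qed.

(** As many words as letters generate only if they are independent: on the
    finite set of maps to the group of order two, evaluation at the tuple is
    injective, hence onto. In particular no two of the words agree. *)
Lemma generating_surj (Y : I -> seq (I * bool)) (e0 : I) :
  generating Y -> exists g : I -> {perm bool},
    forall e, (evalw g (Y e) == 1) = (e != e0).
Proof.
move=> gY; pose Phi (g : {ffun I -> Z2}) : {ffun I -> Z2} := [ffun e => evalw g (Y e)].
have Phi_inj : injective Phi.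
  move=> g g' E; apply/ffunP => i; apply: (mulIg (g' i)^-1); rewrite mulgV.
  pose h j := g j * (g' j)^-1.
  apply: (gY Z2 (fun x => x = 1) h erefl _ _ _ i).
  - by move=> a b -> ->; rewrite mulg1.
  - by move=> a ->; rewrite invg1.
  move=> e; have := congr1 (fun p : {ffun I -> Z2} => p e) E; rewrite !ffunE => Ee.
  rewrite evalw_abelian // Ee -evalw_abelian // (evalw_ext (g' := fun=> 1)).
    by elim: (Y e) => //= l u ->; rewrite mulg1 invg1 if_same.
  by move=> j; rewrite mulgV.
have [Psi _ PsiK] := injF_bij Phi_inj.
exists (Psi [ffun e => if e == e0 then tau else 1]) => e.
have := congr1 (fun p : {ffun I -> Z2} => p e) (PsiK [ffun e => if e == e0 then tau else 1]).
by rewrite !ffunE => ->; case: (e == e0); [exact: negPf tau_neq1|exact: eqxx].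
Qed.
End GeneratingTuples.

Section WordExpectations.
Local Open Scope complex_scope.
Local Open Scope ring_scope.
Variables (R : realType) (K : topGroupType) (psi : K -> R[i]).
Hypotheses (K_compact : compact [set: K]) (psi_rep : rep_fun psi).

Definition Ew k (u : word k) : R[i] :=
  haar_expect (fun a : gpow K k => psi (eval_word a u)).

Lemma gpow_proj_mul k (x y : gpow K k) i : (x * y)%g i = (x i * y i)%g.
Proof. by []. Qed.

Lemma rep_fun_word k (f : K -> R[i]) (u : word k) : rep_fun f ->
  rep_fun (fun a : gpow K k => f (evalw a u)).
Proof.
move=> [J [rho [c [rr fE]]]].
apply: (@rep_fun_ext _ _ (fun a : gpow K k => \sum_j \sum_j' c j j' * rho j j' (evalw a u))).
  by move=> a; rewrite fE.
apply: rep_fun_sum => j; apply: rep_fun_sum => j'; apply: rep_funM; first exact: rep_fun_cst.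
elim: u j j' => [|[i e] u IH] j j'; first exact: (rep_fun_cst _ (rho j j' 1%g)).
apply: (@rep_fun_ext _ _ (fun a : gpow K k => \sum_t
    rho j t (if e then (a i)^-1 else a i)%g * rho t j' (evalw a u))).
  by move=> a; rewrite evalw_cons rr.2.
apply: rep_fun_sum => t; apply: rep_funM; last exact: IH.
have hp : rep_fun (fun a : gpow K k => rho j t (a i)).
  apply: (@rep_fun_comp _ _ _ (fun a : gpow K k => a i) (rho j t)).
  - exact: gpow_proj_continuous.
  - by [].
  - exact: rep_fun_coef.
case: e => //.
apply: (@rep_fun_comp _ _ _ (fun a : gpow K k => a i) (fun x => rho j t x^-1%g)).
- exact: gpow_proj_continuous.
- by [].
- by apply: rep_fun_inv; exact: rep_fun_coef.
Qed.

Lemma Ew_eq k (u v : word k) :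
  (forall g : 'I_k -> K, evalw g u = evalw g v) -> Ew u = Ew v.
Proof. by move=> uv; congr haar_expect; apply/funext => a; congr psi; exact: uv. Qed.

(** The letters that do not occur can be integrated out. *)
Lemma Ew_rename k k' (j : 'I_k -> 'I_k') (u : word k) :
  {in map fst u &, injective j} -> Ew (wmap j u) = Ew u.
Proof.
move=> jinj; pose h (a : gpow K k') : gpow K k := fun i => a (j i).
rewrite -[RHS](@haar_comp R (gpow K k') (gpow K k) h).
- by congr haar_expect; apply/funext => a; congr psi; exact: evalw_wmap.
- exact: gpow_compact.
- exact: gpow_compact.
- apply: (@gpow_continuous K k _ h) => i.
  exact: (@gpow_proj_continuous K k' (j i)).
- by [].
- exact: rep_fun_word.
move=> x; exists (fun l => if [pick i | (i \in map fst u) && (j i == l)] is Some i then x i else 1%g).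
move=> y; congr psi; apply: evalw_eq_in => l lu; rewrite !gpow_proj_mul; congr (_ * _)%g.
have lu1 : l.1 \in map fst u by apply: map_f.
rewrite /h; case: pickP => [i /andP[iu /eqP ij]|/(_ l.1)]; last by rewrite lu1 eqxx.
by rewrite (jinj _ _ iu lu1 ij).
Qed.

Section FiniteAlphabet.
Variable I : finType.
Implicit Types (u : seq (I * bool)) (A : pred I).

Definition EW u : R[i] := Ew (wmap enum_rank u).

Let envg (a : gpow K #|I|) : I -> K := fun i => a (enum_rank i).

Lemma EW_eq u v :
  (forall g : I -> K, evalw g u = evalw g v) -> EW u = EW v.
Proof. by move=> uv; apply: Ew_eq => g; rewrite !evalw_wmap. Qed.

Lemma EW_rename (j : I -> I) u : injective j -> EW (wmap j u) = EW u.
Proof.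
move=> jinj; pose j' (i : 'I_#|I|) : 'I_#|I| := enum_rank (j (enum_val i)).
rewrite /EW -[RHS](@Ew_rename _ _ j').
  by apply: Ew_eq => g; rewrite !evalw_wmap; apply: evalw_ext => i; rewrite /j' enum_rankK.
by move=> i i' _ _ /enum_rank_inj /jinj /enum_val_inj.
Qed.

Lemma EW_rename_ord k (j : 'I_k -> I) (u : word k) : injective j ->
  EW (wmap j u) = Ew u.
Proof.
move=> jinj; rewrite -[RHS](@Ew_rename _ _ (fun i => enum_rank (j i))).
  by apply: Ew_eq => g; rewrite !evalw_wmap.
by move=> i i' _ _ /enum_rank_inj /jinj.
Qed.

Let EW_env u : EW u = haar_expect (fun a : gpow K #|I| => psi (evalw (envg a) u)).
Proof. by congr haar_expect; apply/funext => a; congr psi; exact: evalw_wmap. Qed.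

(** The elementary Nielsen transformations, several at a time. *)
Lemma EW_shear A (l r : I -> seq (I * bool)) u :
  (forall i x, x \in l i -> ~~ A x.1) -> (forall i x, x \in r i -> ~~ A x.1) ->
  EW (wsub (fun i => if A i then l i ++ (i, false) :: r i else [:: (i, false)]) u) = EW u.
Proof.
move=> lA rA; pose A' : pred 'I_#|I| := fun i => A (enum_val i).
pose lf (w : I -> seq (I * bool)) (a : gpow K #|I|) : gpow K #|I| :=
  fun i => evalw (envg a) (w (enum_val i)).
have lfE w a b : (forall i x, x \in w i -> ~~ A x.1) -> lf w (merge A' a b) = lf w a.
  move=> wA; apply/funext => i; apply: evalw_eq_in => x xw.
  by rewrite /envg /merge /A' enum_rankK (negPf (wA _ _ xw)).
pose f (a : gpow K #|I|) := psi (evalw (envg a) u).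
have fr : rep_fun f.
  apply: (@rep_fun_ext _ _ (fun a : gpow K #|I| => psi (evalw a (wmap enum_rank u)))).
    by move=> a; rewrite evalw_wmap.
  exact: rep_fun_word.
set Y := fun i => _.
have fE a : f (merge A' a (lf l a * a * lf r a)%g) = psi (evalw (envg a) (wsub Y u)).
  rewrite /f evalw_wsub; congr psi; apply: evalw_ext => i.
  rewrite /envg /merge /A' enum_rankK /Y; case: ifP => Ai; last by rewrite evalw_letter.
  by rewrite !gpow_proj_mul /lf enum_rankK evalw_cat evalw_cons mulgA.
rewrite !EW_env -[RHS](@haar_shear R K #|I| K_compact A' (lf l) (lf r) f) => [|a b|a b||]//.
- by congr haar_expect; apply/funext => a; rewrite fE.
- exact: lfE.
- exact: lfE.
apply: (@rep_fun_ext _ _ (fun a : gpow K #|I| => psi (evalw a (wmap enum_rank (wsub Y u))))).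
  by move=> a; rewrite evalw_wmap fE.
exact: rep_fun_word.
Qed.

Lemma EW_inv A u : EW (wsub (fun i => [:: (i, A i)]) u) = EW u.
Proof.
pose A' : pred 'I_#|I| := fun i => A (enum_val i).
pose f (a : gpow K #|I|) := psi (evalw (envg a) u).
have fr : rep_fun f.
  apply: (@rep_fun_ext _ _ (fun a : gpow K #|I| => psi (evalw a (wmap enum_rank u)))).
    by move=> a; rewrite evalw_wmap.
  exact: rep_fun_word.
set Y := fun i => _.
have fE a : f (merge A' a a^-1%g) = psi (evalw (envg a) (wsub Y u)).
  rewrite /f evalw_wsub; congr psi; apply: evalw_ext => i.
  by rewrite /envg /merge /A' enum_rankK evalw_letter /=; case: ifP.
rewrite !EW_env -[RHS](@haar_inv_coords R K #|I| K_compact A' f) => [||]//.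
  by congr haar_expect; apply/funext => a; rewrite fE.
apply: (@rep_fun_ext _ _ (fun a : gpow K #|I| => psi (evalw a (wmap enum_rank (wsub Y u))))).
  by move=> a; rewrite evalw_wmap fE.
exact: rep_fun_word.
Qed.
End FiniteAlphabet.
End WordExpectations.

(** * Stallings foldings preserve Haar measure *)

Section Folding.
Local Open Scope complex_scope.
Local Open Scope ring_scope.
Variables (R : realType) (K : topGroupType) (psi : K -> R[i]).
Hypotheses (K_compact : compact [set: K]) (psi_rep : rep_fun psi).
Variable I : finType.

(** An edge of a labelled graph, from its source to its target, or a variable
    that has already been split off. [None] is the base vertex. *)
Definition item : Type := (option I * (I * bool) * option I) + I.
Implicit Types (Y : I -> item) (V Lam : {set I}).

(** A vertex other than the base is itself a letter of the alphabet: the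
    value of the path that leads to it is a random variable of its own. *)
Definition vword (s : option I) : seq (I * bool) :=
  if s is Some v then [:: (v, false)] else [::].

Definition iword (y : item) : seq (I * bool) :=
  match y with
  | inl (s, l, t) => winv (vword s) ++ l :: vword t
  | inr v => [:: (v, false)]
  end.

Definition vlive V (s : option I) := if s is Some v then v \in V else true.

(** [V] holds the letters still used as vertices, [Lam] those used as labels;
    a letter split off is neither. *)
Definition well_formed V Lam (y : item) :=
  match y with
  | inl (s, l, t) => [&& vlive V s, l.1 \in Lam & vlive V t]
  | inr v => (v \notin V) && (v \notin Lam)
  end.

Definition flip (y : item) : item :=
  match y with inl (s, l, t) => inl (t, linv l, s) | inr v => inr v end.

Definition source (y : item) : option (option I * (I * bool)) :=
  if y is inl (s, l, t) then Some (s, l) else None.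

Definition target (y : item) : option I := if y is inl (s, l, t) then t else None.

Definition is_edge (y : item) := if y is inl _ then true else false.

Definition measure_preserving Y := forall u,
  EW psi (wsub (fun e => iword (Y e)) u) = EW psi u.

Lemma evalw_vword (Q : groupType) (g : I -> Q) s :
  evalw g (vword s) = if s is Some v then g v else 1%g.
Proof. by case: s => //= v; rewrite mulg1. Qed.

Lemma evalw_iword (Q : groupType) (g : I -> Q) s l t :
  evalw g (iword (inl (s, l, t))) =
  ((evalw g (vword s))^-1 * (if l.2 then (g l.1)^-1 else g l.1) * evalw g (vword t))%g.
Proof. by rewrite /= evalw_cat evalw_winv evalw_cons mulgA. Qed.

Lemma evalw_flip (Q : groupType) (g : I -> Q) y :
  evalw g (iword (flip y)) = if is_edge y then (evalw g (iword y))^-1%g else evalw g (iword y).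
Proof.
case: y => // -[[s [i e]] t]; rewrite [flip _]/= !evalw_iword /= !invMg invgK mulgA.
by case: e; rewrite ?invgK.
Qed.

Lemma measure_preserving_flip Y (A : pred I) : (forall e, A e -> is_edge (Y e)) ->
  measure_preserving (fun e => if A e then flip (Y e) else Y e) -> measure_preserving Y.
Proof.
move=> AY mp u; rewrite -(EW_inv K_compact psi_rep A u) -[RHS]mp.
apply: EW_eq => g; rewrite !evalw_wsub; apply: evalw_ext => e.
rewrite evalw_letter /=; case Ae: (A e) => //.
by rewrite evalw_flip AY // invgK.
Qed.

Definition rename_vertex (v : I) (t1 : option I) (s : option I) :=
  if s == Some v then t1 else s.

Definition fold_item (v : I) (t1 : option I) (y : item) : item :=
  if y is inl (s, l, t) then inl (rename_vertex v t1 s, l, rename_vertex v t1 t) else y.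

(** Merge two edges [e1], [e2] with the same source and label, the second of
    which ends at [v]. The substitution that identifies [v] with the end of
    [e1] multiplies the letter [v] by a word in other letters; afterwards the
    item [e2] carries [v] alone, and the ends of the other edges at [v] are
    corrected by multiplication with it. All are shears. *)
Lemma measure_preserving_fold Y V Lam e1 e2 s l t1 v :
  [disjoint V & Lam] -> (forall e, well_formed V Lam (Y e)) -> e1 != e2 ->
  Y e1 = inl (s, l, t1) -> Y e2 = inl (s, l, Some v) -> t1 != Some v ->
  measure_preserving (fun e => if e == e2 then inr v else fold_item v t1 (Y e)) ->
  measure_preserving Y.
Proof.
move=> VLam wf e12 Y1 Y2 t1v; set Y' := fun e => _ => mp u.
have vV : v \in V by have := wf e2; rewrite Y2 => /and3P[].
have vLam : v \notin Lam by rewrite (disjointFr VLam).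
(* [Theta] shifts the letter [v]; [Phi1] and [Phi2] are the corrections on the
   side of the items: [Phi1] restores the edges at [v], [Phi2] compares [e2]
   with [e1]. *)
pose hl e := if Y e is inl (s, _, _) then if s == Some v then [:: (e2, true)] else [::] else [::].
pose hr e := if target (Y e) == Some v then [:: (e2, false)] else [::].
pose Phi1 e := if e != e2 then hl e ++ (e, false) :: hr e else [:: (e, false)].
pose Phi2 e := if e == e2 then [:: (e1, false)] ++ [:: (e, false)] else [:: (e, false)].
pose Theta i := if i == v then vword t1 ++ (i, false) :: [::] else [:: (i, false)].
have t1P x : x \in vword t1 -> x.1 != v.
  by move: t1v; case: (t1) => //= w wv; rewrite inE => /eqP -> /=; apply: contra wv => /eqP ->.
rewrite -[LHS](EW_shear K_compact psi_rep (A := pred1 v) (l := fun=> vword t1) (r := fun=> [::])) => [|i x /t1P //|//].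
have -> : EW psi u = EW psi (wsub Phi2 u).
  rewrite -[LHS](EW_shear K_compact psi_rep (A := pred1 e2) (l := fun=> [:: (e1, false)]) (r := fun=> [::])) => [||//] //.
  by move=> i x; rewrite inE => /eqP -> /=.
have -> : EW psi (wsub Phi2 u) = EW psi (wsub Phi1 (wsub Phi2 u)).
  rewrite -[LHS](EW_shear K_compact psi_rep (A := predC1 e2) (l := hl) (r := hr)) => [//|i x|i x].
    rewrite /hl; case: (Y i) => // -[[s' l'] t']; case: ifP => // _.
    by rewrite inE => /eqP -> /=; rewrite negbK.
  by rewrite /hr; case: ifP => // _; rewrite inE => /eqP -> /=; rewrite negbK.
rewrite -[RHS]mp; apply: EW_eq => g; rewrite !evalw_wsub; apply: evalw_ext => e.
set g' := fun i => evalw g (Theta i).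
have g'v : g' v = (evalw g (vword t1) * g v)%g by rewrite /g' /Theta eqxx evalw_cat evalw_letter.
have g'E i : i != v -> g' i = g i by rewrite /g' /Theta => /negPf ->; rewrite evalw_letter.
have g's s' : vlive V s' -> evalw g' (vword s') =
    (evalw g (vword (rename_vertex v t1 s')) * (if s' == Some v then g v else 1))%g.
  move=> _; rewrite /rename_vertex; have [->|s'v] := eqVneq s' (Some v).
    by rewrite [in LHS]evalw_vword /= g'v.
  rewrite mulg1 !evalw_vword; case: s' s'v => // w wv; rewrite g'E //; by apply: contra wv => /eqP ->.
have g'l (l' : I * bool) : l'.1 \in Lam -> (if l'.2 then (g' l'.1)^-1 else g' l'.1)%g =
    (if l'.2 then (g l'.1)^-1 else g l'.1)%g.
  by move=> lL; rewrite g'E //; apply: contraNneq vLam => <-.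
pose z e := evalw g (iword (Y' e)).
have z2 : z e2 = g v by rewrite /z /Y' eqxx /= mulg1.
have zE e' : e' != e2 -> evalw z (Phi1 e') = evalw g' (iword (Y e')).
  move=> e'2; rewrite /Phi1 e'2 evalw_cat evalw_cons /=.
  rewrite {2}/z /Y' (negPf e'2) /hl /hr; have := wf e'; case: (Y e') => [[[s' l'] t']|w] /=.
    move=> /and3P[vs lL vt]; rewrite -!/(iword (inl (_, _, _))) !evalw_iword g's // g's // g'l //.
    rewrite invMg -!mulgA; congr (_ * _)%g.
      by case: ifP; rewrite /= ?z2 ?mulg1 ?invg1.
    by do 3!congr (_ * _)%g; case: ifP; rewrite /= ?z2 ?mulg1.
  by rewrite !mulg1 mul1g => /andP[wV _]; rewrite g'E //; apply: contraNneq wV => ->.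
have [->|ne] := eqVneq e e2; last by rewrite -zE // /Phi2 (negPf ne) evalw_letter.
rewrite /Phi2 eqxx evalw_cat !evalw_letter /= zE //.
rewrite {1}/Phi1 eqxx /= mulg1 -/(z e2) z2 Y1 Y2 !evalw_iword.
have := wf e1; rewrite Y1 => /and3P[_ _ vt1].
rewrite -!mulgA; do 2!congr (_ * _)%g; rewrite !evalw_vword g'v evalw_vword; congr (_ * _)%g.
case: (t1) t1v => // w wv; rewrite g'E //; by apply: contra wv => /eqP ->.
Qed.

Definition orient (o : bool) (y : item) := if o then flip y else y.

Lemma well_formed_orient V Lam o y : well_formed V Lam y -> well_formed V Lam (orient o y).
Proof. by case: o => //; case: y => // -[[s l] t] /and3P[a b c] /=; rewrite a b c. Qed.

Lemma evalw_orient_S (Q : groupType) (S : Q -> Prop) (g : I -> Q) o y :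
  (forall a, S a -> S a^-1%g) ->
  S (evalw g (iword (orient o y))) -> S (evalw g (iword y)).
Proof.
move=> SV; case: o => //; rewrite /orient evalw_flip; case: ifP => // _ /SV.
by rewrite invgK.
Qed.

(** If no two edges can be folded then each letter acts on the vertices by a
    partial injection; extended to permutations, these fix the base vertex
    along every edge, which a generating tuple forbids unless the base is the
    only vertex. The pairs [h1], [h2] consist of an item and an orientation. *)
Lemma foldable_pair Y V Lam : [disjoint V & Lam] ->
  (forall e, well_formed V Lam (Y e)) -> generating (fun e => iword (Y e)) ->
  V != finset.set0 -> exists h1 h2 : I * bool,
    [/\ is_edge (Y h1.1), is_edge (Y h2.1), h1.1 != h2.1
      & source (orient h1.2 (Y h1.1)) = source (orient h2.2 (Y h2.1))].
Proof.
move=> VLam wf gY /set0Pn[v vV]; apply: contrapT => nofold.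
pose oy (h : I * bool) := orient h.2 (Y h.1).
have same (h h' : I * bool) s l : source (oy h) = Some (s, l) -> source (oy h') = Some (s, l) -> h = h'.
  move=> E E'; have e1 : h.1 = h'.1.
    apply: contrapT => /eqP ne; apply: nofold; exists h, h'; split => //; last by rewrite -/(oy h) E.
      by move: E; rewrite /oy; case: (Y h.1) => //; case: h.2.
    by move: E'; rewrite /oy; case: (Y h'.1) => //; case: h'.2.
  case: h h' e1 E E' => [e o] [e' o'] /= <-; rewrite /oy /=.
  case: (Y e) => [[[s0 [i0 e0]] t0]|w]; last by case: o.
  by case: o o' => [] [] //= [_ <-] [_ ]; case: e0.
have sigmaP i : exists sg : {perm option I}, forall e o s t,
    oy (e, o) = inl (s, (i, false), t) -> sg s = t.
  pose P (h : I * bool) := if source (oy h) is Some (_, (j, false)) then j == i else false.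
  pose src h := if source (oy h) is Some (s, _) then s else None.
  have [|sg sgP] := @perm_extend_pairs (option I) _ P src (fun h => target (oy h)).
    move=> h h'; rewrite /P /src.
    have flipE (k : I * bool) s l t : oy k = inl (s, l, t) -> source (oy (k.1, ~~ k.2)) = Some (t, linv l).
      rewrite /oy; case: k => e o /=; case: (Y e) => [[[s0 l0] t0]|w]; last by case: o.
      by case: o => /= -[_ <- <-] //; rewrite linvK.
    case E: (oy h) => [[[s [j []]] t]|] //=; case E': (oy h') => [[[s' [j' []]] t']|] //=.
    move=> /eqP ji /eqP j'i; split=> D.
      have hh : h = h' by apply: (@same _ _ s (i, false)); rewrite ?E ?E' /= ?ji ?j'i ?D.
      by move: E; rewrite hh E' => -[].
    have hh : (h.1, ~~ h.2) = (h'.1, ~~ h'.2).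
      by apply: (@same _ _ t (i, true)); rewrite (flipE _ _ _ _ E, flipE _ _ _ _ E') /linv /= ?ji ?j'i ?D.
    have {}hh : h = h' by case: h h' hh {E E'} => [a b] [a' b'] /= [-> /negb_inj ->].
    by move: E; rewrite hh E' => -[].
  exists sg => e o s t E; have := sgP (e, o); rewrite /P /src E /= eqxx; exact.
have [sg sgP] := choice sigmaP.
(* A vertex letter exchanges the base with that vertex. So every edge word
   fixes the base: to the source, along the edge, and back from the target. *)
pose g i : {perm option I} := if i \in V then tperm None (Some i) else if i \in Lam then sg i else 1%g.
have := gY {perm option I} (fun s => s None = None) g.
have vg s : vlive V s -> (evalw g (vword s) None = s) /\ (evalw g (vword s) s = None).
  by rewrite evalw_vword; case: s => [w /= wV|_]; rewrite ?perm1 // /g wV tpermL tpermR.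
move=> /(_ _ _ _ _ v); rewrite {2}/g vV tpermL => H; suff: Some v = None by [].
apply: H => [|a b a1 b1|a a1|e]; first by rewrite perm1.
- by rewrite permM a1.
- by rewrite -{1}a1 permK.
have := wf e; case E: (Y e) => [[[s [i o]] t]|w] /=; last first.
  by move=> /andP[wV wL]; rewrite mulg1 /g (negPf wV) (negPf wL) perm1.
move=> /and3P[vs iL vt]; rewrite -/(iword (inl (s, (i, o), t))) evalw_iword /= !permM.
have -> : ((evalw g (vword s))^-1)%g None = s by rewrite -{1}(vg s vs).2 permK.
have gi : g i = sg i by rewrite /g iL (disjointFl VLam iL).
have -> : (if o then (g i)^-1 else g i)%g s = t.
  have := sgP i e o; rewrite /oy E gi; case: o {E} => /= H'.
    by rewrite -(H' t s erefl) permK.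
  exact: H'.
exact: (vg t vt).2.
Qed.

(** Merging loses no generators: [v] itself becomes one of the items, and it
    accounts for the difference between the two ends. *)
Lemma generating_fold Y V Lam e1 e2 s l t1 v : generating (fun e => iword (Y e)) ->
  (forall e, well_formed V Lam (Y e)) -> v \in V -> [disjoint V & Lam] ->
  e1 != e2 -> Y e1 = inl (s, l, t1) -> Y e2 = inl (s, l, Some v) -> t1 != Some v ->
  generating (fun e => iword (if e == e2 then inr v else fold_item v t1 (Y e))).
Proof.
move=> gY wf vV VLam e12 Y1 Y2 t1v Q S g S1 SM SV H.
have Sgv : S (g v) by have := H e2; rewrite eqxx /= mulg1.
pose g' i := if i == v then evalw g (vword t1) else g i.
have g's s' : evalw g' (vword s') = evalw g (vword (rename_vertex v t1 s')).
  rewrite /rename_vertex; have [->|s'v] := eqVneq s' (Some v).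
    by rewrite [in LHS]evalw_vword /g' eqxx.
  rewrite !evalw_vword; case: s' s'v => // w wv; rewrite /g'; case: eqP => // wv'.
  by rewrite wv' eqxx in wv.
have g'E i : i != v -> g' i = g i by rewrite /g' => /negPf ->.
have g'fold e : evalw g' (iword (Y e)) = evalw g (iword (fold_item v t1 (Y e))).
  have := wf e; case: (Y e) => [[[s' l'] t']|w] /=.
    move=> /and3P[_ lL _]; rewrite -!/(iword (inl (_, _, _))) !evalw_iword !g's g'E //.
    by apply: contraTneq vV => <-; rewrite (disjointFl VLam).
  by move=> /andP[wV _]; rewrite g'E //; apply: contraNneq wV => ->.
have Sg' : forall i, S (g' i).
  apply: (gY Q S g') => // e; have [->|ne] := eqVneq e e2; last first.
    by rewrite g'fold; have := H e; rewrite (negPf ne).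
  have -> : evalw g' (iword (Y e2)) = evalw g' (iword (Y e1)).
    rewrite Y1 Y2 !evalw_iword; congr (_ * _)%g; rewrite !g's /rename_vertex eqxx.
    by rewrite (negPf t1v).
  by rewrite g'fold; have := H e1; rewrite (negPf e12).
by move=> i; have [->//|iv] := eqVneq i v; rewrite -(g'E i iv).
Qed.

(** Each fold removes a vertex; with only the base left, the items are letters
    up to sign, and a generating tuple of letters is a permutation. Two edges
    with the same ends are impossible, as they would carry the same word. *)
Theorem generating_measure_preserving Y V Lam : [disjoint V & Lam] ->
  (forall e, well_formed V Lam (Y e)) -> generating (fun e => iword (Y e)) ->
  measure_preserving Y.
Proof.
move: {2}#|V| (erefl #|V|) => n; elim: n Y V => [|n IH] Y V cV VLam wf gY.
  have V0 : V = finset.set0 by apply/eqP; rewrite -cards_eq0 cV.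
  have vl s : vlive V s -> s = None by case: s => //= w; rewrite V0 inE.
  pose l e : I * bool := if Y e is inl (_, l, _) then l else if Y e is inr v then (v, false) else (e, false).
  have YE e : iword (Y e) = [:: l e].
    rewrite /l; have := wf e; case: (Y e) => [[[s l'] t]|w] //= /and3P[/vl -> _ /vl ->] //.
  have fb : bijective (fun e => (l e).1).
    by apply: (generating_letter (e := fun e => (l e).2) gY) => e; rewrite YE -surjective_pairing.
  move=> u; rewrite -[RHS](EW_inv K_compact psi_rep (fun e => (l e).2)).
  rewrite -[RHS](EW_rename K_compact psi_rep _ (bij_inj fb)); apply: EW_eq => g.
  rewrite evalw_wsub evalw_wmap evalw_wsub; apply: evalw_ext => e.
  by rewrite YE !evalw_letter.
have V0 : V != finset.set0 by rewrite -cards_eq0 cV.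
have [h1 [h2 [d1 d2 h12 E]]] := foldable_pair VLam wf gY V0.
pose A : pred I := fun e => (e == h1.1) && h1.2 || (e == h2.1) && h2.2.
apply: (@measure_preserving_flip _ A).
  by move=> e /orP[] /andP[/eqP ->].
set Y1 := fun e => _.
have Y1E e : exists o, Y1 e = orient o (Y e) by exists (A e).
have Y1h1 : Y1 h1.1 = orient h1.2 (Y h1.1).
  by rewrite /Y1 /A eqxx (negPf h12) /= orbF.
have Y1h2 : Y1 h2.1 = orient h2.2 (Y h2.1).
  by rewrite /Y1 /A eqxx eq_sym (negPf h12).
have wf1 e : well_formed V Lam (Y1 e).
  by have [b ->] := Y1E e; exact: well_formed_orient.
have gY1 : generating (fun e => iword (Y1 e)).
  move=> Q S g S1 SM SV H; apply: (gY Q S g) => // e; have := H e; have [b ->] := Y1E e.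
  exact: evalw_orient_S.
have [s [l [t1 [t2 [F1 F2]]]]] : exists s l t1 t2,
    Y1 h1.1 = inl (s, l, t1) /\ Y1 h2.1 = inl (s, l, t2).
  rewrite Y1h1 Y1h2; move: E.
  have oe b y : is_edge y -> is_edge (orient b y) by case: b => //; case: y => // -[[]].
  move: (oe h1.2 _ d1) (oe h2.2 _ d2).
  case: (orient h1.2 _) => // -[[s l] t] _; case: (orient h2.2 _) => // -[[s' l'] t'] _.
  by case=> -> ->; exists s', l', t, t'.
have {E} fold (e1 e2 : I) t1' v : e1 != e2 -> Y1 e1 = inl (s, l, t1') ->
    Y1 e2 = inl (s, l, Some v) -> t1' != Some v -> measure_preserving Y1.
  move=> e12 G1 G2 tv.
  have vV : v \in V by have := wf1 e2; rewrite G2 => /and3P[].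
  have t1V : vlive V t1' by have := wf1 e1; rewrite G1 => /and3P[].
  apply: (measure_preserving_fold VLam wf1 e12 G1 G2 tv); apply: (IH _ (V :\ v)).
  - by move: cV; rewrite (cardsD1 v V) vV => -[].
  - by apply: disjointWl VLam; exact: subD1set.
  - have ren s' : vlive V s' -> vlive (V :\ v) (rename_vertex v t1' s').
      rewrite /rename_vertex; case: eqP => [_ _|].
        by case: t1' t1V tv {G1} => //= w wV wv; rewrite !inE wV andbT; apply: contra wv => /eqP ->.
      by case: s' => //= w wv wV; rewrite !inE wV andbT; apply: contra_notN wv => /eqP ->.
    move=> e; case: ifP => _.
      by rewrite /= !inE eqxx /= (disjointFr VLam vV).
    have := wf1 e; case: (Y1 e) => [[[s' l'] t']|w] /=.
      by move=> /and3P[/ren -> -> /ren ->].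
    by move=> /andP[wV ->]; rewrite !inE negb_and wV orbT.
  - exact: (generating_fold gY1 wf1 vV VLam e12 G1 G2 tv).
have [t12|t12] := eqVneq t1 t2.
  have [g gP] := generating_surj h1.1 gY1.
  have h21 : h2.1 != h1.1 by rewrite eq_sym.
  by have := gP h2.1; rewrite F2 -t12 -F1 gP eqxx h21.
case: t2 t12 F2 => [v|] t12 F2; first exact: (fold h1.1 h2.1 t1 v).
case: t1 t12 F1 => [v|] // t12 F1; apply: (fold h2.1 h1.1 None v) => //.
by rewrite eq_sym.
Qed.
End Folding.

(** * Basis independence of word expectations *)

Section BasisIndependence.
Local Open Scope complex_scope.
Local Open Scope ring_scope.
Variables (R : realType) (K : topGroupType) (psi : K -> R[i]).
Hypotheses (K_compact : compact [set: K]) (psi_rep : rep_fun psi).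

(** Subdivide: the loop labelled [Y a] is cut into edges, one for each letter of
    [Y a]. The alphabet [I] of pairs [(a, j)] serves at once for the items, for
    the vertices inside the loops, for the labels, and for padding. The product
    of the edges along a loop telescopes to the word, and multiplying the last
    edge of each loop by the others is a shear. *)
Theorem Ew_generating k (Y : 'I_k -> word k) (u : word k) :
  generating Y -> Ew psi (wsub Y u) = Ew psi u.
Proof.
move=> gY.
have Ypos a : (0 < size (Y a))%N.
  rewrite lt0n; apply/negP => /nilP Ya; have [g gP] := generating_surj a gY.
  by have := gP a; rewrite Ya !eqxx.
pose L := (\max_a size (Y a))%N.
have YL a : (size (Y a) < L.+1)%N by rewrite ltnS (@leq_bigmax _ (fun a => size (Y a))).
pose I : finType := ('I_k * 'I_L.+1)%type.
(* The letter [a] of the old alphabet becomes the last position of the loop. *)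
pose lst (a : 'I_k) : I := (a, inord (size (Y a)).-1).
have lst_inj : injective lst by move=> a b [].
have lstE a : ((lst a).2 : nat) = (size (Y a)).-1.
  by rewrite /= inordK // (leq_ltn_trans (leq_pred _) (YL a)).
pose vert (a : 'I_k) (j : nat) : option I :=
  if (0 < j < size (Y a))%N then Some (a, inord j.-1) else None.
pose y0 (a : 'I_k) : 'I_k * bool := (a, false).
pose let_ (a : 'I_k) (j : nat) : I * bool :=
  let l := nth (y0 a) (Y a) j in (lst l.1, l.2).
(* Positions beyond the length of the loop are padding. *)
pose Z (e : I) : item I := if (e.2 < size (Y e.1))%N
  then inl (vert e.1 e.2, let_ e.1 e.2, vert e.1 e.2.+1) else inr e.
pose V : {set I} := [set e : I | (e.2.+1 < size (Y e.1))%N].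
pose Lam : {set I} := [set e : I | e.2.+1 == size (Y e.1)].
have VLam : [disjoint V & Lam].
  apply/pred0P => e /=; rewrite !inE; apply/negP => /andP[+ /eqP E].
  by rewrite E ltnn.
have lstL a : lst a \in Lam by rewrite inE lstE /= prednK.
have vertV a j : vlive V (vert a j).
  rewrite /vert; case: ifP => //= /andP[j0 ja]; rewrite inE /= inordK ?prednK //.
  by have := YL a; lia.
have wfZ e : well_formed V Lam (Z e).
  rewrite /Z; case: ifP => [_|] /=; first by rewrite !vertV lstL.
  rewrite !inE; case: e => a j /= /negbT; rewrite -leqNgt => ja.
  by rewrite -leqNgt (leq_trans ja) //= gtn_eqF.
pose P (a : 'I_k) (j : nat) : seq (I * bool) := mkseq (fun i => ((a, inord i), false)) j.
have tele (Q : groupType) (g : I -> Q) a j : (j <= size (Y a))%N ->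
    evalw (fun e => evalw g (iword (Z e))) (P a j) =
    (evalw (fun b => g (lst b)) (take j (Y a)) * evalw g (vword (vert a j)))%g.
  elim: j => [_|j IH ja]; first by rewrite take0 mulg1.
  rewrite /P mkseqS evalw_rcons -/(P a j) IH ?(ltnW ja) // (take_nth (y0 a)) // evalw_rcons.
  have jL : (j < L.+1)%N by have := YL a; lia.
  rewrite /= {1}/Z /= inordK // ja evalw_iword /= -!mulgA; congr (_ * _)%g.
  by rewrite mulVKg.
have teleT (Q : groupType) (g : I -> Q) a :
    evalw (fun e => evalw g (iword (Z e))) (P a (size (Y a))) = evalw (fun b => g (lst b)) (Y a).
  by rewrite tele // take_size /vert ltnn andbF /= mulg1.
have gZ : generating (fun e => iword (Z e)).
  move=> Q S g S1 SM SV H.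
  have Slst a : S (g (lst a)).
    apply: (gY Q S (fun b => g (lst b))) => // b; rewrite -teleT.
    exact: (evalw_subgroup _ S1 SM SV H).
  have Svert a j : (j <= size (Y a))%N -> S (evalw g (vword (vert a j))).
    move=> ja; have := tele Q g a j ja => /esym /(canRL (mulKg _)) ->.
    refine (SM _ _ (SV _ _) _); first exact: (evalw_subgroup _ S1 SM SV Slst).
    exact: (evalw_subgroup _ S1 SM SV H).
  case=> a j; have [ja|ja] := ltnP j.+1 (size (Y a)).
    have := Svert a j.+1 (ltnW ja); rewrite evalw_vword /vert /= ja (_ : inord j = j) //.
    by apply: val_inj; rewrite /= inordK.
  have [ja'|ja'] := ltnP j (size (Y a)).
    rewrite (_ : (a, j) = lst a) //; congr pair; apply: val_inj.
    by have := lstE a; rewrite /= => ->; lia.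
  by have := H (a, j); rewrite /Z /= ltnNge ja' /= mulg1.
have mp := generating_measure_preserving K_compact psi_rep VLam wfZ gZ.
rewrite -[LHS](EW_rename_ord K_compact psi_rep _ lst_inj).
rewrite -[RHS](EW_rename_ord K_compact psi_rep _ lst_inj).
transitivity (EW psi (wsub (fun a => P a (size (Y a))) u)).
  rewrite -[RHS]mp; apply: EW_eq => g; rewrite evalw_wmap !evalw_wsub.
  by apply: evalw_ext => a; rewrite teleT.
pose A (e : I) := e == lst e.1.
rewrite -[RHS](EW_shear K_compact psi_rep (A := A)
  (l := fun e => P e.1 (size (Y e.1)).-1) (r := fun=> [::])) => [|e x|//].
  apply: EW_eq => g; rewrite !evalw_wsub evalw_wmap; apply: evalw_ext => a.
  rewrite /A eqxx; congr evalw.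
  by rewrite /= -{1}(prednK (Ypos a)) /P mkseqS -cats1.
move=> /mapP[j]; rewrite mem_iota add0n => /andP[_ jl] ->; rewrite /A /=.
apply/eqP => /(congr1 (fun e' : I => e'.2 : nat)); rewrite lstE /= inordK => [jE|]; first by rewrite jE ltnn in jl.
by have := YL e.1; move: jl; rewrite /=; lia.
Qed.

(** Maps to a finite group are counted: a retraction embeds the tuples of
    length [k] into those of length [k'], and an injection between finite sets
    of equal size is a bijection, which is the Hopf property. *)
Lemma retract_rank k k' (Y : 'I_k' -> word k) (X : 'I_k -> word k') :
  (forall N (g : 'I_k -> 'S_N) j, evalw (fun i => evalw g (Y i)) (X j) = g j) ->
  (k <= k')%N /\ (k = k' ->
    forall N (g : 'I_k' -> 'S_N) i, evalw (fun j => evalw g (X j)) (Y i) = g i).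
Proof.
move=> YX; pose Phi N (g : {ffun 'I_k -> 'S_N}) : {ffun 'I_k' -> 'S_N} := [ffun i => evalw g (Y i)].
pose Psi N (g : {ffun 'I_k' -> 'S_N}) : {ffun 'I_k -> 'S_N} := [ffun i => evalw g (X i)].
have PhiK N : cancel (@Phi N) (@Psi N).
  move=> g; apply/ffunP => j; rewrite ffunE -[RHS]YX; apply: evalw_ext => i.
  by rewrite ffunE.
split=> [|kk' N g i].
  have := leq_card _ (can_inj (PhiK 2)).
  by rewrite !card_ffun !card_ord card_Sn leq_exp2l.
have cardE : #|{ffun 'I_k -> 'S_N}| = #|{ffun 'I_k' -> 'S_N}|.
  by rewrite !card_ffun !card_ord kk'.
have [Psi' PhiK' Psi'K] := inj_card_bij (can_inj (PhiK N)) (eq_leq (esym cardE)).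
have E : Phi N (Psi N (finfun g)) = finfun g.
  by rewrite -{1}(Psi'K (finfun g)) PhiK Psi'K.
have := congr1 (fun f : {ffun 'I_k' -> 'S_N} => f i) E; rewrite !ffunE => <-.
by apply: evalw_ext => j; rewrite ffunE; apply: evalw_ext => i'; rewrite ffunE.
Qed.

Section Bases.
Variables (F : groupType) (H : set F).

Lemma free_basis_words k k' (b : 'I_k -> F) (b' : 'I_k' -> F) :
  free_basis H b -> free_basis H b' ->
  exists Y : 'I_k' -> word k, forall i, evalw b (Y i) = b' i.
Proof.
move=> [Hb _] [Hb' _].
have /choice[Y YE] : forall i, exists u : word k, evalw b u = b' i; last by exists Y.
move=> i; have : H (b' i) by rewrite Hb'; exists [:: (i, false)] => //=; rewrite mulg1.
by rewrite Hb => -[u _ <-]; exists u.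
Qed.

Lemma free_basis_rank k k' (b : 'I_k -> F) (b' : 'I_k' -> F) :
  free_basis H b -> free_basis H b' -> k = k'.
Proof.
suff le n n' (c : 'I_n -> F) (c' : 'I_n' -> F) :
    free_basis H c -> free_basis H c' -> (n <= n')%N.
  by move=> fb fb'; apply/eqP; rewrite eqn_leq !(le _ _ _ _ fb fb', le _ _ _ _ fb' fb).
move=> fc fc'; have [Y YE] := free_basis_words fc fc'; have [X XE] := free_basis_words fc' fc.
apply: (retract_rank (Y := Y) (X := X) _).1 => N g j.
rewrite -evalw_wsub -[RHS](evalw_letter g (j, false)).
apply: (free_basis_evalw _ fc); rewrite evalw_wsub evalw_letter -[RHS]XE.
exact: evalw_ext.
Qed.

(** A second basis, written in the first one, is a generating tuple of words. *)
Theorem Ew_basis k k' (b : 'I_k -> F) (b' : 'I_k' -> F) (u : word k) (u' : word k') :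
  free_basis H b -> free_basis H b' -> evalw b u = evalw b' u' -> Ew psi u = Ew psi u'.
Proof.
move=> fb fb' E; have kk' := free_basis_rank fb fb'; case: _ / kk' b' u' fb' E => b' u' fb' E.
have [Y YE] := free_basis_words fb fb'; have [X XE] := free_basis_words fb' fb.
rewrite -(@Ew_generating _ Y u').
  apply: Ew_eq => g; apply: (free_basis_evalw _ fb); rewrite E evalw_wsub.
  by apply: evalw_ext.
move=> Q S g S1 SM SV Sg i.
have -> : g i = evalw (fun e => evalw g (Y e)) (X i).
  rewrite -evalw_wsub -[LHS](evalw_letter g (i, false)).
  apply: (free_basis_evalw _ fb); rewrite evalw_wsub evalw_letter -[LHS]XE.
  by apply: evalw_ext.
exact: (evalw_subgroup _ S1 SM SV Sg).
Qed.
End Bases.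
End BasisIndependence.

(** * Types of walks along a word *)

Section EquivalenceTypes.
Variables (L : nat) (r : rel 'I_L.+1).
Hypotheses (r_refl : reflexive r) (r_sym : symmetric r) (r_trans : transitive r).

Definition least_equiv : {ffun 'I_L.+1 -> 'I_L.+1} :=
  [ffun j => nth j (enum 'I_L.+1) (find (r^~ j) (enum 'I_L.+1))].

Lemma least_equivP j : r (least_equiv j) j.
Proof.
by rewrite ffunE; apply: (nth_find j (a := r^~ j)); apply/hasP; exists j; rewrite ?mem_enum.
Qed.

Lemma least_equiv_le i j : r i j -> (least_equiv j <= i)%N.
Proof.
move=> rij; rewrite ffunE leqNgt; apply/negP.
have hf : has (r^~ j) (enum 'I_L.+1) by apply/hasP; exists i; rewrite ?mem_enum.
rewrite nth_enum_ord; last by move: hf; rewrite has_find size_enum_ord.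
by move=> /(before_find j); rewrite nth_ord_enum rij.
Qed.

Lemma least_equiv_eq i j : (least_equiv i == least_equiv j) = r i j.
Proof.
apply/eqP/idP => [E|rij].
  by apply: r_trans (least_equivP j); rewrite -E r_sym least_equivP.
apply: val_inj; apply/eqP; rewrite eqn_leq !least_equiv_le //.
  exact: r_trans (least_equivP i) rij.
by apply: r_trans (least_equivP j) _; rewrite r_sym.
Qed.

Lemma least_equiv_idem j : least_equiv (least_equiv j) = least_equiv j.
Proof. by apply/eqP; rewrite least_equiv_eq least_equivP. Qed.
End EquivalenceTypes.

Section Types.
Variables (k : nat) (u : word k).
Local Notation L := (size u).
Implicit Types (c : {ffun 'I_L.+1 -> 'I_L.+1}) (s t : 'I_L) (i j p : 'I_L.+1).

Definition letter t : 'I_k * bool := tnth (in_tuple u) t.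
Definition before t : 'I_L.+1 := widen_ord (leqnSn L) t.
Definition after t : 'I_L.+1 := lift ord0 t.

(** Position [j] of the word visits the vertex [c j], which is named after its
    first visit. The step [t] runs along an edge labelled [(letter t).1]. *)
Definition src c t := if (letter t).2 then c (after t) else c (before t).
Definition tgt c t := if (letter t).2 then c (before t) else c (after t).

Definition same_edge c s t := ((letter s).1 == (letter t).1) && (src c s == src c t).

(** The data of a closed walk that spells [u] on a graph whose labels act as
    partial injections. *)
Definition good c := [&& [forall j, (c j <= j)%N && (c (c j) == c j)], c ord_max == ord0
  & [forall s, forall t, ((letter s).1 == (letter t).1) ==>
      ((src c s == src c t) == (tgt c s == tgt c t))]].

Definition new_edge c t := [forall s, same_edge c s t ==> (t <= s)%N].
(** A step that discovers a vertex belongs to the spanning tree of first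
    visits; a new edge between known vertices closes an independent cycle. *)
Definition tree_step c t := c (after t) == after t.
Definition cycle_steps c : {set 'I_L} := [set t | new_edge c t && ~~ tree_step c t].
Definition sub_rank c := #|cycle_steps c|.
Definition cycle_step c (x : 'I_(sub_rank c)) : 'I_L := enum_val x.

Section PathWords.
Variables (J : Type) (lt : 'I_L -> J * bool).

(** The fuel bounds the length of the path; [tree_wordE] is the equation that
    it satisfies. *)
Fixpoint tree_path c (fuel : nat) j : seq (J * bool) :=
  if fuel is f.+1 then
    if unlift ord0 (c j) is Some t then rcons (tree_path c f (before t)) (lt t)
    else [::]
  else [::].

(** The word that leads from the base vertex to the vertex of [j] along the
    edges of first visits, when the step [t] is spelled [lt t]. *)
Definition gtree_word c j : seq (J * bool) := tree_path c L.+1 j.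

Definition gloop_word c t : seq (J * bool) :=
  gtree_word c (src c t) ++ ((lt t).1, false) :: winv (gtree_word c (tgt c t)).
End PathWords.

Local Notation tree_word := (gtree_word letter).
Local Notation loop_word := (gloop_word letter).

Definition sub_letter c t : option ('I_(sub_rank c) * bool) :=
  omap (fun x => (x, (letter t).2)) [pick x : 'I_(sub_rank c) | same_edge c (cycle_step x) t].

(** The walk in terms of the cycles: tree edges are dropped. *)
Definition sub_word c : word (sub_rank c) := pmap (sub_letter c) (enum 'I_L).

Lemma beforeE t : before t = t :> nat. Proof. by []. Qed.
Lemma afterE t : after t = t.+1 :> nat. Proof. by []. Qed.

Section Good.
Variable c : {ffun 'I_L.+1 -> 'I_L.+1}.
Hypothesis gc : good c.

Lemma good_le j : (c j <= j)%N.
Proof. by case/and3P: gc => /forallP/(_ j)/andP[]. Qed.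
Lemma good_idem j : c (c j) = c j.
Proof. by case/and3P: gc => /forallP/(_ j)/andP[_ /eqP]. Qed.
Lemma good_closed : c ord_max = ord0.
Proof. by case/and3P: gc => _ /eqP. Qed.
Lemma good_base : c ord0 = ord0.
Proof. by apply: val_inj; apply/eqP; rewrite -leqn0 good_le. Qed.
Lemma good_consistent s t : (letter s).1 = (letter t).1 ->
  (src c s == src c t) = (tgt c s == tgt c t).
Proof.
by move=> st; case/and3P: gc => _ _ /forallP/(_ s)/forallP/(_ t); rewrite st eqxx => /eqP.
Qed.

Lemma c_src t : c (src c t) = src c t.
Proof. by rewrite /src; case: ifP; rewrite good_idem. Qed.
Lemma c_tgt t : c (tgt c t) = tgt c t.
Proof. by rewrite /tgt; case: ifP; rewrite good_idem. Qed.

Lemma same_edge_refl t : same_edge c t t.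
Proof. by rewrite /same_edge !eqxx. Qed.
Lemma same_edge_sym s t : same_edge c s t = same_edge c t s.
Proof. by rewrite /same_edge eq_sym [X in _ && X]eq_sym. Qed.
Lemma same_edge_trans s t t' : same_edge c s t -> same_edge c t t' -> same_edge c s t'.
Proof. by move=> /andP[/eqP a /eqP b] /andP[/eqP a' /eqP b']; rewrite /same_edge a b a' b' !eqxx. Qed.
Lemma same_edge_tgt s t : same_edge c s t -> tgt c s = tgt c t.
Proof. by move=> /andP[/eqP a b]; apply/eqP; rewrite -good_consistent. Qed.

Lemma new_edge_uniq s t : new_edge c s -> new_edge c t -> same_edge c s t -> s = t.
Proof.
move=> /forallP ns /forallP nt st; apply: val_inj; apply/eqP; rewrite eqn_leq.
by rewrite (implyP (ns t)) ?(implyP (nt s)) // same_edge_sym.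
Qed.

Lemma new_edge_exists t : exists2 s, new_edge c s & same_edge c s t.
Proof.
have [s st smin] := @arg_minnP _ t (fun s => same_edge c s t) (fun s => s : nat) (same_edge_refl t).
exists s => //; apply/forallP => s'; apply/implyP => ss'.
by apply: smin; exact: same_edge_trans ss' st.
Qed.

(** An earlier step along the same edge would have visited its end before. *)
Lemma tree_new t : tree_step c t -> new_edge c t.
Proof.
move=> /eqP tt; apply/forallP => s; apply/implyP => st; rewrite leqNgt; apply/negP => lt.
have sT := same_edge_tgt st; case/andP: st => _ /eqP sS.
have : (c (after t) <= s.+1)%N.
  have h1 := good_le (before s); have h2 := good_le (after s).
  rewrite beforeE in h1; rewrite afterE in h2.
  move: sS sT; rewrite /src /tgt; case: (letter s).2 (letter t).2 => [] [] E E'; first [rewrite -E|rewrite -E']; lia.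
by rewrite tt afterE; lia.
Qed.

Lemma cycle_stepP (x : 'I_(sub_rank c)) :
  new_edge c (cycle_step x) /\ ~~ tree_step c (cycle_step x).
Proof. by have := enum_valP x; rewrite inE => /andP. Qed.

Lemma cycle_step_surj t : new_edge c t -> ~~ tree_step c t -> exists x, cycle_step (c := c) x = t.
Proof.
move=> nt tt; have tB : t \in cycle_steps c by rewrite inE nt tt.
by exists (enum_rank_in tB t); rewrite /cycle_step enum_rankK_in.
Qed.

Lemma cycle_step_inj (x y : 'I_(sub_rank c)) t :
  same_edge c (cycle_step x) t -> same_edge c (cycle_step y) t -> x = y.
Proof.
move=> xt yt; apply: enum_val_inj; apply: new_edge_uniq; try by case: (cycle_stepP x); case: (cycle_stepP y).
by apply: same_edge_trans xt _; rewrite same_edge_sym.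
Qed.

Variant edge_spec t : option 'I_(sub_rank c) -> Type :=
  | CycleEdge (x : 'I_(sub_rank c)) of same_edge c (cycle_step x) t : edge_spec t (Some x)
  | TreeEdge s of tree_step c s & same_edge c s t &
      (forall x : 'I_(sub_rank c), ~~ same_edge c (cycle_step x) t) : edge_spec t None.

Lemma edgeP t : edge_spec t [pick x : 'I_(sub_rank c) | same_edge c (cycle_step x) t].
Proof.
case: pickP => [x xt|no]; first exact: CycleEdge.
have [|ns] := pselect (exists2 s, tree_step c s & same_edge c s t).
  by case/cid2 => s ts st; apply: (TreeEdge ts st) => x; rewrite no.
exfalso; have [s nes st] := new_edge_exists t.
have [ts|ts] := boolP (tree_step c s); first by apply: ns; exists s.
by have [x xs] := cycle_step_surj nes ts; have := no x; rewrite xs st.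
Qed.

Section PathWordLemmas.
Variables (J : Type) (lt : 'I_L -> J * bool).

Lemma tree_path_fuel f g j :
  (c j <= f)%N -> (c j <= g)%N -> tree_path lt c f j = tree_path lt c g j.
Proof.
have n0 t : ((lift ord0 t : 'I_L.+1) <= 0)%N = false by [].
elim: f g j => [|f IH] [|g] j //= jf jg; case: unliftP jf jg => // t ->; rewrite ?n0 //.
move=> jf jg; congr rcons; apply: IH; exact: leq_trans (good_le _) _.
Qed.

Lemma tree_wordE j : gtree_word lt c j =
  if unlift ord0 (c j) is Some t then rcons (gtree_word lt c (before t)) (lt t) else [::].
Proof.
rewrite {1}/gtree_word /=; case: unliftP => // t jt; congr rcons.
have := good_le (before t); rewrite beforeE => bt.
by apply: tree_path_fuel; apply: (leq_trans bt) => //; [exact: ltnW|apply: leq_trans (ltnW _) (leqnSn _)].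
Qed.

Lemma tree_word_c j : gtree_word lt c (c j) = gtree_word lt c j.
Proof. by rewrite tree_wordE good_idem -tree_wordE. Qed.

Lemma tree_word_base : gtree_word lt c ord0 = [::].
Proof. by rewrite tree_wordE good_base unlift_none. Qed.

Lemma tree_word_step t : tree_step c t ->
  gtree_word lt c (after t) = rcons (gtree_word lt c (before t)) (lt t).
Proof. by move=> /eqP tt; rewrite tree_wordE tt /after liftK. Qed.

End PathWordLemmas.

Lemma tree_word_ind (P : 'I_L.+1 -> Prop) : P ord0 ->
  (forall t, tree_step c t -> P (c (before t)) -> P (after t)) -> forall j, P (c j).
Proof.
move=> P0 PS j; move: {2}(c j : nat) (leqnn (c j)) => n; elim: n j => [|n IH] j jn.
  by rewrite (_ : c j = ord0) //; apply: val_inj; apply/eqP; rewrite -leqn0.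
case: (unliftP ord0 (c j)) => [t jt|->] //; rewrite jt; apply: PS.
  by rewrite /tree_step -/(after t) /after -jt good_idem.
apply: IH; apply: leq_trans (good_le _) _; rewrite beforeE.
by move: jn; rewrite jt /= /bump.
Qed.

(** *** The new words in terms of the old ones *)
Section Evaluation.
Variables (J : Type) (lt : 'I_L -> J * bool) (Q : groupType) (a : J -> Q).
Hypothesis lt_sign : forall t, (lt t).2 = (letter t).2.
Hypothesis lt_edge : forall s t, same_edge c s t -> (lt s).1 = (lt t).1.
Local Open Scope group_scope.
Local Notation tv j := (evalw a (gtree_word lt c j)).

(** The loop through the base that a step closes, read in the direction of the
    step. *)
Definition step_value t : Q := tv (before t) * evalw a [:: lt t] * (tv (after t))^-1.

Lemma gevalw_loop_word t : evalw a (gloop_word lt c t) =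
  if (letter t).2 then (step_value t)^-1 else step_value t.
Proof.
rewrite /gloop_word /step_value evalw_cat evalw_cons evalw_winv evalw_letter lt_sign /src /tgt.
case: (letter t).2 => /=; rewrite !tree_word_c ?mulgA //.
by rewrite !invMg !invgK mulgA.
Qed.

Lemma step_value_tree t : tree_step c t -> step_value t = 1.
Proof.
by move=> tt; rewrite /step_value tree_word_step // evalw_rcons evalw_letter mulgV.
Qed.

Lemma gloop_word_same s t : same_edge c s t -> gloop_word lt c s = gloop_word lt c t.
Proof.
by move=> st; rewrite /gloop_word (same_edge_tgt st) (lt_edge st); case/andP: st => _ /eqP ->.
Qed.

Lemma gevalw_loop_tree t : tree_step c t -> evalw a (gloop_word lt c t) = 1.
Proof. by move=> /step_value_tree E; rewrite gevalw_loop_word E invg1 if_same. Qed.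

Definition gsub_gen (x : 'I_(sub_rank c)) : Q := evalw a (gloop_word lt c (cycle_step x)).

Lemma sub_letter_value t :
  evalw gsub_gen (if sub_letter c t is Some l then [:: l] else [::]) = step_value t.
Proof.
rewrite /sub_letter; case: edgeP => [x xt|s ts st _] /=.
  rewrite mulg1 /gsub_gen (gloop_word_same xt) gevalw_loop_word.
  by case: (letter t).2; rewrite ?invgK.
have := gevalw_loop_tree ts; rewrite (gloop_word_same st) gevalw_loop_word.
by case: ifP => _ E; [rewrite -[RHS]invgK E invg1|rewrite E].
Qed.

Lemma gevalw_sub_prefix (j : 'I_L.+1) :
  evalw gsub_gen (pmap (sub_letter c) (take j (enum 'I_L))) =
  evalw a [seq lt t | t <- take j (enum 'I_L)] * (tv j)^-1.
Proof.
case: j => j jL; elim: j jL => [|j IH] jL.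
  by rewrite !take0 /= (_ : Ordinal jL = ord0) ?tree_word_base ?invg1 ?mulg1 //; exact: val_inj.
pose t : 'I_L := Ordinal (jL : (j < L)%N).
have jL' : (j < L.+1)%N by exact: ltnW.
have := IH jL'; rewrite /= => {}IH.
rewrite (take_nth t) ?size_enum_ord // map_rcons.
rewrite -[in LHS]cats1 pmap_cat evalw_cat IH evalw_rcons.
have -> : nth t (enum 'I_L) j = t by apply: val_inj; rewrite /= nth_enum_ord.
have -> : pmap (sub_letter c) [:: t] = (if sub_letter c t is Some l then [:: l] else [::]).
  by rewrite /=; case: (sub_letter c t).
rewrite sub_letter_value /step_value evalw_letter.
have -> : before t = Ordinal jL' by exact: val_inj.
have -> : after t = Ordinal jL by exact: val_inj.
by rewrite !mulgA mulgKV.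
Qed.

Lemma gevalw_sub_word : evalw gsub_gen (sub_word c) = evalw a [seq lt t | t <- enum 'I_L].
Proof.
have := gevalw_sub_prefix ord_max; rewrite /= !take_oversize ?size_enum_ord // => ->.
by rewrite -tree_word_c good_closed tree_word_base invg1 mulg1.
Qed.
End Evaluation.

(** *** The case of the alphabet of the original word *)
Section Original.
Variables (Q : groupType) (a : 'I_k -> Q).

Let lt_sign t : (letter t).2 = (letter t).2. Proof. by []. Qed.
Let lt_edge s t : same_edge c s t -> (letter s).1 = (letter t).1.
Proof. by case/andP => /eqP. Qed.

Definition sub_gen := gsub_gen letter a.

Lemma evalw_loop_word t : evalw a (loop_word c t) =
  if (letter t).2 then (step_value letter a t)^-1%g else step_value letter a t.
Proof. exact: gevalw_loop_word. Qed.

Lemma loop_word_same s t : same_edge c s t -> loop_word c s = loop_word c t.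
Proof. exact: gloop_word_same. Qed.

Lemma evalw_loop_tree t : tree_step c t -> evalw a (loop_word c t) = 1%g.
Proof. exact: gevalw_loop_tree. Qed.

Lemma take_letters (j : nat) : [seq letter t | t <- take j (enum 'I_L)] = take j u.
Proof.
by rewrite map_take; congr take; exact: (map_tnth_enum (in_tuple u)).
Qed.

Lemma evalw_sub_prefix (j : 'I_L.+1) :
  evalw sub_gen (pmap (sub_letter c) (take j (enum 'I_L))) =
  (evalw a (take j u) * (evalw a (tree_word c j))^-1)%g.
Proof. by rewrite gevalw_sub_prefix // take_letters. Qed.

Lemma evalw_sub_word : evalw sub_gen (sub_word c) = evalw a u.
Proof. by rewrite gevalw_sub_word // -[enum _]take_size take_letters take_oversize ?size_enum_ord. Qed.
End Original.

Lemma size_sub_word : (size (sub_word c) <= L)%N.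
Proof. by rewrite /sub_word size_pmap -[X in (_ <= X)%N](size_enum_ord L) count_size. Qed.

(** *** The cycles generate freely *)
Section Walk.
Variables (Q : groupType) (y : 'I_(sub_rank c) -> Q).
Local Open Scope group_scope.

Lemma edge_perms : exists sg : 'I_k -> {perm 'I_L.+1}, forall t, sg (letter t).1 (src c t) = tgt c t.
Proof.
have H (i : 'I_k) : exists s : {perm 'I_L.+1}, forall t, (letter t).1 == i -> s (src c t) = tgt c t.
  apply: perm_extend_pairs => t t' /eqP ti /eqP ti'.
  have E : (letter t).1 = (letter t').1 by rewrite ti ti'.
  by split=> /eqP st; apply/eqP; rewrite ?(good_consistent E) // -(good_consistent E).
by have [sg sgP] := choice H; exists sg => t; apply: sgP.
Qed.

Let sg := projT1 (cid edge_perms).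
Let sgP t : sg (letter t).1 (src c t) = tgt c t. Proof. exact: projT2 (cid edge_perms) t. Qed.

Let lb (i : 'I_k) p : Q :=
  if [pick x | ((letter (cycle_step (c := c) x)).1 == i) && (src c (cycle_step x) == p)] is Some x
  then y x else 1.

Definition vstep (i : 'I_k) (e : bool) p := if e then (sg i)^-1 p else sg i p.
Definition vlab (i : 'I_k) (e : bool) p := if e then (lb i ((sg i)^-1 p))^-1 else lb i p.

Let vstepK (i : 'I_k) e p : vstep i (~~ e) (vstep i e p) = p.
Proof. by rewrite /vstep; case: e; rewrite ?permK ?permKV. Qed.
Let vlabV (i : 'I_k) e p : vlab i (~~ e) (vstep i e p) = (vlab i e p)^-1.
Proof. by rewrite /vlab /vstep; case: e; rewrite ?permK ?invgK. Qed.

Local Notation vwalk := (walk vstep vlab).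

Let lb_same (x : 'I_(sub_rank c)) t : same_edge c (cycle_step x) t -> lb (letter t).1 (src c t) = y x.
Proof.
move=> xt; rewrite /lb; case: pickP => [x' x't|/(_ x)/negP[]]; last exact: xt.
by rewrite (cycle_step_inj x't xt).
Qed.

Let lb_tree t : tree_step c t -> lb (letter t).1 (src c t) = 1.
Proof.
move=> tt; rewrite /lb; case: pickP => // x xt; have [nx] := cycle_stepP x.
by rewrite (new_edge_uniq nx (tree_new tt) xt) tt.
Qed.

Let vstep_letter t : vstep (letter t).1 (letter t).2 (c (before t)) = c (after t).
Proof.
by have := sgP t; rewrite /vstep /src /tgt; case: (letter t).2 => // <-; rewrite permK.
Qed.

Let vlab_letter t : vlab (letter t).1 (letter t).2 (c (before t)) =
  if (letter t).2 then (lb (letter t).1 (src c t))^-1 else lb (letter t).1 (src c t).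
Proof.
by have := sgP t; rewrite /vlab /src /tgt; case: (letter t).2 => // <-; rewrite permK.
Qed.

Lemma vwalk_prefix (j : 'I_L.+1) : (vwalk ord0 (take j u)).1 = c j.
Proof.
case: j => j jL; elim: j jL => [|j IH] jL.
  rewrite take0 /= (_ : Ordinal jL = ord0) ?good_base //; exact: val_inj.
pose t : 'I_L := Ordinal (jL : (j < L)%N).
have jL' : (j < L.+1)%N by exact: ltnW.
have l0 : 'I_k * bool := letter t.
rewrite /= (take_nth l0) // walk_rcons /= (IH jL').
have -> : nth l0 u j = letter t by rewrite /letter (tnth_nth l0).
rewrite (_ : Ordinal jL' = before t) ?vstep_letter; last exact: val_inj.
by congr (c _); exact: val_inj.
Qed.

Lemma vwalk_tree j : vwalk ord0 (tree_word c j) = (c j, 1).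
Proof.
suff /(_ j) : forall j, vwalk ord0 (tree_word c (c j)) = (c (c j), 1).
  by rewrite tree_word_c good_idem.
apply: (tree_word_ind (P := fun p => vwalk ord0 (tree_word c p) = (c p, 1))).
  by rewrite tree_word_base good_base.
move=> t tt; rewrite tree_word_c good_idem => E; rewrite tree_word_step // walk_rcons E.
rewrite vstep_letter; congr pair; rewrite mul1g vlab_letter lb_tree // invg1.
by rewrite if_same.
Qed.

Lemma vwalk_loop (x : 'I_(sub_rank c)) : vwalk ord0 (loop_word c (cycle_step x)) = (ord0, y x).
Proof.
set t := cycle_step x; rewrite /gloop_word walk_cat vwalk_tree walk_cons /= c_src sgP.
have /(_ ord0 (tree_word c (tgt c t))) := walk_winv vstepK vlabV.
rewrite vwalk_tree c_tgt /= => -> /=; rewrite mul1g invg1 mulg1.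
by rewrite (lb_same (same_edge_refl t)).
Qed.

(** Label the cycle edges with arbitrary elements [y] and the tree edges with
    the identity: a word in the loops then collects its value at [y], so the
    loops satisfy no relations. *)
Lemma vwalk_sub v :
  vwalk ord0 (wsub (fun x : 'I_(sub_rank c) => loop_word c (cycle_step x)) v) = (ord0, evalw y v).
Proof.
elim: v => //= -[x e] v IH; rewrite /wsub /= walk_cat.
case: e => /=; last by rewrite vwalk_loop /= -/(wsub _ v) IH.
have := walk_winv vstepK vlabV ord0 (loop_word c (cycle_step x)).
by rewrite vwalk_loop /= /winv => -> /=; rewrite -/(wsub _ v) IH.
Qed.

Lemma vwalk_sim o v v' : sim v v' -> vwalk o v = vwalk o v'.
Proof. exact: walk_sim. Qed.
End Walk.
End Good.
End Types.

(** * The subgroup of a type *)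

Section Subgroups.
Local Open Scope classical_set_scope.
Local Open Scope group_scope.
Variable F : groupType.
Local Notation tree_word := (gtree_word (@letter _ _)).
Local Notation loop_word := (gloop_word (@letter _ _)).

Definition is_subgroup (H : set F) :=
  [/\ H 1, forall x y, H x -> H y -> H (x * y) & forall x, H x -> H x^-1].

Lemma range_subgroup k (b : 'I_k -> F) : is_subgroup (range (evalw b)).
Proof.
split=> [|_ _ [u _ <-] [v _ <-]|_ [u _ <-]]; first by exists [::].
  by exists (u ++ v) => //; rewrite evalw_cat.
by exists (winv u) => //; rewrite evalw_winv.
Qed.

Lemma range_gen k (b : 'I_k -> F) i : range (evalw b) (b i).
Proof. by exists [:: (i, false)] => //; rewrite evalw_letter. Qed.

Lemma range_sub k (b : 'I_k -> F) (H : set F) : is_subgroup H ->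
  (forall i, H (b i)) -> range (evalw b) `<=` H.
Proof. by move=> [H1 HM HV] Hb _ [u _ <-]; exact: (evalw_subgroup _ H1 HM HV Hb). Qed.

Lemma subgroup_div (H : set F) x y z : is_subgroup H ->
  H (x * y^-1) -> H (y * z^-1) -> H (x * z^-1).
Proof. by move=> [H1 HM HV] xy yz; have := HM _ _ xy yz; rewrite -mulgA mulKg. Qed.

Lemma subgroup_divC (H : set F) x y : is_subgroup H -> H (x * y^-1) -> H (y * x^-1).
Proof. by move=> [H1 HM HV] /HV; rewrite invMg invgK. Qed.

Section Word.
Variables (k : nat) (b : 'I_k -> F) (H0 : set F).
Hypothesis b_free : free_basis H0 b.
Variable u : word k.
Local Notation L := (size u).
Implicit Types (c : {ffun 'I_L.+1 -> 'I_L.+1}) (i j : 'I_L.+1).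

Definition prefix_value (j : nat) : F := evalw b (take j u).

Lemma prefix_after (t : 'I_L) :
  prefix_value (after t) = prefix_value (before t) * evalw b [:: letter t].
Proof.
have l0 := letter t; rewrite /prefix_value /= (take_nth l0) // evalw_rcons mulg1.
by rewrite (_ : nth l0 u t = letter t) // /letter (tnth_nth l0).
Qed.

Definition sub_group c : set F := range (evalw (sub_gen (c := c) b)).

Section Good.
Variable c : {ffun 'I_L.+1 -> 'I_L.+1}.
Hypothesis gc : good c.
Local Notation Hc := (sub_group c).
Local Notation bc := (sub_gen (c := c) b).

Lemma evalw_sub_gen v : evalw bc v =
  evalw b (wsub (fun x : 'I_(sub_rank c) => loop_word c (cycle_step x)) v).
Proof. by rewrite evalw_wsub. Qed.

(** A relation between the loops would hold between arbitrary permutations, by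
    [vwalk_sub]; free groups are residually finite. *)
Lemma sub_free : free_basis Hc bc.
Proof.
split=> // v vr v1; apply: reduced_detect vr _ => N g.
have /(congr1 snd) /= <- := vwalk_sub gc g v.
rewrite (@vwalk_sim _ _ _ gc _ g _ _ [::]) //.
by apply: (free_basis_sim b_free); rewrite -evalw_sub_gen.
Qed.

Lemma sub_prefix j : Hc (prefix_value j * (evalw b (tree_word c j))^-1).
Proof. by eexists; [|exact: evalw_sub_prefix]. Qed.

(** Up to loops at the base a prefix of the word is the tree word of its vertex;
    conversely a product of loops ends at the base in the walk of [vwalk_sub]. *)
Lemma sub_vertex i j : (c i == c j) = `[< Hc (prefix_value i * (prefix_value j)^-1) >].
Proof.
have sg := range_subgroup bc; have [_ _ HV] := sg.
apply/eqP/asboolP => [E|].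
  have := sub_prefix j; rewrite -(tree_word_c gc) -E (tree_word_c gc) => /(subgroup_divC sg).
  exact: subgroup_div sg (sub_prefix i).
case=> v _ vE; pose y : 'I_(sub_rank c) -> {perm 'I_1} := fun=> 1.
have s : sim (take i u) (wsub (fun x : 'I_(sub_rank c) => loop_word c (cycle_step x)) v ++ take j u).
  apply: (free_basis_sim b_free); rewrite evalw_cat -evalw_sub_gen vE.
  by rewrite /prefix_value mulgKV.
have := vwalk_sim gc y ord0 s; rewrite walk_cat (vwalk_sub gc y) /= => /(congr1 fst) /=.
by rewrite !vwalk_prefix.
Qed.

Lemma sub_group_loop t : Hc (evalw b (loop_word c t)).
Proof.
case: (edgeP c t) => [x xt|s ts st _].
  by rewrite -(loop_word_same gc xt); exact: (range_gen bc).
rewrite -(loop_word_same gc st) evalw_loop_tree //.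
by case: (range_subgroup bc).
Qed.
End Good.

(** By [sub_vertex] the subgroup determines which positions share a vertex. *)
Lemma sub_group_inj c c' : good c -> good c' -> sub_group c = sub_group c' -> c = c'.
Proof.
move=> gc gc' E.
have ker i j : (c i == c j) = (c' i == c' j) by rewrite !sub_vertex ?E.
apply/ffunP => j; apply: val_inj; apply/eqP; rewrite eqn_leq; apply/andP; split.
  have /eqP <- : c (c' j) == c j by rewrite ker good_idem.
  exact: good_le.
have /eqP <- : c' (c j) == c' j by rewrite -ker good_idem.
exact: good_le.
Qed.

(** *** The type of the trajectory of [u] on the cosets of a subgroup *)
Section Coset.
Variable H : set F.
Hypotheses (H_sub : is_subgroup H) (Hu : H (evalw b u)).

Let r : rel 'I_L.+1 := fun i j => `[< H (prefix_value i * (prefix_value j)^-1) >].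
Definition coset_type := least_equiv r.
Local Notation c := coset_type.

Let r_refl : reflexive r.
Proof. by move=> i; apply/asboolP; rewrite mulgV; case: H_sub. Qed.
Let r_sym : symmetric r.
Proof. by move=> i j; apply/asboolP/asboolP; exact: subgroup_divC. Qed.
Let r_trans : transitive r.
Proof. by move=> j i l /asboolP ij /asboolP jl; apply/asboolP; exact: subgroup_div ij jl. Qed.

Lemma coset_typeE i j : (c i == c j) = `[< H (prefix_value i * (prefix_value j)^-1) >].
Proof. exact: least_equiv_eq. Qed.

Lemma coset_type_c j : H (prefix_value (c j) * (prefix_value j)^-1).
Proof. by apply/asboolP; exact: (least_equivP r_refl j). Qed.

Lemma prefix_letter (t : 'I_L) (e := (letter t).2) :
  prefix_value (if e then before t else after t) =
  prefix_value (if e then after t else before t) * b (letter t).1.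
Proof.
rewrite /e; have := prefix_after t; rewrite evalw_letter.
by case: (letter t).2 => -> //; rewrite mulgKV.
Qed.

(** Right multiplication by a letter is injective on cosets. *)
Lemma coset_good : good c.
Proof.
apply/and3P; split.
- apply/forallP => j; rewrite (least_equiv_idem r_refl r_sym r_trans) eqxx andbT.
  exact: least_equiv_le (r_refl j).
- have E0 : c ord0 = ord0.
    by apply: val_inj; apply/eqP; rewrite -leqn0; exact: least_equiv_le (r_refl ord0).
  rewrite -E0 coset_typeE; apply/asboolP.
  by rewrite /prefix_value take_size take0 invg1 mulg1.
apply/forallP => s; apply/forallP => t; apply/implyP => /eqP st; apply/eqP.
have srcE (x : 'I_L) : src c x = c (if (letter x).2 then after x else before x).
  by rewrite /src; case: ifP.
have tgtE (x : 'I_L) : tgt c x = c (if (letter x).2 then before x else after x).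
  by rewrite /tgt; case: ifP.
rewrite !srcE !tgtE !coset_typeE !(prefix_letter s) !(prefix_letter t) st.
by rewrite invMg -!mulgA mulVKg.
Qed.

Lemma coset_tree j : H (evalw b (tree_word c j) * (prefix_value (c j))^-1).
Proof.
have gc := coset_good; rewrite -(tree_word_c gc).
apply: (tree_word_ind gc (P := fun p => H (evalw b (tree_word c p) * (prefix_value p)^-1))).
  by rewrite (tree_word_base gc) /prefix_value take0 /= mulgV; case: H_sub.
move=> t tt; rewrite (tree_word_c gc) (tree_word_step gc _ tt) prefix_after => E.
rewrite evalw_rcons -evalw_letter invMg -mulgA mulKVg.
exact: subgroup_div H_sub E (coset_type_c _).
Qed.

Lemma coset_loop t : H (evalw b (loop_word c t)).
Proof.
have gc := coset_good; have [_ _ HV] := H_sub.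
have Ht j : H (evalw b (tree_word c j) * (prefix_value j)^-1).
  exact: subgroup_div H_sub (coset_tree j) (coset_type_c j).
have Hs : H (step_value c (@letter _ _) b t).
  rewrite /step_value; apply: (@subgroup_div _ _ (prefix_value (after t)) _ H_sub).
    rewrite prefix_after; move: (evalw b [:: letter t]) => l; rewrite invMg -!mulgA mulVKg.
    exact: Ht.
  exact: subgroup_divC (Ht _).
by rewrite (evalw_loop_word gc); case: ifP => // _; exact: HV.
Qed.

Lemma coset_sub : sub_group c `<=` H.
Proof. by apply: range_sub => // x; exact: coset_loop. Qed.

(** *** The retraction onto the subgroup of the coset type *)

(** The label of an edge of the coset graph: the loop it closes if the word
    runs along it, the identity otherwise. *)
Let L0 (i : 'I_k) (x : F) : F :=
  if [pick t : 'I_L | ((letter t).1 == i) && `[< H (x * (prefix_value (src c t))^-1) >]]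
  is Some t then evalw b (loop_word c t) else 1.

Let rstep (i : 'I_k) (e : bool) (x : F) : F := x * (if e then (b i)^-1 else b i).
Let rlab (i : 'I_k) (e : bool) (x : F) : F :=
  if e then (L0 i (x * (b i)^-1))^-1 else L0 i x.

Let rstepK (i : 'I_k) e x : rstep i (~~ e) (rstep i e x) = x.
Proof. by rewrite /rstep; case: e => /=; rewrite ?mulgK ?mulgKV. Qed.
Let rlabV (i : 'I_k) e x : rlab i (~~ e) (rstep i e x) = (rlab i e x)^-1.
Proof. by rewrite /rlab /rstep; case: e => /=; rewrite ?mulgK ?invgK. Qed.

Local Notation rwalk := (walk rstep rlab).
Definition retract_value (v : word k) : F := (rwalk 1 v).2.

Let L0E (t : 'I_L) x : H (x * (prefix_value (src c t))^-1) ->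
  L0 (letter t).1 x = evalw b (loop_word c t).
Proof.
have gc := coset_good.
move=> Hx; rewrite /L0; case: pickP => [s /andP[st /asboolP Hs]|/(_ t)/negP[]]; last first.
  by rewrite eqxx; apply/asboolP.
rewrite (loop_word_same gc (t := t)) // /same_edge st /= -(c_src gc s) -(c_src gc t).
by rewrite coset_typeE; apply/asboolP; apply: subgroup_div Hx => //; exact: subgroup_divC.
Qed.

Let L0_sub (i : 'I_k) x : sub_group c (L0 i x).
Proof.
rewrite /L0; case: pickP => [t _|_]; first exact: sub_group_loop coset_good _.
by case: (range_subgroup (sub_gen (c := c) b)).
Qed.

Let L0_mul (i : 'I_k) h x : H h -> L0 i (h * x) = L0 i x.
Proof.
move=> Hh; have [_ HM HV] := H_sub; rewrite /L0; congr (if _ is Some t then _ else _).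
apply: eq_pick => t /=; congr andb; apply/asboolP/asboolP; rewrite -mulgA => Hx.
  by rewrite -[X in H X](mulKg h); exact: HM (HV _ Hh) Hx.
exact: HM.
Qed.

Let rwalk_mul h x v : H h ->
  rwalk (h * x) v = (h * (rwalk x v).1, (rwalk x v).2).
Proof.
move=> Hh; elim: v x => [//|[i e] v IH] x; rewrite !walk_cons /=.
have -> : rstep i e (h * x) = h * rstep i e x by rewrite /rstep mulgA.
rewrite IH /=; congr (_, _ * _).
by rewrite /rlab; case: e; rewrite -?mulgA (L0_mul _ _ Hh).
Qed.

Let rwalk_end x v : (rwalk x v).1 = x * evalw b v.
Proof.
elim: v x => [|[i e] v IH] x; first by rewrite mulg1.
by rewrite walk_cons /= IH /rstep mulgA.
Qed.

(** Elements of [H] are the loops at the base of the coset graph, where the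
    labels multiply; the graph of the type is a subgraph of it, on which the
    labels are the loops themselves. *)
Lemma retract_cat v v' : H (evalw b v) ->
  retract_value (v ++ v') = retract_value v * retract_value v'.
Proof.
move=> Hv; rewrite /retract_value walk_cat /= rwalk_end mul1g -{1}[evalw b v]mulg1.
by rewrite rwalk_mul.
Qed.

Lemma retract_sim v v' : evalw b v = evalw b v' -> retract_value v = retract_value v'.
Proof.
by move=> /(free_basis_sim b_free) s; rewrite /retract_value (walk_sim rstepK rlabV _ s).
Qed.

Lemma retract_winv v : H (evalw b v) -> retract_value (winv v) = (retract_value v)^-1.
Proof.
move=> Hv; apply: (mulgI (retract_value v)); rewrite -retract_cat // mulgV.
by rewrite (retract_sim (v' := [::])) // evalw_cat evalw_winv mulgV.
Qed.

Lemma retract_wsub (J : Type) (W : J -> word k) v : (forall x, H (evalw b (W x))) ->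
  retract_value (wsub W v) = evalw (fun x => retract_value (W x)) v.
Proof.
have [_ _ HV] := H_sub.
move=> HW; elim: v => //= -[x e] v IH; rewrite /wsub /= -/(wsub W v).
case: e => /=; rewrite retract_cat ?IH // -/(winv (W x)) ?retract_winv //.
by rewrite evalw_winv; exact: HV.
Qed.

Lemma retract_sub v : sub_group c (retract_value v).
Proof.
have [H1 HM HV] := range_subgroup (sub_gen (c := c) b).
rewrite /retract_value; elim: v (1 : F) => [//|[i e] v IH] x; rewrite walk_cons /=.
apply: (HM); last exact: IH.
by rewrite /rlab; case: e; [apply: (HV); exact: L0_sub|exact: L0_sub].
Qed.

Lemma retract_tree j : retract_value (tree_word c j) = 1.
Proof.
have gc := coset_good; rewrite -(tree_word_c gc).
apply: (tree_word_ind gc (P := fun p => retract_value (tree_word c p) = 1)).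
  by rewrite (tree_word_base gc).
move=> t tt; rewrite (tree_word_c gc) => E.
rewrite (tree_word_step gc _ tt) /retract_value walk_rcons -/(retract_value _) E mul1g rwalk_end mul1g.
have := coset_tree (before t); have := coset_tree (after t).
rewrite (tree_word_step gc _ tt) evalw_rcons /rlab.
have := evalw_loop_tree gc b tt; have := L0E (t := t); rewrite /src.
case: (letter t).2 => L0t lt Ha Hb; first by rewrite L0t ?lt ?invg1 // ; move: Ha.
by rewrite L0t ?lt.
Qed.

Lemma retract_loop t : retract_value (loop_word c t) = evalw b (loop_word c t).
Proof.
have gc := coset_good; set x := evalw b (tree_word c (src c t)).
have xs : H (x * (prefix_value (src c t))^-1).
  by have := coset_tree (src c t); rewrite (c_src gc).
have E : rwalk 1 (tree_word c (src c t)) = (x, 1).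
  by rewrite [LHS]surjective_pairing rwalk_end mul1g -/(retract_value _) retract_tree.
have -> : retract_value (loop_word c t) =
    L0 (letter t).1 x * (rwalk (x * b (letter t).1) (winv (tree_word c (tgt c t)))).2.
  by rewrite /retract_value walk_cat E walk_cons /= mul1g.
rewrite L0E // -[RHS]mulg1; congr (_ * _).
have -> : x * b (letter t).1 = evalw b (loop_word c t) * evalw b (tree_word c (tgt c t)).
  by rewrite /gloop_word evalw_cat evalw_cons evalw_winv /= mulgA mulgKV.
have Hl := coset_loop t.
rewrite rwalk_mul //=.
have := walk_winv rstepK rlabV 1 (tree_word c (tgt c t)).
rewrite rwalk_end mul1g -/(retract_value _) retract_tree invg1 => ->.
by [].
Qed.

Hypothesis H_H0 : H `<=` H0.

(** [X] is the retraction of [H] onto the subgroup of the coset type, in terms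
    of a basis of [H]. By [retract_rank] the rank of that subgroup is at most
    the rank of [H], with equality only if it is all of [H]. *)
Lemma coset_retract k' (b' : 'I_k' -> F) : free_basis H b' ->
  [/\ (sub_rank c <= k')%N, sub_rank c = k' -> H = sub_group c
    & exists X : 'I_k' -> word (sub_rank c), forall (Q : groupType) (a : 'I_(sub_rank c) -> Q) v v',
      evalw b' v' = evalw (sub_gen (c := c) b) v -> evalw a (wsub X v') = evalw a v].
Proof.
move=> fb'; have gc := coset_good; have scfree := sub_free gc.
have HE : H = range (evalw b') by case: fb'.
have Hb' e : H (b' e) by rewrite HE; exact: range_gen.
have /choice[W WE] : forall e, exists v : word k, evalw b v = b' e.
  by move=> e; have := H_H0 (Hb' e); case: b_free => -> _ [v _ <-]; exists v.
have /choice[X XE] : forall e, exists v : word (sub_rank c),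
    evalw (sub_gen (c := c) b) v = retract_value (W e).
  by move=> e; have [v _ <-] := retract_sub (W e); exists v.
have HW e : H (evalw b (W e)) by rewrite WE.
have XP (Q : groupType) (a : 'I_(sub_rank c) -> Q) v v' :
    evalw b' v' = evalw (sub_gen (c := c) b) v -> evalw a (wsub X v') = evalw a v.
  move=> E; apply: (free_basis_evalw _ scfree); rewrite evalw_wsub.
  transitivity (retract_value (wsub W v')).
    by rewrite retract_wsub //; apply: evalw_ext.
  rewrite (retract_sim (v' := wsub (fun x : 'I_(sub_rank c) => loop_word c (cycle_step x)) v)).
    rewrite retract_wsub => [|x]; last exact: coset_loop.
    by apply: evalw_ext => x; exact: retract_loop.
  by rewrite -evalw_sub_gen -E evalw_wsub; exact: evalw_ext.
have /choice[Y YE] : forall x, exists v : word k', evalw b' v = sub_gen (c := c) b x.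
  move=> x; have : H (sub_gen (c := c) b x) by exact: coset_sub (range_gen _ _).
  by rewrite HE => -[v _ <-]; exists v.
have YX N (g : 'I_(sub_rank c) -> 'S_N) x : evalw (fun e => evalw g (X e)) (Y x) = g x.
  by rewrite -evalw_wsub (XP _ g [:: (x, false)]) ?evalw_letter // YE.
have [le eq] := retract_rank YX; split => //; last by exists X.
move=> kk; apply/seteqP; split; last exact: coset_sub.
rewrite HE; apply: range_sub; first exact: range_subgroup.
move=> e; exists (X e) => //.
have s : sim (wsub Y (X e)) [:: (e, false)].
  by apply: sim_of_finite => N g; rewrite evalw_wsub eq // evalw_letter.
have := sim_evalw b' s; rewrite evalw_letter evalw_wsub /= => <-.
exact: evalw_ext.
Qed.
End Coset.
End Word.

(** The subgroup of the coset type of the concatenated generators [U] contains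
    each generator, because [U] returns to the base between any two of them. *)
Lemma nielsen_schreier k (b : 'I_k -> F) (H0 H : set F) q (y : 'I_q -> F) :
  free_basis H0 b -> H `<=` H0 -> H = range (evalw y) ->
  exists k' (b' : 'I_k' -> F), free_basis H b'.
Proof.
move=> fb HH0 HE.
have Hy i : H (y i) by rewrite HE; exact: range_gen.
have /choice[W WE] : forall i, exists v : word k, evalw b v = y i.
  by move=> i; have := HH0 _ (Hy i); case: fb => -> _ [v _ <-]; exists v.
have H_sub : is_subgroup H by rewrite HE; exact: range_subgroup.
have [H1 HM HV] := H_sub.
pose U : word k := flatten [seq W i | i <- enum 'I_q].
have HU (s : seq 'I_q) : H (evalw b (flatten [seq W i | i <- s])).
  by elim: s => //= i s IH; rewrite evalw_cat; apply: (HM) => //; rewrite WE.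
have gc := coset_good H_sub (HU (enum 'I_q)); rewrite -/U in gc.
exists (sub_rank (coset_type b U H)), (sub_gen (c := coset_type b U H) b).
suff HS : H = sub_group b (coset_type b U H) by have := sub_free fb gc; rewrite -HS.
apply/seteqP; split; last exact: coset_sub H_sub (HU _).
rewrite [X in subset X _]HE; apply: range_sub; first exact: range_subgroup.
set Hc := sub_group _ _; have scs : is_subgroup Hc by exact: range_subgroup.
have cut (n : nat) : (n <= size U)%N -> H (evalw b (take n U)) -> Hc (evalw b (take n U)).
  move=> nU Hn; have := sub_vertex fb gc (Ordinal (nU : (n < (size U).+1)%N)) ord0.
  rewrite coset_typeE // /prefix_value take0 /= invg1 mulg1.
  by rewrite (asboolT Hn) => /esym E; exact: (asboolW E).
move=> i; have [s1 [s2 es]] : exists s1 s2, enum 'I_q = s1 ++ i :: s2.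
  have : i \in enum 'I_q by rewrite mem_enum.
  by case/splitPr => s1 s2; exists s1, s2.
pose U1 := flatten [seq W i | i <- s1].
have UE : U = U1 ++ W i ++ flatten [seq W i | i <- s2].
  by rewrite /U es map_cat flatten_cat.
have h1 : Hc (evalw b U1).
  have := cut (size U1); rewrite UE take_size_cat // size_cat leq_addr; apply => //.
  exact: HU.
have h2 : Hc (evalw b (U1 ++ W i)).
  have := cut (size (U1 ++ W i)); rewrite UE catA take_size_cat // [size (_ ++ flatten _)]size_cat leq_addr; apply => //.
  by rewrite evalw_cat; apply: (HM); [exact: HU|rewrite WE].
have [_ cM cV] := scs.
have := cM _ _ (cV _ h1) h2; rewrite evalw_cat mulKg WE.
exact.
Qed.
End Subgroups.

(** * Haar measure of wreath products *)

Section WreathProducts.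
Local Open Scope classical_set_scope.
Local Open Scope complex_scope.
Local Open Scope ring_scope.
Variables (R : realType) (K : topGroupType) (n : nat).
Hypothesis K_compact : compact [set: K].
Local Notation W := (wreath K n).

Lemma wreath_base_continuous p : continuous (fun a : W => a.1 p).
Proof.
move=> a; apply: (@continuous_comp _ _ _
  (fst : W -> gpow K n) (fun b : gpow K n => b p)).
  exact: (@cvg_fst _ _ (nbhs a.1) (nbhs a.2)).
exact: gpow_proj_continuous.
Qed.

Lemma wreath_perm_near (a : W) : \forall b \near a, b.2 = a.2.
Proof.
exact: (@cvg_snd _ _ (nbhs a.1) (nbhs a.2) _ [set s | s = a.2] (discrete_set1 a.2)).
Qed.

Lemma ccont_perm (h : 'S_n -> R[i]) : ccont (fun a : W => h a.2).
Proof.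
have H (g : 'S_n -> R) : continuous (fun a : W => g (a.2 : 'S_n) : R).
  move=> a U Ua; have Ug := nbhs_singleton Ua.
  by apply: filterS (wreath_perm_near a) => b ba; rewrite /= ba.
by split; [exact: (H (fun s => complex.Re (h s)))|exact: (H (fun s => complex.Im (h s)))].
Qed.

Lemma wreath_mul1E (a b : W) p : (a * b)%g.1 p = (a.1 p * b.1 ((a.2 : 'S_n) p))%g.
Proof. by []. Qed.
Lemma wreath_mul2E (a b : W) : (a * b)%g.2 = ((a.2 : 'S_n) * (b.2 : 'S_n))%g.
Proof. by []. Qed.

(** The induced representation, on the sum of [n] copies. *)
Lemma rep_fun_ind (psi : K -> R[i]) : rep_fun psi -> rep_fun (@ind R K n psi).
Proof.
move=> [J [rho [c [[rc rM] psiE]]]].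
exists ('I_n * J)%type,
  (fun x y a => ((a.2 : 'S_n) x.1 == y.1)%:R * rho x.2 y.2 (a.1 x.1)),
  (fun x y => (x.1 == y.1)%:R * c x.2 y.2); split=> [|a].
  split=> [[p j] [q j']|[p j] [q j'] a b] /=.
    apply: ccontM; first exact: (ccont_perm (fun s => (s p == q)%:R)).
    exact: (ccont_comp (wreath_base_continuous (p := p))).
  rewrite -(pair_bigA _ (fun t l => ((a.2 : 'S_n) p == t)%:R * rho j l (a.1 p) *
    (((b.2 : 'S_n) t == q)%:R * rho l j' (b.1 t)))) /=.
  rewrite (bigD1 ((a.2 : 'S_n) p)) //= [X in _ + X]big1 ?addr0; last first.
    move=> t /negPf tp; rewrite big1 // => l _.
    by rewrite eq_sym tp mul0r mul0r.
  rewrite permM eqxx rM big_distrr /=; apply: eq_bigr => l _.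
  by rewrite mul1r mulrCA.
rewrite /ind -(pair_bigA _ (fun p j => \sum_(y : 'I_n * J)
  (p == y.1)%:R * c j y.2 * (((a.2 : 'S_n) p == y.1)%:R * rho j y.2 (a.1 p)))) /=.
rewrite big_mkcond /=; apply: eq_bigr => p _; rewrite psiE.
under [RHS]eq_bigr => j _.
  rewrite -(pair_bigA _ (fun q j' => (p == q)%:R * c j j' * (((a.2 : 'S_n) p == q)%:R * rho j j' (a.1 p)))) /=.
  rewrite (bigD1 p) //= [X in _ + X]big1 ?addr0; last first.
    by move=> t /negPf tp; rewrite big1 // => l _; rewrite eq_sym tp !mul0r.
  over.
case: eqP => _; last by rewrite big1 // => j _; rewrite big1 // => j' _; rewrite mul0r mulr0.
by apply: eq_bigr => j _; apply: eq_bigr => j' _; rewrite eqxx !mul1r.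
Qed.

(** *** Haar measure of a power of the wreath product *)
Section Fibre.
Variable k : nat.
Local Notation V := (gpow (gpow K n) k).
Local Notation T := (gpow W k).
Implicit Types (sg tau : {ffun 'I_k -> 'S_n}) (v : V).

Definition fibre sg v : T := fun i => (v i, sg i : discrete_topology 'S_n).

Lemma fibre_continuous sg : continuous (fibre sg).
Proof.
apply: (@gpow_continuous W k _ (fibre sg)) => i v.
have c1 : (fun v : V => v i) x @[x --> v] --> v i by exact: gpow_proj_continuous.
have c2 : (fun=> (sg i : discrete_topology 'S_n)) x @[x --> v] --> (sg i : discrete_topology 'S_n).
  move=> U Us.
  have Us' := nbhs_singleton Us.
  change (nbhs v (fun _ : V => U (sg i : discrete_topology 'S_n))).
  exact: (@filterS _ _ (nbhs_filter v) setT _ (fun y _ => Us') (@filterT _ _ (nbhs_filter v))).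
exact: (cvg_pair c1 c2).
Qed.

Lemma fibre_mul sg tau v v' :
  (fibre sg v * fibre tau v')%g =
  fibre [ffun i => (sg i * tau i)%g] (v * (fun i p => v' i (sg i p)) : V)%g.
Proof.
apply/funext => i; congr pair; last by rewrite ffunE.
Qed.

Lemma rep_fun_fibre sg (f : T -> R[i]) : rep_fun f -> rep_fun (fun v => f (fibre sg v)).
Proof.
move=> fr; pose one : {ffun 'I_k -> 'S_n} := [ffun=> 1%g].
apply: (@rep_fun_ext _ _ (fun v => f (fibre one v * fibre sg 1)%g)).
  move=> v; rewrite fibre_mul; congr (f (fibre _ _)).
    by apply/ffunP => i; rewrite !ffunE mul1g.
  by apply/funext => i; apply/funext => p; exact: mulg1.
apply: (@rep_fun_comp _ _ _ (fibre one) (fun y => f (y * fibre sg 1)%g)).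
- exact: fibre_continuous.
- move=> v v'; rewrite fibre_mul; congr fibre.
    by apply/ffunP => i; rewrite !ffunE mul1g.
  apply/funext => i; apply/funext => p.
  by rewrite -[LHS]/(v i p * v' i p)%g -[RHS]/(v i p * v' i (one i p))%g ffunE perm1.
- exact: rep_fun_mulgr.
Qed.

Let V_compact : compact [set: V].
Proof. by apply: gpow_compact; exact: gpow_compact. Qed.
Let T_compact : compact [set: T].
Proof. by apply: gpow_compact; exact: wreath_compact. Qed.

(** The permutations are uniform and independent of the uniform entries: the
    right-hand side is an invariant mean. *)
Lemma haar_fibre (f : T -> R[i]) : rep_fun f ->
  haar_expect f = (#|{ffun 'I_k -> 'S_n}|%:R)^-1 *
    \sum_(sg : {ffun 'I_k -> 'S_n}) haar_expect (fun v => f (fibre sg v)).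
Proof.
move=> fr; have [_ ED EZ] := haar_mean R V_compact.
have N0 : #|{ffun 'I_k -> 'S_n}|%:R != 0 :> R[i].
  rewrite pnatr_eq0 -lt0n; apply/card_gt0P; by exists [ffun=> 1%g].
pose L := fun g : T -> R[i] => (#|{ffun 'I_k -> 'S_n}|%:R)^-1 *
    \sum_(sg : {ffun 'I_k -> 'S_n}) haar_expect (fun v => g (fibre sg v)).
have mL : mean L.
  split=> [|g g' gr gr'|z g gr]; rewrite /L.
  - under eq_bigr => sg _ do rewrite haar_expect_cst.
    by rewrite sumr_const mulVf.
  - rewrite -mulrDr -big_split /=; congr (_ * _); apply: eq_bigr => sg _.
    by rewrite ED //; exact: rep_fun_fibre.
  - rewrite [RHS]mulrCA; congr (_ * _); rewrite big_distrr /=; apply: eq_bigr => sg _.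
    by rewrite EZ //; exact: rep_fun_fibre.
apply/esym/(haar_unique T_compact mL fr) => x; rewrite /L; congr (_ * _).
pose sx : {ffun 'I_k -> 'S_n} := [ffun i => (x i).2].
pose vx : V := fun i => (x i).1.
have xE : x = fibre sx vx.
  apply/funext => i; rewrite [LHS]surjective_pairing /fibre ffunE //.
pose h tau : {ffun 'I_k -> 'S_n} := [ffun i => (sx i * tau i)%g].
have h_inj : injective h.
  move=> t t' E; apply/ffunP => i; apply: (mulgI (sx i)).
  by have := congr1 (fun g : {ffun 'I_k -> 'S_n} => g i) E; rewrite !ffunE.
rewrite [RHS](reindex_inj h_inj) /=; apply: eq_bigr => tau _.
have fr' := rep_fun_fibre (h tau) fr.
pose th (v : V) : V := fun i p => v i (sx i p).
rewrite -(haar_mulgl V_compact vx fr').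
have thc : continuous th.
  apply: (@gpow_continuous (gpow K n) k _ th) => i.
  apply: (@gpow_continuous K n _ (fun v : V => th v i)) => p v.
  apply: (@continuous_comp _ _ _ (fun v : V => v i) (fun b : gpow K n => b (sx i p))).
    exact: gpow_proj_continuous.
  exact: gpow_proj_continuous.
rewrite -(haar_comp V_compact V_compact thc (f := fun y => f (fibre (h tau) (vx * y)%g))).
- by congr haar_expect; apply/funext => v; rewrite {1}xE fibre_mul.
- by [].
- exact: (rep_fun_mulgl vx fr').
move=> y; exists (fun i p => y i ((sx i)^-1%g p)) => z; congr (f (fibre _ (_ * (_ * _))%g)).
by apply/funext => i; apply/funext => p; rewrite /th permK.
Qed.
End Fibre.
End WreathProducts.

(** * Random trajectories *)

Section EdgeWord.
Variables (k : nat) (u : word k).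
Local Notation L := (size u).
Variable c : {ffun 'I_L.+1 -> 'I_L.+1}.
Hypothesis gc : good c.
Implicit Types (s t : 'I_L).

Definition edge_rep t : 'I_L := odflt t [pick s | new_edge c s && same_edge c s t].

Lemma edge_repP t : new_edge c (edge_rep t) /\ same_edge c (edge_rep t) t.
Proof.
rewrite /edge_rep; case: pickP => [s /andP[]//|no].
by have [s ns st] := new_edge_exists c t; have := no s; rewrite ns st.
Qed.

Lemma edge_rep_new t : new_edge c t -> edge_rep t = t.
Proof. by have [nr rt] := edge_repP t => nt; apply: new_edge_uniq rt. Qed.

Lemma edge_rep_same s t : same_edge c s t -> edge_rep s = edge_rep t.
Proof.
have [ns ss] := edge_repP s; have [nt tt] := edge_repP t => st.
rewrite same_edge_sym in tt.
exact: (new_edge_uniq ns nt (same_edge_trans ss (same_edge_trans st tt))).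
Qed.

(** Distinct edges of the trajectory carry independent labels, so every edge
    gets a letter of its own, named after its first step. *)
Definition edge_letter t : 'I_L * bool := (edge_rep t, (letter t).2).
Definition edge_word : word L := [seq edge_letter t | t <- enum 'I_L].

Section Expectation.
Local Open Scope complex_scope.
Local Open Scope ring_scope.
Variables (R : realType) (K : topGroupType) (psi : K -> R[i]).
Hypotheses (K_compact : compact [set: K]%classic) (psi_rep : rep_fun psi).

(** The labels of the tree edges can be gauged away: what remains are the
    letters of the free basis of loops. *)
Lemma Ew_edge_word : Ew psi edge_word = Ew psi (sub_word c).
Proof.
pose Y t : word L := if t \in cycle_steps c then gloop_word edge_letter c t else [:: (t, false)].
have gY : generating Y.
  move=> Q S g S1 SM SV H.
  have St t : t \notin cycle_steps c -> S (g t).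
    by move=> tB; have := H t; rewrite /Y (negPf tB) evalw_letter.
  have Stree j : S (evalw g (gtree_word edge_letter c j)).
    rewrite -(tree_word_c gc).
    apply: (tree_word_ind gc (P := fun p => S (evalw g (gtree_word edge_letter c p)))).
      by rewrite (tree_word_base gc).
    move=> t tt; rewrite (tree_word_c gc) (tree_word_step gc _ tt) evalw_rcons => E.
    have tB : t \notin cycle_steps c by rewrite inE tt andbF.
    refine (SM _ _ E _); rewrite /= (edge_rep_new (tree_new gc tt)).
    by case: ifP => _; [exact: (SV _ (St t tB))|exact: St].
  move=> t; have [tB|] := boolP (t \in cycle_steps c); last exact: St.
  have := H t; rewrite /Y tB /gloop_word evalw_cat evalw_cons evalw_winv /=.
  move: (tB); rewrite inE => /andP[nt _]; rewrite (edge_rep_new nt) => E.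
  have -> : g t = ((evalw g (gtree_word edge_letter c (src c t)))^-1 *
    (evalw g (gtree_word edge_letter c (src c t)) *
      (g t * (evalw g (gtree_word edge_letter c (tgt c t)))^-1)) *
    evalw g (gtree_word edge_letter c (tgt c t)))%g by rewrite mulKg mulgKV.
  refine (SM _ _ (SM _ _ (SV _ _) E) _); exact: Stree.
rewrite -[RHS](@Ew_rename _ _ _ K_compact psi_rep _ _ (@cycle_step _ _ c)); last first.
  by move=> x y _ _; exact: enum_val_inj.
rewrite -[RHS](Ew_generating K_compact psi_rep _ gY); apply: Ew_eq => g.
rewrite evalw_wsub evalw_wmap -[LHS](gevalw_sub_word gc) //.
  by apply: evalw_ext => x; rewrite /Y /cycle_step (enum_valP x).
by move=> s t /edge_rep_same.
Qed.
End Expectation.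
End EdgeWord.

Section Trajectories.
Local Open Scope complex_scope.
Local Open Scope ring_scope.
Variables (R : realType) (K : topGroupType) (psi : K -> R[i]).
Hypotheses (K_compact : compact [set: K]%classic) (psi_rep : rep_fun psi).
Variables (n k : nat) (u : word k).
Local Notation L := (size u).
Local Notation V := (gpow (gpow K n) k).
Implicit Types (sg : {ffun 'I_k -> 'S_n}) (v : V) (s : {ffun 'I_L.+1 -> 'I_n}).

Definition psrc s (t : 'I_L) := if (letter t).2 then s (after t) else s (before t).
Definition ptgt s (t : 'I_L) := if (letter t).2 then s (before t) else s (after t).

(** The permutations [sg] carry the word along the points of [s]. *)
Definition follows sg s := [forall t : 'I_L, sg (letter t).1 (psrc s t) == ptgt s t].

Definition traj_type s : {ffun 'I_L.+1 -> 'I_L.+1} := least_equiv (fun i j => s i == s j).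

Lemma traj_typeE s i j : (traj_type s i == traj_type s j) = (s i == s j).
Proof.
apply: least_equiv_eq => [x|x y|y x z] /=; first exact: eqxx.
  exact: eq_sym.
by move=> /eqP -> /eqP ->.
Qed.

Lemma traj_type_src s t t' :
  (src (traj_type s) t == src (traj_type s) t') = (psrc s t == psrc s t').
Proof. by rewrite /src /psrc; case: (letter t).2; case: (letter t').2; rewrite traj_typeE. Qed.

Lemma traj_type_tgt s t t' :
  (tgt (traj_type s) t == tgt (traj_type s) t') = (ptgt s t == ptgt s t').
Proof. by rewrite /tgt /ptgt; case: (letter t).2; case: (letter t').2; rewrite traj_typeE. Qed.

(** A walk with these steps and labels computes the row at its starting point
    of the monomial matrix of the word. *)
Let step sg (i : 'I_k) (e : bool) (p : 'I_n) := if e then (sg i)^-1%g p else sg i p.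
Let lab sg v (i : 'I_k) (e : bool) (p : 'I_n) :=
  if e then (v i ((sg i)^-1%g p))^-1%g else v i p.

Lemma eval_fibre sg v (w : word k) p :
  ((eval_word (fibre sg v) w).2 : 'S_n) p = (walk (step sg) (lab sg v) p w).1 /\
  (eval_word (fibre sg v) w).1 p = (walk (step sg) (lab sg v) p w).2.
Proof.
elim: w p => [|[i e] w IH] p; first by rewrite /= perm1.
pose A : wreath K n := (if e then (fibre sg v i)^-1 else fibre sg v i)%g.
have [e2 e1] : (A.2 : 'S_n) p = step sg i e p /\ A.1 p = lab sg v i e p.
  by subst A; case: e.
have -> : eval_word (fibre sg v) ((i, e) :: w) = (A * eval_word (fibre sg v) w)%g by [].
rewrite walk_cons wreath_mul1E wreath_mul2E permM e2 e1.
by have [-> ->] := IH (step sg i e p).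
Qed.

Definition traj sg (p : 'I_n) : {ffun 'I_L.+1 -> 'I_n} :=
  [ffun j : 'I_L.+1 => (walk (step sg) (fun _ _ _ => 1%g : {perm 'I_1}) p (take j u)).1].

Lemma walk_end (Q Q' : groupType) sg (l : 'I_k -> bool -> 'I_n -> Q)
  (l' : 'I_k -> bool -> 'I_n -> Q') p (w : word k) :
  (walk (step sg) l p w).1 = (walk (step sg) l' p w).1.
Proof. by elim: w p => [//|[i e] w IH] p; rewrite !walk_cons; exact: IH. Qed.

Lemma take_after (t : 'I_L) : take (after t) u = rcons (take (before t) u) (letter t).
Proof.
have l0 := letter t; rewrite /= (take_nth l0) //; congr rcons.
by rewrite /letter (tnth_nth l0).
Qed.

Lemma traj_step sg p (t : 'I_L) :
  traj sg p (after t) = step sg (letter t).1 (letter t).2 (traj sg p (before t)).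
Proof. by rewrite !ffunE take_after walk_rcons. Qed.

Lemma traj_follows sg p : follows sg (traj sg p).
Proof.
apply/forallP => t; rewrite /psrc /ptgt; have := traj_step sg p t; rewrite /step.
by case: (letter t).2 => ->; rewrite ?permKV.
Qed.

Lemma traj_base sg p : traj sg p ord0 = p.
Proof. by rewrite ffunE take0. Qed.

Lemma follows_traj sg s : follows sg s -> traj sg (s ord0) = s.
Proof.
move=> /forallP fs; apply/ffunP => -[j jL]; elim: j jL => [|j IH] jL.
  by rewrite (_ : Ordinal jL = ord0) ?traj_base //; exact: val_inj.
pose t : 'I_L := Ordinal (jL : (j < L)%N).
rewrite (_ : Ordinal jL = after t); last exact: val_inj.
rewrite traj_step (_ : before t = Ordinal (ltnW jL : (j < L.+1)%N)); last exact: val_inj.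
rewrite IH (_ : Ordinal _ = before t); last exact: val_inj.
have /eqP := fs t; rewrite /step /psrc /ptgt; case: (letter t).2 => // <-.
by rewrite permK.
Qed.

Lemma walk_traj sg v s : follows sg s ->
  (walk (step sg) (lab sg v) (s ord0) u).2 =
  evalw (fun t => v (letter t).1 (psrc s t)) [seq (t, (letter t).2) | t <- enum 'I_L].
Proof.
move=> fs; have sE := follows_traj fs.
suff H (j : nat) : (j <= L)%N -> (walk (step sg) (lab sg v) (s ord0) (take j u)).2 =
    evalw (fun t => v (letter t).1 (psrc s t)) [seq (t, (letter t).2) | t <- take j (enum 'I_L)].
  by have := H L (leqnn L); rewrite take_size take_oversize ?size_enum_ord.
elim: j => [|j IH] jL; first by rewrite !take0.
pose t : 'I_L := Ordinal jL.
rewrite (_ : take j.+1 u = rcons (take j u) (letter t)); last exact: (take_after t).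
rewrite walk_rcons (take_nth t) ?size_enum_ord // map_rcons evalw_rcons /=.
have -> : nth t (enum 'I_L) j = t by apply: val_inj; rewrite /= nth_enum_ord.
rewrite IH ?(ltnW jL) //; congr (_ * _)%g.
have -> : (walk (step sg) (lab sg v) (s ord0) (take j u)).1 = s (before t).
  by rewrite -[in RHS]sE ffunE; exact: walk_end.
move/forallP/(_ t): fs; rewrite /lab /psrc /ptgt; case: (letter t).2 => // /eqP <-.
by rewrite permK.
Qed.

(** The trace counts the points that the word fixes, that is, the closed
    trajectories. *)
Lemma ind_word sg v : @ind R K n psi (eval_word (fibre sg v) u) =
  \sum_(s | follows sg s && (s ord_max == s ord0))
    psi (evalw (fun t => v (letter t).1 (psrc s t)) [seq (t, (letter t).2) | t <- enum 'I_L]).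
Proof.
rewrite /ind (reindex_onto (traj sg) (fun s => s ord0)) /=; last first.
  by move=> s /andP[fs _]; exact: follows_traj.
apply: eq_big => [p|p _].
  rewrite traj_follows traj_base eqxx andbT /= (eval_fibre sg v u p).1.
  congr (_ == _); rewrite [RHS]ffunE /= take_size; exact: walk_end.
rewrite (eval_fibre sg v u p).2; congr psi.
by rewrite -(walk_traj _ (traj_follows sg p)) traj_base.
Qed.

(** Given the trajectory, the labels of its edges are independent. *)
Lemma haar_traj s (c := traj_type s) : good c ->
  haar_expect (fun v : V =>
    psi (evalw (fun t => v (letter t).1 (psrc s t)) [seq (t, (letter t).2) | t <- enum 'I_L]))
  = Ew psi (sub_word c).
Proof.
move=> gc; rewrite -(Ew_edge_word gc K_compact psi_rep).
pose h (v : V) : gpow K L := fun t => v (letter t).1 (psrc s t).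
have VC : compact [set: V]%classic by apply: gpow_compact; exact: gpow_compact.
rewrite /Ew -(haar_comp VC (gpow_compact (n := L) K_compact) (h := h)).
- congr haar_expect; apply/funext => v; congr psi; rewrite [RHS]/(evalw _ _) /edge_word.
  elim: (enum 'I_L) => //= t ts ->; congr (_ * _)%g.
  have [_ /andP[/eqP E /eqP sE]] := edge_repP c t.
  have -> : h v (edge_rep c t) = v (letter t).1 (psrc s t); last by [].
  by rewrite /h E; congr (v _ _); apply/eqP; rewrite -traj_type_src; apply/eqP.
- apply: (@gpow_continuous K L _ h) => t v.
  apply: (@continuous_comp _ _ _ (fun v : V => v (letter t).1) (fun b : gpow K n => b (psrc s t))).
    exact: gpow_proj_continuous.
  exact: gpow_proj_continuous.
- by [].
- exact: rep_fun_word.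
move=> x; exists (fun i q => if [pick t | [&& new_edge c t, (letter t).1 == i & psrc s t == q]]
  is Some t then x t else 1%g) => y; congr psi; apply: evalw_eq_in => l /mapP[t _ ->] /=.
rewrite !gpow_proj_mul; congr (_ * _)%g; rewrite /h; have [nr _] := edge_repP c t.
case: pickP => [t' /and3P[nt' /eqP E sE]|/(_ (edge_rep c t))]; last by rewrite nr !eqxx.
congr x; apply: new_edge_uniq nr nt' _; rewrite /same_edge E eqxx /=.
by rewrite traj_type_src eq_sym.
Qed.

Lemma Ew_ind_traj : Ew (@ind R K n psi) u = (#|{ffun 'I_k -> 'S_n}|%:R)^-1 *
  \sum_(s : {ffun 'I_L.+1 -> 'I_n} | s ord_max == s ord0) #|[set sg | follows sg s]|%:R *
    haar_expect (fun v : V =>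
      psi (evalw (fun t => v (letter t).1 (psrc s t)) [seq (t, (letter t).2) | t <- enum 'I_L])).
Proof.
have WC := wreath_compact (n := n) K_compact.
have VC : compact [set: V]%classic by apply: gpow_compact; exact: gpow_compact.
rewrite /Ew (haar_fibre K_compact); last by apply: rep_fun_word; exact: rep_fun_ind.
congr (_ * _); pose f s (v : V) :=
  psi (evalw (fun t => v (letter t).1 (psrc s t)) [seq (t, (letter t).2) | t <- enum 'I_L]).
have fr s : rep_fun (f s).
  pose h (v : V) : gpow K L := fun t => v (letter t).1 (psrc s t).
  apply: (@rep_fun_comp _ _ _ h (fun a : gpow K L => psi (evalw a [seq (t, (letter t).2) | t <- enum 'I_L]))).
  - apply: (@gpow_continuous K L _ h) => t v.
    apply: (@continuous_comp _ _ _ (fun v : V => v (letter t).1) (fun b : gpow K n => b (psrc s t))).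
      exact: gpow_proj_continuous.
    exact: gpow_proj_continuous.
  - by [].
  - exact: rep_fun_word.
have mV := haar_mean R VC.
transitivity (\sum_sg \sum_(s : {ffun 'I_L.+1 -> 'I_n} | s ord_max == s ord0) (follows sg s)%:R * haar_expect (f s)).
  apply: eq_bigr => sg _.
  rewrite (_ : (fun v => _) = fun v => \sum_(s <- [seq s : {ffun 'I_L.+1 -> 'I_n} <- index_enum _
      | s ord_max == s ord0]) (follows sg s)%:R * f s v); last first.
    apply/funext => v; rewrite big_filter ind_word big_andbC [RHS]big_mkcond [LHS]big_mkcond /=.
    by apply: eq_bigr => s _; case: (s ord_max == s ord0); case: (follows sg s); rewrite /= ?mul1r ?mul0r.
  rewrite (mean_sum _ mV) => [|s]; last by apply: rep_funM; [exact: rep_fun_cst|].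
  rewrite big_filter; apply: eq_bigr => s _.
  by have [_ _ ->] := mV.
rewrite exchange_big /=; apply: eq_bigr => s _; rewrite -big_distrl /=; congr (_ * _).
by rewrite -natr_sum; congr (_%:R); rewrite -sum1dep_card [RHS]big_mkcond; apply: eq_bigr => sg _; case: follows.
Qed.
End Trajectories.

(** * Counting the trajectories of a type *)

Section Counting.
Variables (n k : nat) (u : word k).
Local Notation L := (size u).
Implicit Types (s : {ffun 'I_L.+1 -> 'I_n}) (c : {ffun 'I_L.+1 -> 'I_L.+1}).

Definition vertex_count c := #|[set j | c j == j]|.
Definition letter_edges c (i : 'I_k) : {set 'I_L} := [set t | new_edge c t && ((letter t).1 == i)].
Definition edge_count c (i : 'I_k) := #|letter_edges c i|.

Lemma follows_good s sg : s ord_max == s ord0 -> follows sg s -> good (traj_type s).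
Proof.
move=> cl /forallP fs.
have rr : reflexive (fun i j => s i == s j) by move=> x /=; exact: eqxx.
have rs : symmetric (fun i j => s i == s j) by move=> x y /=; exact: eq_sym.
have rt : transitive (fun i j => s i == s j) by move=> x y z /= /eqP -> /eqP ->.
apply/and3P; split.
- apply/forallP => j; rewrite (least_equiv_idem rr rs rt) eqxx andbT.
  exact: least_equiv_le (rr j).
- have E0 : traj_type s ord0 = ord0.
    by apply: val_inj; apply/eqP; rewrite -leqn0; exact: least_equiv_le (rr ord0).
  by rewrite -E0 traj_typeE.
apply/forallP => t; apply/forallP => t'; apply/implyP => /eqP tt'.
by rewrite traj_type_src traj_type_tgt -(eqP (fs t)) -(eqP (fs t')) tt' (inj_eq perm_inj).
Qed.

Lemma good_traj_closed s : good (traj_type s) -> s ord_max == s ord0.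
Proof. by move=> gc; rewrite -traj_typeE (good_closed gc) good_base. Qed.

Section Good.
Variables s : {ffun 'I_L.+1 -> 'I_n}.
Local Notation c := (traj_type s).
Hypothesis gc : good c.

Lemma card_letter_src i : #|[set psrc s t | t in letter_edges c i]| = edge_count c i.
Proof.
apply: card_in_imset => t t'; rewrite !inE => /andP[nt /eqP ti] /andP[nt' /eqP ti'] E.
by apply: (new_edge_uniq nt nt'); rewrite /same_edge ti ti' eqxx /= traj_type_src E.
Qed.

Lemma edge_count_le i : (edge_count c i <= n)%N.
Proof. by rewrite -card_letter_src -[X in (_ <= X)%N]card_ord max_card. Qed.

(** The permutations of one letter with prescribed values on [edge_count c i]
    points: a coset of the permutations that fix these points. *)
Lemma card_letter_perms i :
  #|[set tau : 'S_n | [forall t : 'I_L, ((letter t).1 == i) ==> (tau (psrc s t) == ptgt s t)]]|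
  = ((n - edge_count c i)`!)%N.
Proof.
have [t t' /eqP ti /eqP ti'|tau0 tau0P] := @perm_extend_pairs _ _ (fun t : 'I_L => (letter t).1 == i) (psrc s) (ptgt s).
  have := @good_consistent _ _ _ gc t t'; rewrite ti ti' traj_type_src traj_type_tgt => /(_ erefl) E.
  by split=> /eqP; rewrite ?E => F; apply/eqP; rewrite ?E // -E.
pose D := [set psrc s t | t in letter_edges c i].
have -> : (n - edge_count c i)%N = #|~: D| by rewrite cardsCs finset.setCK card_ord card_letter_src.
rewrite -card_perm -[X in _ = X](card_imset _ (mulIg tau0)); apply: eq_card => tau.
rewrite inE; apply/forallP/imsetP => [H|[rho rhoP ->] t]; last first.
  apply/implyP => ti; rewrite permM (out_perm rhoP) ?tau0P //.
  rewrite inE negbK; have [nr /andP[/eqP re /eqP rs]] := edge_repP c t.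
  have -> : psrc s t = psrc s (edge_rep c t) by apply/eqP; rewrite -traj_type_src rs.
  by apply: imset_f; rewrite inE nr re.
exists (tau * tau0^-1)%g; last by rewrite mulgKV.
apply/fintype.subsetP => x; rewrite !inE; apply: contra => /imsetP[t]; rewrite inE => /andP[_ ti] ->.
by rewrite permM (eqP (implyP (H t) ti)) -(tau0P t ti) permK.
Qed.
End Good.

Lemma card_follows s : #|[set sg | follows sg s]| =
  (\prod_(i < k) #|[set tau : 'S_n | [forall t : 'I_L, ((letter t).1 == i) ==> (tau (psrc s t) == ptgt s t)]]|)%N.
Proof.
under eq_bigr => i _ do rewrite -sum1dep_card big_mkcond /=.
rewrite bigA_distr_bigA /= -sum1dep_card big_mkcond /=; apply: eq_bigr => sg _.
case: (boolP (follows sg s)) => [/forallP fs|].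
  rewrite big1 // => i _; case: forallP => // -[] t; apply/implyP => /eqP <-; exact: fs.
rewrite negb_forall => /existsP[t ft]; rewrite (bigD1 (letter t).1) //=.
by case: forallP => [/(_ t)|//]; rewrite eqxx (negPf ft).
Qed.

(** A trajectory of type [c] is an injective placement of the vertices. *)
Lemma card_traj_type c : good c ->
  #|[set s : {ffun 'I_L.+1 -> 'I_n} | traj_type s == c]| = n ^_ (vertex_count c).
Proof.
move=> gc; pose V := {j : 'I_L.+1 | c j == j}.
have cV j : c (c j) == c j by rewrite good_idem.
pose h (f : {ffun V -> 'I_n}) : {ffun 'I_L.+1 -> 'I_n} := [ffun j => f (exist _ (c j) (cV j) : V)].
have h_inj : injective h.
  move=> f f' E; apply/ffunP => -[j jP]; have := congr1 (fun g : {ffun _} => g j) E.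
  rewrite !ffunE (_ : (exist _ (c j) (cV j) : V) = exist _ j jP) //; apply: val_inj; exact: (eqP jP).
have hE (f : {ffun V -> 'I_n}) i j : injectiveb f -> (h f i == h f j) = (c i == c j).
  move=> /injectiveP fi; rewrite !ffunE (inj_eq fi).
  by rewrite -(inj_eq val_inj).
have typeE s : (forall i j, (s i == s j) = (c i == c j)) -> traj_type s = c.
  move=> sE; apply/ffunP => j; have ker i l : (traj_type s i == traj_type s l) = (c i == c l).
    by rewrite traj_typeE sE.
  apply: val_inj; apply/eqP; rewrite eqn_leq; apply/andP; split.
    by apply: least_equiv_le; rewrite sE good_idem.
  have /eqP <- : c (traj_type s j) == c j.
    rewrite -sE; apply: (least_equivP (r := fun i j => s i == s j)) => x; exact: eqxx.
  exact: good_le.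
have -> : n ^_ vertex_count c = #|[set f : {ffun V -> 'I_n} | injectiveb f]|.
  rewrite card_inj_ffuns card_ord card_sig; congr (_ ^_ _).
  by apply: eq_card => j; rewrite !inE.
rewrite -(card_imset _ h_inj); apply: eq_card => s; rewrite inE.
apply/eqP/imsetP => [E|[f]]; last first.
  by rewrite inE => fi ->; apply: typeE => i j; exact: hE.
exists [ffun x : V => s (val x)].
  rewrite inE; apply/injectiveP => -[i iP] [j jP]; rewrite !ffunE /= => /eqP.
  by rewrite -traj_typeE E (eqP iP) (eqP jP) => /eqP ij; exact: val_inj.
apply/ffunP => j; rewrite !ffunE /=; apply/eqP.
by rewrite -traj_typeE E good_idem.
Qed.
End Counting.

Section TypeCounts.
Variables (k : nat) (u : word k) (c : {ffun 'I_(size u).+1 -> 'I_(size u).+1}).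

Lemma edge_count_size i : (edge_count c i <= size u)%N.
Proof. by rewrite -[X in (_ <= X)%N]card_ord max_card. Qed.

Lemma sum_edge_count : (\sum_(i < k) edge_count c i)%N = #|[set t | new_edge c t]|.
Proof.
rewrite -[RHS]sum1dep_card (partition_big (fun t => (letter t).1) predT) //=.
by apply: eq_bigr => i _; rewrite -[LHS]sum1dep_card.
Qed.

(** The first Betti number of the graph of the type: every vertex but the base
    is reached by exactly one tree step. *)
Lemma sub_rank_vertices : good c ->
  (sub_rank c + vertex_count c)%N = (\sum_(i < k) edge_count c i).+1.
Proof.
move=> gc; have -> : vertex_count c = #|[set t | tree_step c t]|.+1.
  rewrite /vertex_count (cardsD1 ord0) inE good_base // eqxx add1n; congr _.+1.
  rewrite -[RHS](card_imset _ (@lift_inj _ ord0)); apply: eq_card => j; rewrite !inE.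
  apply/andP/imsetP => [[j0 cj]|[t]]; last by rewrite inE => tt ->.
  by case: (unliftP ord0 j) j0 cj => [t ->|->] // _ cj; exists t; rewrite ?inE.
rewrite sum_edge_count addnS; congr _.+1.
rewrite -[RHS](cardsID [set t | tree_step c t]) addnC; congr (_ + _)%N.
  apply: eq_card => t; rewrite !inE; symmetry; apply/andb_idl; exact: tree_new.
by apply: eq_card => t; rewrite !inE andbC.
Qed.
End TypeCounts.

Section Expansion.
Local Open Scope complex_scope.
Local Open Scope ring_scope.
Variables (R : realType) (K : topGroupType) (psi : K -> R[i]).
Hypotheses (K_compact : compact [set: K]%classic) (psi_rep : rep_fun psi).

Definition type_coef (C : fieldType) k (u : word k) (c : {ffun 'I_(size u).+1 -> 'I_(size u).+1})
    (n : nat) : C :=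
  (n ^_ vertex_count c)%:R / \prod_(i < k) (n ^_ edge_count c i)%:R.

(** Trajectories of the same type contribute equally; [type_coef] is the
    expected number of those of type [c]. *)
Theorem Ew_ind k (u : word k) n :
  Ew (@ind R K n psi) u = \sum_(c : {ffun 'I_(size u).+1 -> 'I_(size u).+1} | good c) type_coef R[i] c n * Ew psi (sub_word c).
Proof.
rewrite (Ew_ind_traj K_compact psi_rep) big_distrr /=.
pose N : R[i] := #|{ffun 'I_k -> 'S_n}|%:R.
have NE : N = \prod_(i < k) (n`!)%:R.
  by rewrite /N card_ffun card_Sn card_ord natrX prodr_const card_ord.
pose G (c : {ffun 'I_(size u).+1 -> 'I_(size u).+1}) : R[i] := (\prod_(i < k) (n ^_ edge_count c i)%:R)^-1 * Ew psi (sub_word c).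
transitivity (\sum_(s | good (traj_type s)) G (traj_type (n := n) (u := u) s)).
  rewrite [LHS]big_mkcond [RHS]big_mkcond /=; apply: eq_bigr => s _.
  have [gc|ngc] := boolP (good (traj_type s)); last first.
    case: ifP => // cl; rewrite (_ : #|[set sg | follows sg s]| = 0%N) ?mul0r ?mulr0 //.
    apply: eq_card0 => sg; rewrite inE; apply: contraNF ngc; exact: follows_good.
  rewrite good_traj_closed // (haar_traj K_compact psi_rep gc) mulrA; congr (_ * _).
  rewrite card_follows -/N NE natr_prod -!prodfV -big_split /=; apply: eq_bigr => i _.
  rewrite (@card_letter_perms _ _ _ s gc) -(ffact_fact (edge_count_le s i)) natrM invfM.
  by rewrite -mulrA mulVf ?mulr1 // pnatr_eq0 -lt0n fact_gt0.
rewrite (partition_big (fun s => traj_type s) (@good k u)) //=; apply: eq_bigr => c gc.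
rewrite (eq_bigl (fun s => traj_type s == c)); last first.
  by move=> s /=; apply/andb_idl => /eqP ->.
rewrite (eq_bigr (fun=> G c)) => [|s /eqP ->//].
rewrite sumr_const -cardsE (card_traj_type n gc) /G /type_coef -[LHS]mulr_natl mulrA.
by [].
Qed.
End Expansion.

(** * Iterated wreath products *)

Section WreathOperator.
Local Open Scope ring_scope.

Section Operator.
Variable C : fieldType.
Implicit Types A : forall k, word k -> C.

(** The effect on word expectations of passing from a character to the induced
    character of the wreath product with ['S_n]. *)
Definition wreath_op n A : forall k, word k -> C := fun k u =>
  \sum_(c : {ffun 'I_(size u).+1 -> 'I_(size u).+1} | good c) type_coef C c n * A _ (sub_word c).

(** The innermost wreath product comes first in [ns], and its character is
    the first to be induced; the word is expanded from the outermost one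
    inwards, hence the recursion in [wreath_iter_rcons]. *)
Definition wreath_iter A ns := foldl (fun A n => wreath_op n A) A ns.

Lemma wreath_iter_rcons A ns n : wreath_iter A (rcons ns n) = wreath_op n (wreath_iter A ns).
Proof. by rewrite /wreath_iter -cats1 foldl_cat. Qed.

Lemma wreath_iter_eq0 A (P : forall k, word k -> Prop) :
  (forall k (u : word k) c, P k u -> good c -> P _ (sub_word (u := u) c)) ->
  (forall k (u : word k), P k u -> A k u = 0) ->
  forall ns k (u : word k), P k u -> wreath_iter A ns u = 0.
Proof.
move=> Psub PA ns; elim/last_ind: ns => [|ns n IH] k u Pu; first exact: PA.
rewrite wreath_iter_rcons /wreath_op big1 // => c gc.
by rewrite IH ?mulr0 //; exact: Psub.
Qed.
End Operator.

Lemma Ew_iter (R : realType) ns (K : topGroupType) (psi : K -> R[i]) :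
  compact [set: K]%classic -> rep_fun psi ->
  forall k (u : word k), Ew (iter_ind psi ns) u = wreath_iter (Ew psi) ns u.
Proof.
elim: ns K psi => [//|n ns IH] K psi Kc pr k u.
have := IH _ (@ind R K n psi) (wreath_compact (n := n) Kc) (rep_fun_ind n pr) k u.
rewrite /= => ->; congr (wreath_iter _ ns u).
apply: functional_extensionality_dep => k'; apply: functional_extensionality_dep => v.
exact: Ew_ind.
Qed.
End WreathOperator.

Section Asymptotics.
Local Open Scope ring_scope.
Variable C : numFieldType.

(** [1 + O(1 / n)], for the [n] that are admissible. *)
Definition near_one L (f : nat -> C) := exists2 K, 0 <= K &
  forall n, (0 < n)%N -> (L <= n)%N -> `|f n - 1| <= K / n%:R.

Lemma near_oneM L f g : near_one L f -> near_one L g -> near_one L (fun n => f n * g n).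
Proof.
move=> [K K0 fK] [K' K'0 gK]; exists (K * (1 + K') + K') => [|n n0 Ln].
  by rewrite addr_ge0 ?mulr_ge0 ?addr_ge0.
have n1 : 1 <= n%:R :> C by rewrite ler1n.
have -> : f n * g n - 1 = (f n - 1) * g n + (g n - 1) by ring.
apply: (le_trans (ler_normD _ _)); rewrite normrM mulrDl lerD ?gK //.
rewrite mulrAC ler_pM ?fK //.
rewrite -[g n](subrK 1) addrC; apply: (le_trans (ler_normD _ _)).
rewrite normr1 lerD2l; apply: (le_trans (gK _ n0 Ln)).
by rewrite ler_pdivrMr ?(lt_le_trans ltr01) // ler_peMr.
Qed.

Lemma near_one1 L : near_one L (fun=> 1).
Proof. by exists 0 => // n _ _; rewrite subrr normr0 mul0r. Qed.

Lemma near_one_prod L (I : Type) (s : seq I) (F : I -> nat -> C) :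
  (forall i, near_one L (F i)) -> near_one L (fun n => \prod_(i <- s) F i n).
Proof.
move=> FP; elim: s => [|i s [K K0 sK]].
  by have [K K0 H] := near_one1 L; exists K => // n n0 Ln; rewrite big_nil H.
have [K' K'0 H] := near_oneM (FP i) (ex_intro2 _ _ K K0 sK).
by exists K' => // n n0 Ln; rewrite big_cons H.
Qed.

Lemma near_one_factor L j : near_one L (fun n => (n - j)%:R / n%:R).
Proof.
exists j%:R => // n n0 Ln; have nn : n%:R != 0 :> C by rewrite pnatr_eq0 -lt0n.
have -> : (n - j)%:R / n%:R - 1 = - ((n - (n - j))%:R / n%:R) :> C.
  by rewrite (natrB _ (leq_subr j n)) mulrBl divff // opprB.
by rewrite normrN ger0_norm // ler_pM2r ?invr_gt0 ?ltr0n // ler_nat; lia.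
Qed.

(** As [j < L <= n] the difference is at least one, so that [n] is at most
    [j.+1] times the difference. *)
Lemma near_one_factorV L j : (j < L)%N -> near_one L (fun n => ((n - j)%:R / n%:R)^-1).
Proof.
move=> jL; exists (j * j.+1)%:R => // n n0 Ln; have nn : n%:R != 0 :> C by rewrite pnatr_eq0 -lt0n.
have nj : (0 < n - j)%N by lia.
have njn : (n - j)%:R != 0 :> C by rewrite pnatr_eq0 -lt0n.
have -> : ((n - j)%:R / n%:R)^-1 - 1 = j%:R / (n - j)%:R :> C.
  rewrite invf_div -[X in _ - X](divff njn) -mulrBl -(natrB _ (leq_subr j n)); congr (_%:R / _); lia.
rewrite ger0_norm // ler_pdivrMr ?ltr0n // mulrAC ler_pdivlMr ?ltr0n //.
by rewrite -!natrM ler_nat; nia.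
Qed.

Lemma near_one_ext L f g :
  (forall n, (0 < n)%N -> f n = g n) -> near_one L f -> near_one L g.
Proof. by move=> fg [K K0 H]; exists K => // n n0; rewrite -fg //; exact: H. Qed.

Lemma ffact_ratio n v : (0 < n)%N ->
  (n ^_ v)%:R = n%:R ^+ v * \prod_(j < v) ((n - j)%:R / n%:R) :> C.
Proof.
move=> n0; have nn : n%:R != 0 :> C by rewrite pnatr_eq0 -lt0n.
rewrite ffact_prod natr_prod prodf_div prodr_const card_ord.
by rewrite mulrCA divff ?mulr1 // expf_neq0.
Qed.

(** By [sub_rank_vertices] the powers of [n] leave [n ^ (1 - sub_rank c)]. *)
Lemma type_coef_near k (u : word k) (c : {ffun 'I_(size u).+1 -> 'I_(size u).+1}) L :
  good c -> (size u <= L)%N ->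
  near_one L (fun n => type_coef C c n * (n%:R ^+ sub_rank c / n%:R)).
Proof.
move=> gc uL.
pose Q i (n : nat) : C := \prod_(j < edge_count c i) ((n - j)%:R / n%:R)^-1.
pose P (n : nat) : C := \prod_(j < vertex_count c) ((n - j)%:R / n%:R).
apply: (@near_one_ext L (fun n => P n * \prod_i Q i n)); last first.
  apply: near_oneM; first by apply: near_one_prod => j; exact: near_one_factor.
  apply: near_one_prod => i; apply: near_one_prod => j; apply: near_one_factorV.
  exact: leq_trans (ltn_ord j) (leq_trans (edge_count_size c i) uL).
move=> n n0; have nn : n%:R != 0 :> C by rewrite pnatr_eq0 -lt0n.
rewrite /type_coef (ffact_ratio _ n0) -/(P n).
under [in RHS]eq_bigr => i _ do rewrite (ffact_ratio _ n0).
rewrite big_split /= prodrXr invfM -prodfV.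
under [X in _ = _ * (_ * X) * _]eq_bigr => i _ do rewrite -prodfV.
rewrite -/(\prod_i Q i n).
have E : n%:R ^+ vertex_count c * n%:R ^+ sub_rank c
    = n%:R ^+ (\sum_(i < k) edge_count c i) * n%:R :> C.
  by rewrite -exprD addnC sub_rank_vertices // exprSr.
have S0 : n%:R ^+ (\sum_(i < k) edge_count c i) != 0 :> C by rewrite expf_neq0.
set X := n%:R ^+ vertex_count c in E *; set Y := n%:R ^+ sub_rank c in E *.
set Z := n%:R ^+ (\sum_(i < k) edge_count c i) in E S0 *.
set B := \prod_i Q i n; transitivity (P n * B * (X * Y) / (Z * n%:R)).
  by rewrite E mulfK // mulf_neq0.
by field; rewrite nn S0.
Qed.
End Asymptotics.

(** * Means of characters *)

Section CharacterExpectations.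
Local Open Scope complex_scope.
Local Open Scope ring_scope.
Variables (R : realType) (K : topGroupType).
Hypothesis K_compact : compact [set: K]%classic.
Implicit Types phi : K -> R[i].

Lemma is_rep_mat_rep d (rho : K -> 'M[R[i]]_d) :
  is_rep rho -> mat_rep (fun i j g => rho g i j).
Proof.
case=> rho1 rhoM rhoc; split=> [i j|i j g h]; first by apply: ccontP; exact: rhoc.
by rewrite rhoM mxE.
Qed.

Lemma is_rep_trace d (rho : K -> 'M[R[i]]_d) : is_rep rho -> rep_fun (fun g => \tr (rho g)).
Proof.
move=> rr; apply: rep_fun_sum => i.
exact: (rep_fun_coef (rho := fun i j g => rho g i j) i i (is_rep_mat_rep rr)).
Qed.

Lemma irr_char_rep_fun phi : irr_char phi -> rep_fun phi.
Proof. by case=> d [rho [rr _ ->]]; exact: is_rep_trace. Qed.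

(** The mean of an irreducible representation maps every row vector to an
    invariant one; so it vanishes unless the representation is trivial. *)
Lemma haar_irr phi : irr_char phi -> phi <> (fun=> 1) -> haar_expect phi = 0.
Proof.
case=> d [rho [rr [d0 irr] ->]] nt; have mr := is_rep_mat_rep rr.
have cr i j : rep_fun (fun g => rho g i j).
  exact: (rep_fun_coef (rho := fun i j g => rho g i j) i j mr).
have mE := haar_mean R K_compact.
pose M : 'M[R[i]]_d := \matrix_(i, j) haar_expect (fun g => rho g i j).
have MrM g : M *m rho g = M.
  apply/matrixP => i j; rewrite !mxE -(haar_mulgr K_compact g (cr i j)).
  transitivity (haar_expect (fun x => \sum_k rho g k j * rho x i k)).
    by rewrite (mean_lin (fun k => rho g k j) mE) //; apply: eq_bigr => k _; rewrite mxE mulrC.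
  congr haar_expect; apply/funext => x; case: rr => _ -> _; rewrite mxE.
  by apply: eq_bigr => k _; rewrite mulrC.
have rowstab g : stablemx M (rho g) by rewrite MrM submx_refl.
have [M0|Mfull] := irr M rowstab.
  rewrite (mean_sum _ mE) // big1 // => i _.
  by have := congr1 (fun A : 'M[R[i]]_d => A i i) M0; rewrite !mxE.
exfalso; apply: nt.
have rho1 g : rho g = 1%:M.
  by rewrite row_full_unit in Mfull; rewrite -(mulKmx Mfull (rho g)) MrM mulVmx.
(* All subspaces are invariant under a trivial representation, so that an
   irreducible one has dimension one. *)
have stab g : stablemx (pid_mx 1 : 'M[R[i]]_d) (rho g) by rewrite rho1 mulmx1 submx_refl.
have [] := irr (pid_mx 1) stab.
  by move/(congr1 mxrank); rewrite mxrank0 rank_pid_mx.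
rewrite /row_full rank_pid_mx // => /eqP d1; subst d.
by apply/funext => g; rewrite rho1 mxtrace1.
Qed.

Section Linear.
Variable phi : K -> R[i].
Hypothesis phi_lin : linear_char phi.

Lemma linear_rep_fun : rep_fun phi.
Proof. by case: phi_lin => rho rr ->; exact: is_rep_trace. Qed.

Lemma linear1 : phi 1%g = 1.
Proof. by case: phi_lin => rho [r1 _ _] ->; rewrite r1 mxtrace1. Qed.

Lemma linearM g h : phi (g * h)%g = phi g * phi h.
Proof.
by case: phi_lin => rho [_ rM _] ->; rewrite rM /mxtrace !big_ord1 mxE big_ord1.
Qed.

Lemma linearV g : phi g^-1%g = (phi g)^-1.
Proof.
have E : phi g * phi g^-1%g = 1 by rewrite -linearM mulgV linear1.
have g0 : phi g != 0 by apply: contra_eq_neq E => ->; rewrite mul0r eq_sym oner_neq0.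
by apply: (mulfI g0); rewrite E divff.
Qed.

(** A linear character turns a word into a homomorphism on tuples, whose mean
    is zero unless it is trivial. *)
Lemma Ew_linear k (u : word k) :
  Ew phi u = (`[< forall a : 'I_k -> K, phi (evalw a u) = 1 >])%:R.
Proof.
have fM (a b : gpow K k) : phi (evalw (a * b)%g u) = phi (evalw a u) * phi (evalw b u).
  elim: u => [|[i e] u IH]; first by rewrite /= linear1 mulr1.
  rewrite !evalw_cons !linearM IH /= mulrACA; congr (_ * _).
  by case: e; rewrite ?linearV linearM // invfM mulrC.
case: asboolP => [triv|/existsNP[a aN]].
  rewrite /Ew (_ : (fun a => _) = fun=> 1) ?haar_expect_cst //; exact/funext.
have /(haar_mulgl (gpow_compact K_compact) a) := rep_fun_word u linear_rep_fun.
under eq_fun do rewrite fM.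
have [_ _ EZ] := haar_mean R (gpow_compact (n := k) K_compact).
rewrite EZ; last by apply: rep_fun_word; exact: linear_rep_fun.
move=> E; apply/eqP; rewrite mulr0n; apply/contra_notT: aN => n0.
by apply: (mulIf n0); rewrite mul1r.
Qed.
End Linear.
End CharacterExpectations.

(** * Ranks and lengths *)

Section Minima.
Local Open Scope classical_set_scope.

Lemma natmin_some (A : set nat) p : natmin A = Some p -> A p /\ forall n, A n -> (p <= n)%N.
Proof.
rewrite /natmin; case: pselect => // h [<-]; case: ex_minnP => n /set_mem An nmin.
by split=> // n' An'; apply: nmin; exact: mem_set.
Qed.

Lemma natmin_none (A : set nat) n : natmin A = None -> ~ A n.
Proof. by rewrite /natmin; case: pselect => // h _ An; apply: h; exists n; exact: mem_set. Qed.
End Minima.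

Section Ranks.
Local Open Scope classical_set_scope.
Local Open Scope complex_scope.
Local Open Scope ring_scope.
Variable F : groupType.
Implicit Types (H : set F) (w : F).

Lemma word_ofP H k (b : 'I_k -> F) w : free_basis H b -> H w -> evalw b (word_of b w) = w.
Proof.
move=> [HE _]; rewrite HE => -[u _ uw].
have : [set v | reduced v /\ eval_word b v = w] (red u).
  by split; [exact: red_reduced|rewrite -uw; exact: sim_evalw (red_sim u)].
by rewrite /word_of => /(xgetI [::]) [].
Qed.

Lemma a_basis_free H k (b : 'I_k -> F) : free_basis H b -> free_basis H (projT2 (a_basis H)).
Proof.
move=> fb; rewrite /a_basis; case: pselect => [h|[]]; first exact: projT2 (cid h).
by exists (existT _ k b).
Qed.

Lemma rk_basis H k (b : 'I_k -> F) : free_basis H b -> rk H = k.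
Proof. by move=> fb; exact: free_basis_rank (a_basis_free fb) fb. Qed.

Lemma word_expect_basis (R : realType) (K : topGroupType) (psi : K -> R[i]) H k (b : 'I_k -> F) u w :
  compact [set: K] -> rep_fun psi -> free_basis H b -> evalw b u = w ->
  word_expect H w psi = Ew psi u.
Proof.
move=> Kc pr fb uw; have fa := a_basis_free fb; apply: (Ew_basis Kc pr fa fb).
by rewrite uw (word_ofP fa) //; case: fb => -> _; exists u.
Qed.

Lemma min_length_basis w k (b : 'I_k -> F) : free_basis [set: F] b ->
  exists k' (b' : 'I_k' -> F) u,
    [/\ free_basis [set: F] b', evalw b' u = w & size u = min_length w].
Proof.
move=> fb; rewrite /min_length; case E: natmin => [l|]; last first.
  by have := natmin_none E; move/(_ (size (word_of b w))) => []; exists k, b.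
have [[k' [b' [fb' ->]]] _] := natmin_some E.
by exists k', b', (word_of b' w); split=> //; exact: word_ofP fb' _.
Qed.

Lemma free_basis_subgroup H k (b : 'I_k -> F) : free_basis H b -> fg_subgroup H.
Proof. by case=> HE _; exists k, b. Qed.

Section Ambient.
Variables (r : nat) (x : 'I_r -> F).
Hypothesis F_free : free_basis [set: F] x.

Lemma fg_free H : fg_subgroup H -> exists k (b : 'I_k -> F), free_basis H b.
Proof. by case=> q [y HE]; exact: nielsen_schreier F_free _ HE. Qed.

Lemma primitivity_rank_le w k (b : 'I_k -> F) H : free_basis H b -> H w ->
  ~ primitive_in H w -> exists2 p, primitivity_rank w = Some p & (p <= k)%N.
Proof.
move=> fb Hw np; have HA : [set rk H | H in
    [set H | [/\ fg_subgroup H, H w & ~ primitive_in H w]]] k.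
  by exists H; [split=> //; exact: free_basis_subgroup fb|exact: rk_basis fb].
rewrite /primitivity_rank; case E: natmin => [p|]; last by case: (natmin_none E HA).
by exists p => //; exact: (natmin_some E).2.
Qed.
End Ambient.
End Ranks.

(** * Growth of iterated expansions *)

Section Growth.
Local Open Scope ring_scope.
Variables (C : numFieldType) (A : forall k, word k -> C).
Variables (p L : nat) (W : forall k, word k -> Prop).
Hypothesis W_sub : forall k (u : word k) c, W u -> good c -> W (sub_word (u := u) c).

Definition rate (z : C) := z / z ^+ p.
Definition large (ns : seq nat) := all (fun n => (0 < n)%N && (L <= n)%N) ns.
Definition prodn (ns : seq nat) : C := \prod_(n <- ns) n%:R.
Definition sum_inv (ns : seq nat) : C := \sum_(n <- ns) n%:R^-1.

Lemma rateM y z : rate (y * z) = rate y * rate z.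
Proof. by rewrite /rate exprMn invfM mulrACA. Qed.

Lemma rate_gt0 z : 0 < z -> 0 < rate z.
Proof. by move=> z0; rewrite divr_gt0 ?exprn_gt0. Qed.

Lemma large_rcons ns n : large (rcons ns n) = [&& (0 < n)%N, (L <= n)%N & large ns].
Proof. by rewrite /large all_rcons andbA. Qed.

Lemma prodn_rcons ns n : prodn (rcons ns n) = prodn ns * n%:R.
Proof. by rewrite /prodn -cats1 big_cat big_seq1. Qed.

Lemma sum_inv_rcons ns n : sum_inv (rcons ns n) = sum_inv ns + n%:R^-1.
Proof. by rewrite /sum_inv -cats1 big_cat big_seq1. Qed.

Lemma prodn_gt0 ns : large ns -> 0 < prodn ns.
Proof.
elim/last_ind: ns => [|ns n IH]; first by rewrite /prodn big_nil.
by rewrite large_rcons prodn_rcons => /and3P[n0 _ /IH h]; rewrite mulr_gt0 ?ltr0n.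
Qed.

Lemma sum_inv_ge0 ns : 0 <= sum_inv ns.
Proof. by apply: sumr_ge0 => n _; rewrite invr_ge0. Qed.

Section Coefficients.
Variables (k : nat) (u : word k) (c : {ffun 'I_(size u).+1 -> 'I_(size u).+1}).
Hypotheses (gc : good c) (uL : (size u <= L)%N).

Lemma type_coef_rate : exists2 K, 0 <= K & forall n, (0 < n)%N -> (L <= n)%N ->
  `|type_coef C c n - n%:R / n%:R ^+ sub_rank c| <= K / n%:R * (n%:R / n%:R ^+ sub_rank c).
Proof.
have [K K0 H] := type_coef_near C gc uL; exists K => // n n0 Ln.
have nn : n%:R != 0 :> C by rewrite pnatr_eq0 -lt0n.
have r0 : 0 < n%:R / n%:R ^+ sub_rank c :> C by rewrite divr_gt0 ?exprn_gt0 ?ltr0n.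
rewrite -ler_pdivrMr // -{2}(ger0_norm (ltW r0)) -normf_div mulrBl divff ?gt_eqF //.
by rewrite invf_div; exact: H.
Qed.

Lemma type_coef_le : (p <= sub_rank c)%N ->
  exists2 K, 0 <= K & forall n, (0 < n)%N -> (L <= n)%N ->
    `|type_coef C c n| <= K * rate n%:R / n%:R ^+ (sub_rank c - p).
Proof.
move=> pc; have [K K0 H] := type_coef_rate; exists (K + 1) => [|n n0 Ln]; first by rewrite addr_ge0.
have n1 : 1 <= n%:R :> C by rewrite ler1n.
have n0' : 0 < n%:R :> C by rewrite ltr0n.
have r0 : 0 <= n%:R / n%:R ^+ sub_rank c :> C by rewrite ltW // divr_gt0 ?exprn_gt0.
have -> : (K + 1) * rate n%:R / n%:R ^+ (sub_rank c - p) = (K + 1) * (n%:R / n%:R ^+ sub_rank c).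
  by rewrite /rate -{2}(subnK pc) exprD invfM [X in _ = _ * (_ * X)]mulrC !mulrA.
rewrite -[X in `|X|](subrK (n%:R / n%:R ^+ sub_rank c)).
apply: (le_trans (ler_normD _ _)); rewrite mulrDl mul1r lerD ?(ger0_norm r0) //.
apply: (le_trans (H _ n0 Ln)); rewrite ler_wpM2r // ler_pdivrMr // ler_peMr //.
Qed.
End Coefficients.

(** A type of rank [k] contributes terms of order [n ^ (1 - k)]; only types
    whose rank is at least [p] contribute. *)
Lemma wreath_iter_bound :
  (forall ns k (u : word k), W u -> (k < p)%N -> wreath_iter A ns u = 0) ->
  forall m k (u : word k), W u -> (size u <= L)%N ->
  exists2 K, 0 <= K & forall ns, size ns = m -> large ns ->
    `|wreath_iter A ns u| <= K * rate (prodn ns).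
Proof.
move=> A0; elim=> [|m IH] k u Wu uL.
  exists `|A u| => // ns /size0nil -> _.
  by rewrite /prodn big_nil /rate expr1n divr1 mulr1.
have /choice[Kf KfP] : forall c : {ffun 'I_(size u).+1 -> 'I_(size u).+1}, exists K, 0 <= K /\
    (good c -> forall ns n, size ns = m -> large (rcons ns n) ->
    `|type_coef C c n * wreath_iter A ns (sub_word c)| <= K * rate (prodn (rcons ns n))).
  move=> c; have [gc|_] := boolP (good c); last by exists 0.
  have [cp|pc] := ltnP (sub_rank c) p.
    exists 0; split=> // _ ns n _ _; rewrite A0 //; last exact: W_sub.
    by rewrite mulr0 normr0 mul0r.
  have [K K0 H] := type_coef_le gc uL pc.
  have [K' K'0 H'] := IH _ (sub_word c) (W_sub Wu gc) (leq_trans (size_sub_word c) uL).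
  exists (K * K'); split=> [|_ ns n sz]; first exact: mulr_ge0.
  rewrite large_rcons => /and3P[n0 Ln lns]; have n1 : 1 <= n%:R :> C by rewrite ler1n.
  rewrite normrM prodn_rcons rateM [rate (prodn ns) * _]mulrC mulrACA ler_pM ?H' //.
  apply: (le_trans (H _ n0 Ln)); rewrite ler_piMr ?mulr_ge0 //.
  by rewrite invf_le1 ?exprn_gt0 ?ltr0n // exprn_ege1.
exists (\sum_c Kf c) => [|ns]; first by apply: sumr_ge0 => c _; case: (KfP c).
elim/last_ind: ns => [//|ns n _]; rewrite size_rcons => -[sz] lns.
rewrite wreath_iter_rcons mulr_suml; apply: (le_trans (ler_norm_sum _ _ _)).
rewrite [leRHS](bigID (@good k u)) /= -[leLHS]addr0 lerD //.
  by apply: ler_sum => c gc; apply: (KfP c).2.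
by apply: sumr_ge0 => c _; rewrite mulr_ge0 ?(KfP c).1 // ltW // rate_gt0 // prodn_gt0.
Qed.

Definition leading k (u : word k) (c : {ffun 'I_(size u).+1 -> 'I_(size u).+1}) :=
  [&& good c, A (sub_word c) != 0 & sub_rank c == p].

(** The number of chains of leading types of length [m]. *)
Fixpoint lead m k (u : word k) : nat :=
  if m is m'.+1 then
    (\sum_(c : {ffun 'I_(size u).+1 -> 'I_(size u).+1} | leading c) lead m' (sub_word c))%N
  else 1%N.

Hypothesis A01 : forall k (u : word k), W u -> A u != 0 -> A u = 1.
Hypothesis A_rank : forall k (u : word k), W u -> A u != 0 -> (p <= k)%N.
Hypothesis A_zero : forall ns k (u : word k), W u -> A u = 0 -> wreath_iter A ns u = 0.

(** Types of rank above [p] lose a factor [n], and those whose word [A] does not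
    see contribute nothing; a type of rank [p] contributes its own leading
    coefficient. *)
Lemma wreath_iter_lead m k (u : word k) : W u -> (size u <= L)%N -> A u != 0 ->
  exists2 K, 0 <= K & forall ns, size ns = m -> large ns ->
    `|wreath_iter A ns u - rate (prodn ns) * (lead m u)%:R| <= K * sum_inv ns * rate (prodn ns).
Proof.
have A0 ns k' (v : word k') : W v -> (k' < p)%N -> wreath_iter A ns v = 0.
  move=> Wv kp; apply: A_zero => //; apply: contraTeq kp => Av.
  by rewrite -leqNgt; exact: A_rank Av.
elim: m k u => [|m IH] k u Wu uL Au.
  exists 0 => // ns /size0nil -> _.
  by rewrite /prodn big_nil /rate expr1n divr1 mul1r /= (A01 Wu Au) subrr normr0 !mul0r.
pose main (c : {ffun 'I_(size u).+1 -> 'I_(size u).+1}) : C :=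
  if leading c then (lead m (sub_word c))%:R else 0.
have /choice[Kf KfP] : forall c : {ffun 'I_(size u).+1 -> 'I_(size u).+1}, exists K, 0 <= K /\
    (good c -> forall ns n, size ns = m -> large (rcons ns n) ->
    `|type_coef C c n * wreath_iter A ns (sub_word c) - rate (prodn (rcons ns n)) * main c|
      <= K * sum_inv (rcons ns n) * rate (prodn (rcons ns n))).
  move=> c; have [gc|_] := boolP (good c); last by exists 0.
  have Wc := W_sub Wu gc; have cL := leq_trans (size_sub_word c) uL.
  have [Ac|Ac] := eqVneq (A (sub_word c)) 0.
    exists 0; split=> // _ ns n _ _; rewrite A_zero // /main /leading Ac eqxx andbF /= !mulr0.
    by rewrite subrr normr0 !mul0r.
  have pc := A_rank Wc Ac; have [K K0 H] := type_coef_le gc uL pc.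
  have [K' K'0 H'] := wreath_iter_bound A0 m Wc cL.
  have rg0 ns n : (0 < n)%N -> large ns -> 0 <= rate (prodn ns) /\ 0 <= rate (n%:R : C).
    by move=> n0 lns; rewrite !ltW // rate_gt0 ?prodn_gt0 // ltr0n.
  have [cp|cp] := eqVneq (sub_rank c) p; last first.
    exists (K * K'); split=> [|_ ns n sz]; first exact: mulr_ge0.
    rewrite large_rcons => /and3P[n0 Ln lns]; have [r0 r0'] := rg0 ns n n0 lns.
    have n1 : 1 <= n%:R :> C by rewrite ler1n.
    rewrite /main /leading (negPf cp) !andbF mulr0 subr0 normrM prodn_rcons rateM.
    have -> : K * K' * sum_inv (rcons ns n) * (rate (prodn ns) * rate n%:R)
      = (K * rate n%:R * sum_inv (rcons ns n)) * (K' * rate (prodn ns)) by ring.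
    rewrite ler_pM ?H' //; apply: (le_trans (H _ n0 Ln)); rewrite ler_wpM2l ?mulr_ge0 //.
    rewrite sum_inv_rcons -[leLHS]add0r lerD ?sum_inv_ge0 // lef_pV2 ?posrE ?exprn_gt0 ?ltr0n //.
    by rewrite -[leLHS]expr1 ler_weXn2l // subn_gt0 ltn_neqAle eq_sym cp.
  have [K1 K10 H1] := type_coef_rate gc uL; have [K2 K20 H2] := IH _ _ Wc cL Ac.
  exists (K1 * K' + K2 + K1 * (lead m (sub_word c))%:R); split=> [|_ ns n sz].
    by rewrite !addr_ge0 ?mulr_ge0.
  rewrite large_rcons => /and3P[n0 Ln lns]; have [r0 r0'] := rg0 ns n n0 lns.
  have lc : leading c by rewrite /leading gc Ac /= cp.
  rewrite /main lc prodn_rcons rateM.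
  have {}H1 := H1 _ n0 Ln; rewrite cp -/(rate n%:R) in H1.
  set t := type_coef C c n in H1 *; set z := wreath_iter A ns (sub_word c).
  set l := (lead m (sub_word c))%:R; set a := rate (prodn ns) in r0 *; set b := rate n%:R in r0' H1 *.
  have -> : t * z - a * b * l = (t - b) * z + b * (z - a * l) by ring.
  have S0 := sum_inv_ge0 ns; have V0 : 0 <= n%:R^-1 :> C by rewrite invr_ge0.
  have l0 : 0 <= l by [].
  have E1 : `|(t - b) * z| <= K1 / n%:R * b * (K' * a) by rewrite normrM ler_pM // H'.
  have E2 : `|b * (z - a * l)| <= b * (K2 * sum_inv ns * a).
    by rewrite normrM ger0_norm // ler_wpM2l // H2.
  apply: (le_trans (ler_normD _ _)); apply: (le_trans (lerD E1 E2)).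
  rewrite sum_inv_rcons -subr_ge0.
  have -> : (K1 * K' + K2 + K1 * l) * (sum_inv ns + n%:R^-1) * (a * b) -
    (K1 / n%:R * b * (K' * a) + b * (K2 * sum_inv ns * a)) =
    (K1 * K' * sum_inv ns + K2 / n%:R + K1 * l * (sum_inv ns + n%:R^-1)) * (a * b) by ring.
  by repeat first [assumption | apply: addr_ge0 | apply: mulr_ge0].
exists (\sum_c Kf c) => [|ns]; first by apply: sumr_ge0 => c _; case: (KfP c).
elim/last_ind: ns => [//|ns n _]; rewrite size_rcons => -[sz] lns.
have -> : (lead m.+1 u)%:R = \sum_(c : {ffun 'I_(size u).+1 -> 'I_(size u).+1} | good c) main c.
  rewrite /= natr_sum big_mkcond [RHS]big_mkcond; apply: eq_bigr => c _.
  by rewrite /main /leading; case: (good c).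
rewrite wreath_iter_rcons mulr_sumr -sumrB -mulrA mulr_suml; apply: (le_trans (ler_norm_sum _ _ _)).
rewrite [leRHS](bigID (@good k u)) /= -[leLHS]addr0 lerD //.
  by apply: ler_sum => c gc; rewrite mulrA; apply: (KfP c).2.
apply: sumr_ge0 => c _; rewrite mulr_ge0 ?(KfP c).1 // mulr_ge0 ?sum_inv_ge0 //.
by rewrite ltW // rate_gt0 // prodn_gt0.
Qed.
End Growth.

(** * Rational functions over the field of word expectations *)

Section ExpectationField.
Local Open Scope complex_scope.
Local Open Scope ring_scope.
Variables (R : realType) (K : topGroupType).

(** Named, so as to carry the structure of a subfield. *)
Definition expect_pred : {pred R[i]} := [in expect_field R K].

Lemma expect_pred_divring : GRing.divring_closed expect_pred.
Proof.
split=> [|x y|x y]; rewrite !inE; first by move=> S [S1 _ _] _.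
  by move=> xK yK S SD SE; have [_ SB _] := SD; apply: SB; [exact: xK|exact: yK].
by move=> xK yK S SD SE; have [_ _ SV] := SD; apply: SV; [exact: xK|exact: yK].
Qed.

HB.instance Definition _ := GRing.isDivringClosed.Build R[i] expect_pred expect_pred_divring.

Lemma expect_pred_Ew k (u : word k) (psi : K -> R[i]) : irr_char psi -> Ew psi u \in expect_pred.
Proof. by move=> pi; rewrite inE => S _; apply. Qed.

Section RationalFunctions.
Variables (m L : nat).
Implicit Types (f g : m.-tuple nat -> R[i]).
Local Notation at_ n := (fun i : 'I_m => (tnth n i)%:R : R[i]).

Definition poly_fun f := exists2 P : mpoly.mpoly m R[i],
  P \is a mpoly.mpolyOver m expect_pred & forall n, f n = mpoly.meval (at_ n) P.

Definition rat_fun f := exists p q, [/\ poly_fun p, poly_fun q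
  & forall n : m.-tuple nat, large L n -> q n != 0 /\ f n = p n / q n].

Lemma poly_fun_cst z : z \in expect_pred -> poly_fun (fun=> z).
Proof.
move=> zK; exists (mpoly.mpolyC m z); first by rewrite mpoly.mpolyOverC.
by move=> n; rewrite mpoly.mevalC.
Qed.

Lemma poly_fun_coord i : poly_fun (fun n => (tnth n i)%:R).
Proof.
exists (mpoly.mpolyX _ (mpoly.mnm1 i)); first exact: mpoly.mpolyOverX.
by move=> n; rewrite mpoly.mevalXU.
Qed.

Lemma poly_funB f g : poly_fun f -> poly_fun g -> poly_fun (fun n => f n - g n).
Proof.
move=> [P PK fP] [Q QK gQ]; exists (P - Q); first by rewrite rpredB.
by move=> n; rewrite mpoly.mevalB fP gQ.
Qed.

Lemma poly_funD f g : poly_fun f -> poly_fun g -> poly_fun (fun n => f n + g n).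
Proof.
move=> [P PK fP] [Q QK gQ]; exists (P + Q); first by rewrite rpredD.
by move=> n; rewrite mpoly.mevalD fP gQ.
Qed.

Lemma poly_funM f g : poly_fun f -> poly_fun g -> poly_fun (fun n => f n * g n).
Proof.
move=> [P PK fP] [Q QK gQ]; exists (P * Q); first by rewrite rpredM.
by move=> n; rewrite mpoly.mevalM fP gQ.
Qed.

Lemma poly_fun_ext f g : (forall n, f n = g n) -> poly_fun f -> poly_fun g.
Proof. by move=> fg [P PK fP]; exists P => // n; rewrite -fg. Qed.

Lemma poly_fun_prod (I : Type) (s : seq I) (f : I -> m.-tuple nat -> R[i]) :
  (forall i, poly_fun (f i)) -> poly_fun (fun n => \prod_(i <- s) f i n).
Proof.
move=> fP; elim: s => [|i s IH].
  by apply: poly_fun_ext (poly_fun_cst (rpred1 _)) => n; rewrite big_nil.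
by apply: poly_fun_ext (poly_funM (fP i) IH) => n; rewrite big_cons.
Qed.

Lemma rat_poly f : poly_fun f -> rat_fun f.
Proof.
move=> fP; exists f, (fun=> 1); split=> //; first exact: poly_fun_cst (rpred1 _).
by move=> n _; rewrite divr1 oner_neq0.
Qed.

Lemma rat_funD f g : rat_fun f -> rat_fun g -> rat_fun (fun n => f n + g n).
Proof.
move=> [p [q [pp qp fE]]] [p' [q' [pp' qp' gE]]].
exists (fun n => p n * q' n + p' n * q n), (fun n => q n * q' n); split=> [||n ln].
- by apply: poly_funD; exact: poly_funM.
- exact: poly_funM.
have [qn ->] := fE n ln; have [qn' ->] := gE n ln.
by rewrite mulf_neq0 // addf_div.
Qed.

Lemma rat_funM f g : rat_fun f -> rat_fun g -> rat_fun (fun n => f n * g n).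
Proof.
move=> [p [q [pp qp fE]]] [p' [q' [pp' qp' gE]]].
exists (fun n => p n * p' n), (fun n => q n * q' n); split=> [||n ln]; try exact: poly_funM.
have [qn ->] := fE n ln; have [qn' ->] := gE n ln.
by rewrite mulf_neq0 // mulf_div.
Qed.

Lemma rat_funV f : poly_fun f -> (forall n : m.-tuple nat, large L n -> f n != 0) ->
  rat_fun (fun n => (f n)^-1).
Proof.
move=> fP f0; exists (fun=> 1), f; split=> // [|n ln]; first exact: poly_fun_cst (rpred1 _).
by rewrite f0 // div1r.
Qed.

Lemma rat_fun_ext f g : (forall n, f n = g n) -> rat_fun f -> rat_fun g.
Proof. by move=> /funext ->. Qed.

Lemma rat_fun_sum (I : Type) (s : seq I) (P : pred I) (f : I -> m.-tuple nat -> R[i]) :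
  (forall i, P i -> rat_fun (f i)) -> rat_fun (fun n => \sum_(i <- s | P i) f i n).
Proof.
move=> fP; elim: s => [|i s IH].
  by apply: rat_fun_ext (rat_poly (poly_fun_cst (rpred0 _))) => n; rewrite big_nil.
have [Pi|Pi] := boolP (P i).
  by apply: rat_fun_ext (rat_funD (fP i Pi) IH) => n; rewrite big_cons Pi.
by apply: rat_fun_ext IH => n; rewrite big_cons (negPf Pi).
Qed.

(** The truncated subtractions in a falling factorial may be replaced by true
    ones: when one of them is truncated, an earlier factor is zero. *)
Lemma poly_fun_ffact i e : poly_fun (fun n => (tnth n i ^_ e)%:R).
Proof.
apply: (@poly_fun_ext (fun n => \prod_(j <- iota 0 e) ((tnth n i)%:R - j%:R))) => [n|]; last first.
  by apply: poly_fun_prod => j; apply: poly_funB (poly_fun_coord i) (poly_fun_cst (rpred_nat _ j)).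
elim: e => [|e IH]; first by rewrite big_nil.
rewrite -addn1 iotaD big_cat big_seq1 IH addn1 ffactnSr natrM add0n.
have [le|lt] := leqP e (tnth n i); first by rewrite natrB.
by rewrite (ffact_small lt) mulr0n /= !mul0r.
Qed.

Lemma rat_fun_type_coef k (u : word k) (c : {ffun 'I_(size u).+1 -> 'I_(size u).+1}) i :
  (size u <= L)%N -> rat_fun (fun n => type_coef R[i] c (tnth n i)).
Proof.
move=> uL; apply: rat_funM; first by apply: rat_poly; exact: poly_fun_ffact.
apply: rat_funV.
  apply: (@poly_fun_prod _ _ (fun j n => (tnth n i ^_ edge_count c j)%:R)) => j.
  exact: poly_fun_ffact.
move=> n /allP ln; apply/prodf_neq0 => j _; rewrite pnatr_eq0 -lt0n ffact_gt0.
have /andP[_] := ln _ (mem_tnth i n); apply: leq_trans.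
exact: leq_trans (edge_count_size c j) uL.
Qed.

Lemma rat_fun_iter (A : forall k, word k -> R[i]) :
  (forall k (u : word k), A k u \in expect_pred) ->
  forall k (u : word k), (size u <= L)%N -> rat_fun (fun n => wreath_iter A n u).
Proof.
move=> AK k u uL; suff H j : (j <= m)%N -> forall k (u : word k), (size u <= L)%N ->
    rat_fun (fun n => wreath_iter A (take j n) u).
  by apply: rat_fun_ext (H m (leqnn m) k u uL) => n; rewrite -{1}(size_tuple n) take_size.
elim: j => [|j IH] jm {uL}k {}u uL.
  by apply: rat_fun_ext (rat_poly (poly_fun_cst (AK k u))) => n; rewrite take0.
apply: (@rat_fun_ext (fun n => wreath_op (tnth n (Ordinal jm)) (wreath_iter A (take j n)) u)).
  by move=> n; rewrite (take_nth 0%N) ?size_tuple // wreath_iter_rcons (tnth_nth 0%N).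
apply: rat_fun_sum => c gc; apply: rat_funM; first exact: rat_fun_type_coef.
by apply: IH (ltnW jm) _ _ _; exact: leq_trans (size_sub_word c) uL.
Qed.
End RationalFunctions.
End ExpectationField.

(** * Elements spelled in subgroups *)

Section Letters.
Local Open Scope complex_scope.
Local Open Scope ring_scope.

(** The new word has at most one letter; it is not empty, as its value at a
    suitable permutation is not the identity. *)
Lemma sub_word_letter k (l : 'I_k * bool) (c : {ffun 'I_(size [:: l]).+1 -> 'I_(size [:: l]).+1}) :
  good c -> exists l', sub_word (u := [:: l]) c = [:: l'].
Proof.
move=> gc; have := size_sub_word (u := [:: l]) c; case E: (sub_word _) => [|l' [|? ?]] // _.
  have := evalw_sub_word gc (fun=> tperm true false); rewrite E evalw_letter /=.
  have t1 : tperm true false != 1%g.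
    by apply/eqP => /permP/(_ true); rewrite tpermL perm1.
  by case: l.2 => /esym/eqP; rewrite ?invg_eq1 (negPf t1).
by exists l'.
Qed.

Lemma Ew_letter (R : realType) (K : topGroupType) (psi : K -> R[i]) k (l : 'I_k * bool) :
  compact [set: K]%classic -> rep_fun psi -> Ew psi [:: l] = haar_expect psi.
Proof.
move=> Kc pr; pose f g := psi (if l.2 then g^-1%g else g).
have fr : rep_fun f by rewrite /f; case: l.2 => //; exact: rep_fun_inv.
transitivity (haar_expect f); last by rewrite /f; case: l.2 => //; exact: haar_inv.
rewrite -(@haar_comp R _ _ (fun a : gpow K k => a l.1) f) //.
- by congr haar_expect; apply/funext => a; rewrite /f [eval_word _ _]evalw_letter.
- exact: gpow_compact.
- exact: gpow_proj_continuous.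
- by move=> g; exists (fun=> g).
Qed.

Lemma rep_fun_iter_ind (R : realType) ns (K : topGroupType) (psi : K -> R[i]) :
  rep_fun psi -> rep_fun (iter_ind psi ns).
Proof. by elim: ns K psi => [//|n ns IH] K psi pr; apply: IH; exact: rep_fun_ind. Qed.

Lemma iter_ind1 (R : realType) ns (K : topGroupType) (psi : K -> R[i]) :
  iter_ind psi ns 1%g = psi 1%g * prodn R[i] ns.
Proof.
elim: ns K psi => [|n ns IH] K psi; first by rewrite /prodn big_nil mulr1.
rewrite /= (IH _ (@ind R K n psi)) /prodn big_cons mulrA; congr (_ * _).
rewrite /ind (eq_bigl predT) => [|i]; last by rewrite /= perm1 eqxx.
by rewrite (eq_bigr (fun=> psi 1%g)) // sumr_const card_ord mulr_natr.
Qed.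
End Letters.

Section Spelling.
Local Open Scope classical_set_scope.
Local Open Scope complex_scope.
Local Open Scope ring_scope.
Variables (R : realType) (K : topGroupType) (phi : K -> R[i]).
Hypothesis K_compact : compact [set: K].
Variables (F : groupType) (r : nat) (x : 'I_r -> F).
Hypothesis F_free : free_basis [set: F] x.
Variable w : F.

(** The words derived from a word for [w] spell [w] again, in the bases of
    subgroups. *)
Definition spells k (u : word k) :=
  exists H (b : 'I_k -> F), free_basis H b /\ evalw b u = w.

Lemma spells_sub k (u : word k) (c : {ffun 'I_(size u).+1 -> 'I_(size u).+1}) :
  spells u -> good c -> spells (sub_word c).
Proof.
case=> H [b [fb uw]] gc; exists (sub_group b c), (sub_gen (c := c) b).
split; last by rewrite evalw_sub_word.
exact: (sub_free fb gc).
Qed.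

(** A primitive element is spelled by one letter in some basis, and so are
    all words derived from it. *)
Lemma wreath_iter_primitive ns k (u : word k) (b : 'I_k -> F) H :
  irr_char phi -> phi <> (fun=> 1) -> free_basis H b -> primitive_in H (evalw b u) ->
  wreath_iter (Ew phi) ns u = 0.
Proof.
move=> irr nt fb [k' [b' [i [fb' ui]]]]; have pr := irr_char_rep_fun irr.
rewrite -Ew_iter // (@Ew_basis _ _ _ (iter_wreath_compact (ns := ns) K_compact)
  (rep_fun_iter_ind ns pr) _ _ _ _ _ _ _ [:: (i, false)] fb fb'); last first.
  by rewrite evalw_letter /= ui.
rewrite Ew_iter //; apply: (wreath_iter_eq0 (P := fun k u => exists l, u = [:: l])).
- by move=> k1 v c [l E]; subst v; exact: sub_word_letter.
- by move=> k1 _ [l ->]; rewrite Ew_letter // haar_irr.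
by exists (i, false).
Qed.

Lemma wreath_iter_small ns k (u : word k) p :
  irr_char phi -> phi <> (fun=> 1) -> spells u ->
  primitivity_rank w = Some p -> (k < p)%N -> wreath_iter (Ew phi) ns u = 0.
Proof.
move=> irr nt [H [b [fb uw]]] wp; apply: contraTeq => n0; rewrite -leqNgt.
have [||p' wp' p'k] := primitivity_rank_le fb (w := w).
- by case: fb => -> _; exists u.
- by rewrite -uw => /(wreath_iter_primitive ns irr nt fb) /eqP; rewrite (negPf n0).
by move: wp'; rewrite wp => -[->].
Qed.

Lemma wreath_iter_none ns k (u : word k) :
  irr_char phi -> phi <> (fun=> 1) -> spells u ->
  primitivity_rank w = None -> wreath_iter (Ew phi) ns u = 0.
Proof.
move=> irr nt [H [b [fb uw]]] wN; apply: contrapT => n0.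
have [||p wp _] := primitivity_rank_le fb (w := w).
- by case: fb => -> _; exists u.
- by rewrite -uw => /(wreath_iter_primitive ns irr nt fb).
by rewrite wN in wp.
Qed.
End Spelling.

(** * Linear characters and critical subgroups *)

Section LinearCharacters.
Local Open Scope classical_set_scope.
Local Open Scope complex_scope.
Local Open Scope ring_scope.
Variables (R : realType) (K : topGroupType) (phi : K -> R[i]).
Hypotheses (K_compact : compact [set: K]) (phi_lin : linear_char phi).
Variables (F : groupType) (r : nat) (x : 'I_r -> F).
Hypothesis F_free : free_basis [set: F] x.
Variable w : F.
Local Notation A := (Ew phi).

Lemma Ew_linear_neq0 k (u : word k) : A u != 0 <-> forall a : 'I_k -> K, phi (evalw a u) = 1.
Proof.
rewrite Ew_linear //; case: asboolP => [triv|ntriv]; first by rewrite oner_neq0.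
by rewrite eqxx.
Qed.

Lemma Ew_linear1 k (u : word k) : A u != 0 -> A u = 1.
Proof. by rewrite Ew_linear //; case: asboolP => // _; rewrite eqxx. Qed.

Lemma Ew_linear_iter0 ns k (u : word k) : A u = 0 -> wreath_iter A ns u = 0.
Proof.
apply: (wreath_iter_eq0 (P := fun k u => A u = 0)) => // k' v c /eqP v0 gc.
apply/eqP; apply: contraTT v0 => /Ew_linear_neq0 cv; apply/Ew_linear_neq0 => a.
by rewrite -(evalw_sub_word gc).
Qed.

Lemma char_witness_word H k (b : 'I_k -> F) (u : word k) :
  free_basis H b -> evalw b u = w -> A u != 0 -> char_witness phi w H.
Proof.
move=> fb uw Au; split; first exact: free_basis_subgroup fb.
  by case: fb => -> _; exists u.
by rewrite (word_expect_basis K_compact (linear_rep_fun phi_lin) fb uw); apply/eqP.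
Qed.

Lemma char_witness_basis H : char_witness phi w H -> exists k (b : 'I_k -> F) (u : word k),
  [/\ free_basis H b, evalw b u = w & A u != 0].
Proof.
case=> fg Hw Hn; have [k [b fb]] := fg_free F_free fg.
exists k, b, (word_of b w); have bw := word_ofP fb Hw; split=> //.
by apply/eqP; rewrite -(word_expect_basis K_compact (linear_rep_fun phi_lin) fb bw).
Qed.

(** Homomorphisms on the free group restrict to its subgroups, so that a linear
    character that kills [w] under all those of [H] kills it under all those of
    the whole group. *)
Lemma char_witness_setT k (b : 'I_k -> F) (u : word k) H :
  free_basis [set: F] b -> evalw b u = w -> char_witness phi w H -> A u != 0.
Proof.
move=> fb uw /char_witness_basis[k' [b' [v [fb' vw /Ew_linear_neq0 v1]]]].
have /choice[Y YE] : forall j, exists y : word k, evalw b y = b' j.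
  by move=> j; exists (word_of b (b' j)); exact: word_ofP fb _.
apply/Ew_linear_neq0 => a; rewrite (free_basis_evalw (v := wsub Y v) a fb) ?evalw_wsub //.
by rewrite uw -vw; symmetry; apply: evalw_ext => j; rewrite YE.
Qed.

Lemma char_rank_none k (b : 'I_k -> F) (u : word k) :
  free_basis [set: F] b -> evalw b u = w -> char_rank phi w = None -> A u = 0.
Proof.
move=> fb uw rN; apply: contrapT => /eqP Au.
have W := char_witness_word fb uw Au.
by case: (natmin_none (n := rk [set: F]) rN); exists [set: F].
Qed.

Section FiniteRank.
Variable p : nat.
Hypothesis w_rank : char_rank phi w = Some p.

Lemma char_rank_le k (u : word k) : spells w u -> A u != 0 -> (p <= k)%N.
Proof.
case=> H [b [fb uw]] Au; have [_] := natmin_some w_rank; apply.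
by exists H; [exact: char_witness_word fb uw Au|exact: rk_basis fb].
Qed.

Lemma leading_crit H0 k (b : 'I_k -> F) (u : word k) (c : {ffun 'I_(size u).+1 -> 'I_(size u).+1}) :
  free_basis H0 b -> evalw b u = w -> leading A p c -> crit phi w (sub_group b c).
Proof.
move=> fb uw /and3P[gc Ac /eqP cp]; have fc := sub_free fb gc; split.
  by apply: char_witness_word fc _ Ac; rewrite evalw_sub_word.
by rewrite w_rank -cp (rk_basis fc).
Qed.

(** A critical subgroup retracts onto the subgroup of its coset type, which
    is therefore a witness too; by minimality of the rank they are equal. *)
Lemma crit_leading H0 k (b : 'I_k -> F) (u : word k) H :
  free_basis H0 b -> evalw b u = w -> crit phi w H -> H `<=` H0 ->
  leading A p (coset_type b u H) /\ H = sub_group b (coset_type b u H).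
Proof.
move=> fb uw [WH Hp] HH0; have [k' [b' [v [fb' vw /Ew_linear_neq0 v1]]]] := char_witness_basis WH.
have k'p : k' = p by move: Hp; rewrite w_rank (rk_basis fb') => -[].
have Hs : is_subgroup H by case: (fb') => -> _; exact: range_subgroup.
have Hu : H (evalw b u) by rewrite uw; case: WH.
have gc := coset_good Hs Hu; have [le eqH [X XE]] := coset_retract fb Hs Hu HH0 fb'.
have Ac : A (sub_word (coset_type b u H)) != 0.
  apply/Ew_linear_neq0 => a; rewrite -(XE _ a _ v); first by rewrite evalw_wsub.
  by rewrite vw evalw_sub_word.
have cp : sub_rank (coset_type b u H) = p.
  apply/eqP; rewrite eqn_leq -{1}k'p le (char_rank_le _ Ac) //.
  by apply: spells_sub => //; exists H0, b.
by split; [rewrite /leading gc Ac /= cp|apply: eqH; rewrite cp].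
Qed.

(** A critical subgroup is the subgroup of its own coset type, again and again
    inside itself. *)
Lemma lead_gt0 H m H0 k (b : 'I_k -> F) (u : word k) : crit phi w H ->
  free_basis H0 b -> evalw b u = w -> H `<=` H0 -> (0 < lead A p m u)%N.
Proof.
move=> CH; elim: m H0 k b u => [//|m IH] H0 k b u fb uw HH0.
have [lc Hc] := crit_leading fb uw CH HH0; have /and3P[gc _ _] := lc.
rewrite /= (bigD1 (coset_type b u H)) //= addn_gt0 (IH _ _ _ _ (sub_free fb gc)) //.
  by rewrite evalw_sub_word.
by rewrite -Hc.
Qed.

Section Count.
Variables (k0 : nat) (b0 : 'I_k0 -> F) (u0 : word k0).
Hypotheses (b0_free : free_basis [set: F] b0) (u0w : evalw b0 u0 = w).
Local Notation critn := #|[pred c : {ffun 'I_(size u0).+1 -> 'I_(size u0).+1} | leading A p c]|.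

Lemma card_crit : (crit phi w #= `I_critn)%card.
Proof.
set S := [pred c | _]; pose f (i : 'I_#|S|) : set F := sub_group b0 (enum_val i).
have Sl (i : 'I_#|S|) : leading A p (enum_val i : {ffun 'I_(size u0).+1 -> 'I_(size u0).+1}).
  exact: (enum_valP i).
have -> : crit phi w = f @` [set: 'I_#|S|].
  apply/seteqP; split=> [H CH|_ [i _ <-]]; last exact: leading_crit b0_free u0w (Sl i).
  have [lc ->] := crit_leading b0_free u0w CH (@subsetT _ H).
  have cS : coset_type b0 u0 H \in S by rewrite inE.
  by exists (enum_rank_in cS (coset_type b0 u0 H)) => //; rewrite /f enum_rankK_in.
apply: card_eq_trans (inj_card_eq _) _; last by rewrite card_eq_sym; exact: card_II.
move=> i j _ _ /(sub_group_inj b0_free) E; apply: enum_val_inj; apply: E.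
  by have /and3P[] := Sl i.
by have /and3P[] := Sl j.
Qed.

(** At each stage distinct leading types give distinct critical subgroups, and
    all of these occur among the types of the original word. *)
Lemma lead_le m H0 k (b : 'I_k -> F) (u : word k) :
  free_basis H0 b -> evalw b u = w -> (lead A p m u <= critn ^ m)%N.
Proof.
elim: m H0 k b u => [|m IH] H0 k b u fb uw; first by rewrite expn0.
rewrite expnS /=; apply: (@leq_trans
  (\sum_(c : {ffun 'I_(size u).+1 -> 'I_(size u).+1} | leading A p c) critn ^ m)%N).
  apply: leq_sum => c /and3P[gc _ _]; apply: (IH _ _ _ _ (sub_free fb gc)).
  by rewrite evalw_sub_word.
rewrite sum_nat_const leq_mul2r; apply/orP; right.
pose f (c : {ffun 'I_(size u).+1 -> 'I_(size u).+1}) := coset_type b0 u0 (sub_group b c).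
have fP c : leading A p c -> leading A p (f c) /\ sub_group b c = sub_group b0 (f c).
  by move=> lc; apply: crit_leading b0_free u0w (leading_crit fb uw lc) _.
rewrite -(card_in_imset (f := f)) => [|c c']; last first.
  move=> lc lc' E; have [_ Ec] := fP c lc; have [_ Ec'] := fP c' lc'.
  have /and3P[gc _ _] := lc; have /and3P[gc' _ _] := lc'.
  by apply: (sub_group_inj fb gc gc'); rewrite Ec Ec' E.
by apply/subset_leq_card/fintype.subsetP => _ /imsetP[c lc ->]; exact: (fP c lc).1.
Qed.
End Count.
End FiniteRank.
End LinearCharacters.

Local Open Scope classical_set_scope.
Local Open Scope complex_scope.
Local Open Scope ring_scope.

Lemma ge0_complex_real (R : realType) (z : R[i]) : 0 <= z -> exists K : R, K%:C = z.
Proof. by move=> z0; exists (complex.Re z); rewrite RRe_real // ger0_real. Qed.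

Lemma pow_one_minusE (C : fieldType) (z : C) p : z != 0 ->
  pow_one_minus z (Some p) = z / z ^+ p.
Proof. by move=> z0; rewrite /= expfzDr // expr1z -exprnN. Qed.

Lemma irr_char1 (R : realType) (K : topGroupType) (phi : K -> R[i]) :
  irr_char phi -> 0 < phi 1%g.
Proof. by case=> d [rho [[r1 _ _] [d0 _] ->]]; rewrite r1 mxtrace1 ltr0n. Qed.

Theorem theorem1p12 (R : realType) (G : topGroupType)
    (G_compact : compact [set: G]) (G_hausdorff : hausdorff_space G)
    (phi : G -> R[i]) (phi_irr : irr_char phi) (phi_nontriv : phi <> (fun=> 1))
    (r : nat) (F : groupType) (x : 'I_r -> F) (F_free : free_basis [set: F] x)
    (w : F) (m : nat) :
  let admissible (n : m.-tuple nat) :=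
    forall i, (0 < tnth n i)%N /\ (min_length w <= tnth n i)%N in
  let chi (n : m.-tuple nat) := iter_ind phi n in
  let E (n : m.-tuple nat) := word_expect [set: F] w (chi n) in
  let N (n : m.-tuple nat) : R[i] := \prod_(i < m) (tnth n i)%:R in
  [/\ exists P Q : mpoly.mpoly m R[i],
        [/\ P \is a mpoly.mpolyOver m [in expect_field R G],
            Q \is a mpoly.mpolyOver m [in expect_field R G]
          & forall n, admissible n ->
              mpoly.meval (fun i => (tnth n i)%:R) Q != 0 /\
              E n = mpoly.meval (fun i => (tnth n i)%:R) P /
                    mpoly.meval (fun i => (tnth n i)%:R) Q],
      exists K : R, forall n, admissible n ->
        `|E n| <= K%:C * pow_one_minus (chi n 1%g) (primitivity_rank w)
    & linear_char phi ->
      exists C : nat,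
        [/\ (0 < C)%N,
            char_rank phi w <> None ->
              exists c : nat, (crit phi w #= `I_c)%card /\ (C <= c ^ m)%N
          & exists K : R, forall n, admissible n ->
              exists e : R[i],
                E n = pow_one_minus (N n) (char_rank phi w) * (C%:R + e) /\
                `|e| <= K%:C * \sum_(i < m) (tnth n i)%:R^-1]].
Proof.
move=> admissible chi E N.
have [k [b [u [fb uw uL]]]] := min_length_basis w F_free.
have Wu : spells w u by exists [set: F], b.
set L := min_length w in uL admissible *.
have uL' : (size u <= L)%N by rewrite uL.
have pr := irr_char_rep_fun phi_irr.
have EE n : E n = wreath_iter (Ew phi) n u.
  rewrite -Ew_iter //; apply: word_expect_basis fb uw; first exact: iter_wreath_compact.
  exact: rep_fun_iter_ind.
have admE n : admissible n -> large L n.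
  by move=> an; apply/all_tnthP => i; have [-> ->] := an i.
have NE n : N n = prodn R[i] n by rewrite /N /prodn big_tuple.
have SE (n : m.-tuple nat) : \sum_(i < m) (tnth n i)%:R^-1 = sum_inv R[i] n.
  by rewrite /sum_inv big_tuple.
split.
- have [p [q [[P PK pP] [Q QK qQ] H]]] : rat_fun (R := R) G L (fun n : m.-tuple nat => E n).
    apply: rat_fun_ext (fun n => esym (EE n)) _; apply: rat_fun_iter uL' => k' v.
    exact: expect_pred_Ew.
  by exists P, Q; split=> // n /admE ln; rewrite -qQ -pP; exact: H.
- have d0 := irr_char1 phi_irr.
  case wp: (primitivity_rank w) => [p|]; last first.
    by exists 0 => n _; rewrite EE (wreath_iter_none G_compact _ phi_irr phi_nontriv Wu wp) normr0 mulr0.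
  have [||K K0 H] := @wreath_iter_bound R[i] (@Ew R G phi) p L (@spells F w) _ _ m k u Wu uL'.
  + by move=> k' v c Wv gc; exact: spells_sub.
  + by move=> ns k' v Wv k'p; exact: (wreath_iter_small G_compact _ phi_irr phi_nontriv Wv wp k'p).
  have [|K' K'E] := @ge0_complex_real R (K / rate p (phi 1%g)).
    by rewrite divr_ge0 // ltW // rate_gt0.
  exists K' => n /admE ln; have N0 := prodn_gt0 R[i] ln.
  rewrite EE K'E /chi iter_ind1 pow_one_minusE ?mulf_neq0 ?gt_eqF //.
  rewrite -/(rate p _) rateM mulrA divfK ?gt_eqF ?rate_gt0 //.
  by apply: H ln; exact: size_tuple.
move=> lin; case wr: (char_rank phi w) => [p|]; last first.
  have u0 := char_rank_none G_compact lin fb uw wr.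
  exists 1%N; split=> //; exists 0 => n _; exists 0.
  by rewrite EE (Ew_linear_iter0 G_compact lin) // /= mul0r normr0 mul0r.
have [[H0 W0 rkH0] _] := natmin_some wr.
have Au := char_witness_setT G_compact lin F_free fb uw W0.
have H0c : crit phi w H0.
  by split=> //; rewrite wr rkH0.
exists (lead (Ew phi) p m u); split.
- exact: (lead_gt0 G_compact lin F_free wr _ H0c fb uw).
- move=> _; exists #|[pred c | leading (u := u) (Ew phi) p c]|; split.
    exact: (card_crit G_compact lin F_free wr fb uw).
  exact: (lead_le G_compact lin F_free wr fb uw _ fb uw).
have [||||K K0 H] := @wreath_iter_lead R[i] (@Ew R G phi) p L (@spells F w) _ _ _ _ m k u Wu uL' Au.
- by move=> k' v c Wv gc; exact: spells_sub.
- by move=> k' v _; exact: Ew_linear1.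
- by move=> k' v Wv Av; exact: (char_rank_le G_compact lin wr Wv Av).
- by move=> ns k' v _; exact: Ew_linear_iter0.
have [K' K'E] := ge0_complex_real K0.
exists K' => n /admE ln; have r0 : 0 < rate p (N n) by rewrite NE rate_gt0 // (prodn_gt0 R[i] ln).
have N0 : N n != 0 by rewrite NE gt_eqF // (prodn_gt0 R[i] ln).
exists (E n / rate p (N n) - (lead (Ew phi) p m u)%:R); split.
  by rewrite addrC subrK pow_one_minusE // mulrC divfK // gt_eqF.
have -> : E n / rate p (N n) - (lead (Ew phi) p m u)%:R
    = (E n - rate p (N n) * (lead (Ew phi) p m u)%:R) / rate p (N n).
  by rewrite mulrBl mulrAC divff ?mul1r // gt_eqF.
rewrite normf_div (gtr0_norm r0) ler_pdivrMr // K'E SE EE NE.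
by apply: H ln; exact: size_tuple.
Qed.
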